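(* Let $R$ be a domain of characteristic $0$, let $F$ be a one-dimensional commutative formal group law over $R$, let $A$ be a generalized Cartan matrix and $\Lambda$ a Demazure lattice for its root datum. The map $\phi=\bigoplus_{i\ge0}\phi_i'$ is a ring isomorphism $\mathrm{Gr}\,\mathbf{D}_F^*\cong\mathcal{N}^*$.
   Context: Root datum: $A=(a_{ij})_{1\le i,j\le n}$ is an integer matrix with $a_{ii}=2$, $-a_{ij}\in\mathbb{Z}_{\ge 0}$ for $i\ne j$, and $a_{ij}=0\Leftrightarrow a_{ji}=0$. Let $\mathfrak{h}$ be a complex vector space of dimension $2n-\mathrm{rank}\,A$ with linearly independent subsets $\{\alpha_1,\dots,\alpha_n\}\subset\mathfrak{h}^*$ (simple roots) and $\{\alpha_1^\vee,\dots,\alpha_n^\vee\}\subset\mathfrak{h}$ (simple coroots) with $a_{ij}=\langle\alpha_j,\alpha_i^\vee\rangle$. The Weyl group $W$ is generated by $s_i(\lambda)=\lambda-\langle\lambda,\alpha_i^\vee\rangle\alpha_i$ on $\mathfrak{h}^*$; $\ell$ is its length function. The set of (real) roots is $\Phi=\{w(\alpha_i)\}$; $\Phi_+=\Phi\cap\sum_i\mathbb{Z}_{\ge0}\alpha_i$, $\Phi_-=-\Phi_+$, $\Phi=\Phi_+\amalg\Phi_-$. For $\alpha=w(\alpha_i)$, $s_\alpha=ws_iw^{-1}$. Demazure lattice: a finitely generated free abelian subgroup $\Lambda$ of $\mathfrak{h}^*$ containing the simple roots, with $\langle\Lambda,\alpha_i^\vee\rangle\subset\mathbb{Z}$ for all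 $i$, such that every simple root can be extended to a $\mathbb{Z}$-basis of $\Lambda$. It is $W$-invariant. Formal group algebra: $S=R[[\Lambda]]_F=R[[x_\lambda\mid\lambda\in\Lambda]]/J$, where $R[[x_\lambda\mid\lambda\in\Lambda]]$ is the completion of the polynomial ring at the kernel of $x_\lambda\mapsto0$, and $J$ is the closure of the ideal generated by $x_0$ and $x_{\lambda+\mu}-F(x_\lambda,x_\mu)$, $\lambda,\mu\in\Lambda$. $W$ acts on $S$ by $w(x_\lambda)=x_{w(\lambda)}$. Let $\mathcal{I}_F$ be the kernel of the augmentation $S\to R$, $x_\lambda\mapsto0$. $\bigoplus_{i\ge0}\mathcal{I}_F^i/\mathcal{I}_F^{i+1}$ is identified with the symmetric algebra $S_R^*(\Lambda)$ by sending the class of $x_\lambda$ to $\lambda$. For $q\in\mathcal{I}_F^i$, $(q)_i\in S_R^i(\Lambda)$ denotes its class in $\mathcal{I}_F^i/\mathcal{I}_F^{i+1}$ (so $(q)_i=0$ if $q\in\mathcal{I}_F^{i+1}$). Twisted group algebra: $Q=S[\frac1{x_\alpha}\mid\alpha\in\Phi_+]$; $Q_W$ is the left $Q$-module with basis $\{\delta_w\}_{w\in W}$ and product $q\delta_w\cdot q'\delta_{w'}=qw(q')\delta_{ww'}$. Set $X_\alpha=\frac1{x_\alpha}(1-\delta_{s_\alpha})$. The formal affine Demazure algebra $\mathbf{D}_F$ is the $R$-subalgebra of $Q_W$ generated by $S$ and all $X_\alpha$, $\alpha\in\Phi$; it contains all $\delta_w$. Dual: $\mathbf{D}_F^*=\mathrm{Hom}_S(\mathbf{D}_F,S)$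 ($\mathbf{D}_F$ as a left $S$-module). It is identified with $\{f\in\mathrm{Hom}_Q(Q_W,Q)\mid f(\mathbf{D}_F)\subseteq S\}$, and is a commutative ring with product dual to the coproduct $q\delta_w\mapsto q\delta_w\otimes\delta_w$, i.e. $(fg)(\delta_w)=f(\delta_w)g(\delta_w)$ for all $w\in W$. Filtration: for $i\ge0$, $(\mathbf{D}_F^* )^{(i)}=\{f\in\mathbf{D}_F^*\mid f(\delta_w)\in\mathcal{I}_F^i\text{ for all }w\in W\}$; $\mathrm{Gr}\,\mathbf{D}_F^*=\bigoplus_{i\ge0}(\mathbf{D}_F^* )^{(i)}/(\mathbf{D}_F^* )^{(i+1)}$ is the associated graded ring. Nil affine Hecke algebra and its dual: let $Q_a=S_R^*(\Lambda)[\frac1\alpha\mid\alpha\in\Phi_+]$ and let $Q_{a,W}$ be the left $Q_a$-module with basis $\{\delta_w^a\}_{w\in W}$ and product $q\delta^a_w\cdot q'\delta^a_{w'}=qw(q')\delta^a_{ww'}$. Put $x_i=-\frac1{\alpha_i}(1-\delta^a_{s_i})$ and $x_w=x_{i_1}\cdots x_{i_l}$ for a reduced expression $w=s_{i_1}\cdots s_{i_l}$ (independent of the choice). $\mathcal{N}\subset Q_{a,W}$ is the subalgebra generated by $S_R^*(\Lambda)$ and the $x_i$; it is a free left $S_R^*(\Lambda)$-module with basis $\{x_w\}_{w\in W}$. Let $Q_{a,W}^*=\mathrm{Hom}_{Q_a}(Q_{a,W},Q_a)$, with product $(fg)(\delta_w^a)=f(\delta_w^a)g(\delta_w^a)$,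 and let $x_w^*\in Q_{a,W}^*$ be given by $x_w^*(x_v)=1$ if $v=w$ and $0$ otherwise. $\mathcal{N}^*\subset Q_{a,W}^*$ is the dual of $\mathcal{N}$ with $S_R^*(\Lambda)$-basis $\{x_w^*\}_{w\in W}$, i.e. the subring of those $f$ with $f(\mathcal{N})\subseteq S_R^*(\Lambda)$ and $f(x_w)=0$ for all but finitely many $w$. The map: $\phi_i\colon(\mathbf{D}_F^* )^{(i)}\to Q_{a,W}^*$ is defined by $\phi_i(f)(\delta_w^a)=(f(\delta_w))_i$; it vanishes on $(\mathbf{D}_F^* )^{(i+1)}$ and induces $\phi_i'\colon(\mathbf{D}_F^* )^{(i)}/(\mathbf{D}_F^* )^{(i+1)}\to Q_{a,W}^*$. *)

(* Defs.v *)
From HB Require Import structures.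
From mathcomp Require Import all_boot all_order all_algebra.
From mathcomp Require Import generic_quotient ring_quotient.
From mathcomp Require Import boolp classical_sets functions cardinality reals.
From mathcomp Require Import complex finmap monalg ring.

Set Implicit Arguments.
Unset Strict Implicit.
Unset Printing Implicit Defensive.

Import GRing.Theory.
Local Open Scope classical_set_scope.
Local Open Scope ring_scope.
Local Open Scope quotient_scope.

(* Quotients and localizations are taken in possibly zero rings, so that  *)
(* forming them needs no properness side condition.                       *)

HB.mixin Record isMulAbsorbing (R : pzRingType) (I : {pred R}) := {
  idealMl : forall a x : R, x \in I -> a * x \in I
}.

#[short(type="idealPred")]
HB.structure Definition IdealPred (R : pzRingType) :=
  {I of isMulAbsorbing R I & GRing.ZmodClosed R I}.

Section Quotient.
Variables (R : comPzRingType) (I : idealPred R).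

Definition quo : Type := Quotient.quot I.
HB.instance Definition _ := GRing.Zmodule.on quo.

Definition quo_pi (x : R) : quo := \pi_(Quotient.quot I) x.
Definition quo_repr (q : quo) : R := repr (q : Quotient.quot I).

Lemma quo_reprK q : quo_pi (quo_repr q) = q.
Proof. exact: reprK. Qed.

Lemma quo_piP x y : quo_pi x = quo_pi y <-> x - y \in I.
Proof. by rewrite Quotient.idealrBE; split=> [/eqP|/eqP]. Qed.

Lemma quo_repr_pi x : quo_repr (quo_pi x) - x \in I.
Proof. by apply/quo_piP; rewrite quo_reprK. Qed.

Lemma quo_pi_is_zmod_morphism : zmod_morphism quo_pi.
Proof. by move=> x y; rewrite /quo_pi !piE. Qed.
HB.instance Definition _ :=
  GRing.isZmodMorphism.Build R quo quo_pi quo_pi_is_zmod_morphism.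

Definition quo_one : quo := quo_pi 1.
Definition quo_mul (p q : quo) : quo := quo_pi (quo_repr p * quo_repr q).

Lemma quo_pi_mul x y : quo_mul (quo_pi x) (quo_pi y) = quo_pi (x * y).
Proof.
apply/quo_piP; set a := quo_repr _; set b := quo_repr _.
have -> : a * b - x * y = b * (a - x) + x * (b - y).
  by rewrite !mulrBr [b * a]mulrC [b * x]mulrC addrA subrK.
by apply: rpredD; apply: idealMl; apply: quo_repr_pi.
Qed.

Lemma quo_mulA : associative quo_mul.
Proof.
move=> p q r; rewrite -(quo_reprK p) -(quo_reprK q) -(quo_reprK r).
by rewrite !quo_pi_mul mulrA.
Qed.

Lemma quo_mulC : commutative quo_mul.
Proof. by move=> p q; rewrite /quo_mul mulrC. Qed.

Lemma quo_mul1 : left_id quo_one quo_mul.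
Proof. by move=> p; rewrite -(quo_reprK p) quo_pi_mul mul1r. Qed.

Lemma quo_mulDl : left_distributive quo_mul +%R.
Proof.
move=> p q r; rewrite -(quo_reprK p) -(quo_reprK q) -(quo_reprK r).
by rewrite -raddfD !quo_pi_mul mulrDl raddfD.
Qed.

HB.instance Definition _ :=
  GRing.Zmodule_isComPzRing.Build quo quo_mulA quo_mulC quo_mul1 quo_mulDl.

Lemma quo_pi_is_monoid_morphism : monoid_morphism quo_pi.
Proof. by split=> // x y; rewrite -quo_pi_mul. Qed.
HB.instance Definition _ :=
  GRing.isMonoidMorphism.Build R quo quo_pi quo_pi_is_monoid_morphism.

End Quotient.

Section IdealSpan.
Variables (R : comPzRingType) (G : set R).

Definition ideal_span : {pred R} := fun x =>
  `[< exists2 s : seq (R * R),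
        (forall p, p \in s -> G p.2) & x = \sum_(p <- s) p.1 * p.2 >].

Lemma ideal_spanP x : reflect (exists2 s : seq (R * R),
  (forall p, p \in s -> G p.2) & x = \sum_(p <- s) p.1 * p.2)
  (x \in ideal_span).
Proof. exact: asboolP. Qed.

Lemma ideal_span_Ml a x : x \in ideal_span -> a * x \in ideal_span.
Proof.
move=> /ideal_spanP[s sG ->]; apply/ideal_spanP.
exists [seq (a * p.1, p.2) | p <- s].
  by move=> p /mapP[q qs ->] /=; apply: sG.
by rewrite big_map mulr_sumr; apply: eq_bigr => p _; rewrite mulrA.
Qed.

Lemma ideal_span_zmod : zmod_closed ideal_span.
Proof.
split; first by apply/ideal_spanP; exists [::]; rewrite ?big_nil // => ?; rewrite in_nil.
move=> x y /ideal_spanP[s sG ->]; rewrite -mulN1r => /(ideal_span_Ml (-1)).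
move=> /ideal_spanP[t tG ->]; apply/ideal_spanP; exists (s ++ t).
  by move=> p; rewrite mem_cat => /orP[/sG|/tG].
by rewrite big_cat.
Qed.

HB.instance Definition _ := GRing.isZmodClosed.Build R ideal_span ideal_span_zmod.
HB.instance Definition _ := isMulAbsorbing.Build R ideal_span ideal_span_Ml.

End IdealSpan.

Fixpoint ideal_pow (R : comPzRingType) (I : set R) (k : nat) : set R :=
  if k is k'.+1 then
    [set x | x \in ideal_span [set a * b | a in I & b in ideal_pow I k']]
  else setT.

(* the inverse of an invertible element (0 for the other elements) *)
Definition cinv (R : comPzRingType) (x : R) : R := xget 0 [set y | x * y = 1].

(* The localization S[1/g | g in G]: fractions whose denominators are     *)
(* finite products of elements of G.                                      *)
Section Localization.
Variables (S : comPzRingType) (G : set S).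

Definition mulspan : {pred S} := fun t =>
  `[< exists2 s : seq S, (forall g, g \in s -> G g) & t = \prod_(g <- s) g >].

Lemma mulspanP t : reflect
  (exists2 s : seq S, (forall g, g \in s -> G g) & t = \prod_(g <- s) g)
  (t \in mulspan).
Proof. exact: asboolP. Qed.

Lemma mulspan1 : 1 \in mulspan.
Proof. by apply/mulspanP; exists [::]; rewrite ?big_nil // => ?; rewrite in_nil. Qed.

Lemma mulspanM x y : x \in mulspan -> y \in mulspan -> x * y \in mulspan.
Proof.
move=> /mulspanP[s sG ->] /mulspanP[t tG ->]; apply/mulspanP; exists (s ++ t).
  by move=> g; rewrite mem_cat => /orP[/sG|/tG].
by rewrite big_cat.
Qed.

Record den := Den { den_val : S; _ : den_val \in mulspan }.
HB.instance Definition _ := [isSub for den_val].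
HB.instance Definition _ := [Choice of den by <:].

Definition den1 := Den mulspan1.
Definition denM (s t : den) := Den (mulspanM (valP s) (valP t)).

Definition loc_equiv (x y : S * den) :=
  `[< exists2 u, u \in mulspan
      & u * (x.1 * den_val y.2) = u * (y.1 * den_val x.2) >].

Lemma loc_equiv_is_equiv : equiv_class_of loc_equiv.
Proof.
split=> [x|x y|y x z].
- by apply/asboolP; exists 1 => //; apply: mulspan1.
- by apply/asboolP/asboolP => -[u uT e]; exists u.
move=> /asboolP[u uT e] /asboolP[v vT e']; apply/asboolP.
exists (u * v * den_val y.2).
  by apply: mulspanM; [apply: mulspanM | apply: valP].
have -> : u * v * den_val y.2 * (x.1 * den_val z.2)
  = v * den_val z.2 * (u * (x.1 * den_val y.2)) by ring.
rewrite e.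
have -> : v * den_val z.2 * (u * (y.1 * den_val x.2))
  = u * den_val x.2 * (v * (y.1 * den_val z.2)) by ring.
by rewrite e'; ring.
Qed.

Canonical loc_equiv_rel := EquivRelPack loc_equiv_is_equiv.
Canonical loc_encModRel := defaultEncModRel loc_equiv.

Definition loc : Type := {eq_quot loc_equiv}.
HB.instance Definition _ := Choice.on loc.

Definition frac (s : S) (t : den) : loc := \pi_({eq_quot loc_equiv}) (s, t).

Lemma fracP s t s' t' : frac s t = frac s' t' <->
  exists2 u, u \in mulspan & u * (s * den_val t') = u * (s' * den_val t).
Proof.
rewrite /frac; split=> [/eqmodP/asboolP //|h].
by apply/eqmodP/asboolP.
Qed.

Lemma fracW (q : loc) : exists s t, q = frac s t.
Proof.
exists (repr (q : {eq_quot loc_equiv})).1, (repr (q : {eq_quot loc_equiv})).2.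
by rewrite /frac -surjective_pairing reprK.
Qed.

Definition loc_lift2 (f : S -> den -> S -> den -> S) (p q : loc) : loc :=
  let x := repr (p : {eq_quot loc_equiv}) in
  let y := repr (q : {eq_quot loc_equiv}) in
  frac (f x.1 x.2 y.1 y.2) (denM x.2 y.2).

Lemma frac_repr s t : exists2 u, u \in mulspan &
  let x := repr (frac s t : {eq_quot loc_equiv}) in
  u * (x.1 * den_val t) = u * (s * den_val x.2).
Proof.
by move=> /=; apply/fracP; rewrite /frac -surjective_pairing reprK.
Qed.

Definition loc_add := loc_lift2 (fun s t s' t' => s * den_val t' + s' * den_val t).
Definition loc_mul := loc_lift2 (fun s _ s' _ => s * s').

Lemma frac_add s t s' t' : loc_add (frac s t) (frac s' t') =
  frac (s * den_val t' + s' * den_val t) (denM t t').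
Proof.
have [u uT] := frac_repr s t; have [v vT] := frac_repr s' t'.
rewrite /loc_add /loc_lift2 /=; move: (repr _) (repr _) => [a d] [b c] /= ev eu.
apply/fracP; exists (u * v); first exact: mulspanM.
apply/subr0_eq => /=.
transitivity (v * den_val t' * den_val c * (u * (a * den_val t) - u * (s * den_val d))
  + u * den_val t * den_val d * (v * (b * den_val t') - v * (s' * den_val c))).
  by ring.
by rewrite ev eu !subrr !mulr0 addr0.
Qed.

Lemma frac_mul s t s' t' :
  loc_mul (frac s t) (frac s' t') = frac (s * s') (denM t t').
Proof.
have [u uT] := frac_repr s t; have [v vT] := frac_repr s' t'.
rewrite /loc_mul /loc_lift2 /=; move: (repr _) (repr _) => [a d] [b c] /= ev eu.
apply/fracP; exists (u * v); first exact: mulspanM.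
rewrite /=; transitivity ((u * (a * den_val t)) * (v * (b * den_val t'))).
  by ring.
by rewrite ev eu; ring.
Qed.

Lemma frac_eq s t s' t' : s * den_val t' = s' * den_val t ->
  frac s t = frac s' t'.
Proof. by move=> e; apply/fracP; exists 1; rewrite ?mulspan1 // !mul1r. Qed.

Definition loc_zero : loc := frac 0 den1.
Definition loc_one : loc := frac 1 den1.
Definition loc_opp (p : loc) : loc := loc_mul (frac (-1) den1) p.

Lemma loc_addA : associative loc_add.
Proof.
move=> p q r; have [a [s ->]] := fracW p; have [b [t ->]] := fracW q.
have [c [u ->]] := fracW r; rewrite !frac_add; apply: frac_eq => /=; ring.
Qed.

Lemma loc_addC : commutative loc_add.
Proof.
move=> p q; have [a [s ->]] := fracW p; have [b [t ->]] := fracW q.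
rewrite !frac_add; apply: frac_eq => /=; ring.
Qed.

Lemma loc_add0 : left_id loc_zero loc_add.
Proof.
move=> p; have [a [s ->]] := fracW p.
rewrite frac_add; apply: frac_eq => /=; ring.
Qed.

Lemma loc_addN : left_inverse loc_zero loc_opp loc_add.
Proof.
move=> p; have [a [s ->]] := fracW p.
rewrite /loc_opp frac_mul frac_add; apply: frac_eq => /=; ring.
Qed.

HB.instance Definition _ :=
  GRing.isZmodule.Build loc loc_addA loc_addC loc_add0 loc_addN.

Lemma loc_mulA : associative loc_mul.
Proof.
move=> p q r; have [a [s ->]] := fracW p; have [b [t ->]] := fracW q.
have [c [u ->]] := fracW r; rewrite !frac_mul; apply: frac_eq => /=; ring.
Qed.

Lemma loc_mulC : commutative loc_mul.
Proof.
move=> p q; have [a [s ->]] := fracW p; have [b [t ->]] := fracW q.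
rewrite !frac_mul; apply: frac_eq => /=; ring.
Qed.

Lemma loc_mul1 : left_id loc_one loc_mul.
Proof.
move=> p; have [a [s ->]] := fracW p.
rewrite frac_mul; apply: frac_eq => /=; ring.
Qed.

Lemma loc_mulDl : left_distributive loc_mul +%R.
Proof.
move=> p q r; have [a [s ->]] := fracW p; have [b [t ->]] := fracW q.
have [c [u ->]] := fracW r.
rewrite -[_ + _]/(loc_add _ _) -[RHS]/(loc_add _ _) !(frac_mul, frac_add); apply: frac_eq => /=; ring.
Qed.

HB.instance Definition _ :=
  GRing.Zmodule_isComPzRing.Build loc loc_mulA loc_mulC loc_mul1 loc_mulDl.

Definition loc_in (s : S) : loc := frac s den1.

Lemma loc_in_is_zmod_morphism : zmod_morphism loc_in.
Proof.
move=> s t; apply/esym/eqP; rewrite subr_eq; apply/eqP.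
rewrite -[RHS]/(loc_add _ _) frac_add.
by apply: frac_eq => /=; ring.
Qed.
HB.instance Definition _ :=
  GRing.isZmodMorphism.Build S loc loc_in loc_in_is_zmod_morphism.

Lemma loc_in_is_monoid_morphism : monoid_morphism loc_in.
Proof.
split=> // s t; rewrite -[RHS]/(loc_mul _ _) frac_mul.
by apply: frac_eq => /=; ring.
Qed.
HB.instance Definition _ :=
  GRing.isMonoidMorphism.Build S loc loc_in loc_in_is_monoid_morphism.

(* The extension of a ring endomorphism f of S to the localization:        *)
(* s / t |-> f(s) / f(t), meaningful when f maps denominators to elements  *)
(* that are invertible in the localization.                                *)
Definition loc_ext (f : S -> S) (q : loc) : loc :=
  xget 0 [set q' | exists s t,
    q = frac s t /\ q' = loc_in (f s) * cinv (loc_in (f (den_val t)))].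

End Localization.

(* Sequences (a_d) with the Cauchy product, i.e. B[[t]].                  *)
Section Series.
Variable B : comPzRingType.

Record series := Series { coefs : nat -> B }.
HB.instance Definition _ := [isNew for coefs].
HB.instance Definition _ := [Choice of series by <:].

Lemma seriesP (a b : series) : coefs a =1 coefs b -> a = b.
Proof. by move=> e; apply: val_inj; apply/funext. Qed.

Definition ser_zero := Series (fun=> 0).
Definition ser_opp a := Series (fun d => - coefs a d).
Definition ser_add a b := Series (fun d => coefs a d + coefs b d).
Definition ser_one := Series (fun d => (d == 0%N)%:R).
Definition ser_mul a b :=
  Series (fun d => \sum_(i < d.+1) coefs a i * coefs b (d - i)%N).

Lemma ser_addA : associative ser_add.
Proof. by move=> a b c; apply/seriesP => d /=; rewrite addrA. Qed.

Lemma ser_addC : commutative ser_add.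
Proof. by move=> a b; apply/seriesP => d /=; rewrite addrC. Qed.

Lemma ser_add0 : left_id ser_zero ser_add.
Proof. by move=> a; apply/seriesP => d /=; rewrite add0r. Qed.

Lemma ser_addN : left_inverse ser_zero ser_opp ser_add.
Proof. by move=> a; apply/seriesP => d /=; rewrite addNr. Qed.

HB.instance Definition _ :=
  GRing.isZmodule.Build series ser_addA ser_addC ser_add0 ser_addN.

Lemma ser_mul_rev a b d :
  coefs (ser_mul a b) d = \sum_(i < d.+1) coefs a (d - i)%N * coefs b i.
Proof.
rewrite /= (reindex_inj rev_ord_inj) /=.
by apply: eq_bigr => i _; rewrite !subSS subKn // -ltnS.
Qed.

Lemma ser_mulC : commutative ser_mul.
Proof.
move=> a b; apply/seriesP => d; rewrite ser_mul_rev /=.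
by apply: eq_bigr => i _; rewrite mulrC.
Qed.

Lemma ser_mulA : associative ser_mul.
Proof.
move=> p q r; apply/seriesP => i; rewrite [RHS]ser_mul_rev [LHS]/=.
pose coef3 j k := coefs p j * (coefs q (i - j - k)%N * coefs r k).
transitivity (\sum_(j < i.+1) \sum_(k < i.+1 | (k <= i - j)%N) coef3 j k).
  apply: eq_bigr => /= j _; rewrite -[X in _ * X]/(coefs (ser_mul q r) _).
  rewrite ser_mul_rev big_distrr /=.
  by rewrite (big_ord_narrow_leq (leq_subr _ _)).
rewrite (exchange_big_dep predT) //=; apply: eq_bigr => k _.
transitivity (\sum_(j < i.+1 | (j <= i - k)%N) coef3 j k).
  apply: eq_bigl => j; rewrite -ltnS -(ltnS j) -!subSn ?leq_ord //.
  by rewrite -subn_gt0 -(subn_gt0 j) -!subnDA addnC.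
rewrite (big_ord_narrow_leq (leq_subr _ _)) big_distrl /=.
by apply: eq_bigr => j _; rewrite /coef3 -!subnDA addnC mulrA.
Qed.

Lemma ser_mul1 : left_id ser_one ser_mul.
Proof.
move=> a; apply/seriesP => d /=; rewrite big_ord_recl /= mul1r subn0.
by rewrite big1 ?addr0 // => i _; rewrite mul0r.
Qed.

Lemma ser_mulDl : left_distributive ser_mul +%R.
Proof.
move=> a b c; apply/seriesP => d /=; rewrite -big_split /=.
by apply: eq_bigr => i _; rewrite mulrDl.
Qed.

HB.instance Definition _ :=
  GRing.Zmodule_isComPzRing.Build series ser_mulA ser_mulC ser_mul1 ser_mulDl.

Lemma coefs0 d : coefs 0 d = 0. Proof. by []. Qed.
Lemma coefsN (a : series) d : coefs (- a) d = - coefs a d. Proof. by []. Qed.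
Lemma coefsD (a b : series) d : coefs (a + b) d = coefs a d + coefs b d.
Proof. by []. Qed.
Lemma coefsB (a b : series) d : coefs (a - b) d = coefs a d - coefs b d.
Proof. by []. Qed.
Lemma coefs1 d : coefs 1 d = (d == 0%N)%:R. Proof. by []. Qed.
Lemma coefsM (a b : series) d :
  coefs (a * b) d = \sum_(i < d.+1) coefs a i * coefs b (d - i)%N.
Proof. by []. Qed.

Definition ser_mono d (b : B) := Series (fun i => if i == d then b else 0).

End Series.

(* Polynomials in (possibly infinitely many) variables x_k, k in K, and   *)
(* the completion R[[x_k | k in K]] of R[x_k | k in K] at the kernel I of *)
(* x_k |-> 0. As I^d is spanned by the monomials of degree at least d,    *)
(* the completion lim_d R[x]/I^d is the product of the homogeneous        *)
(* components of R[x].                                                    *)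
Section PowerSeries.
Variables (R : idomainType) (K : choiceType).

Definition homog (d : nat) : {pred {malg R[{cmonom K}]}} :=
  fun p => `[< forall m, p@_m != 0 -> mdeg m = d >].

Lemma homogP d (p : {malg R[{cmonom K}]}) :
  reflect (forall m, p@_m != 0 -> mdeg m = d) (p \in homog d).
Proof. exact: asboolP. Qed.

Lemma homog_zmod d : zmod_closed (homog d).
Proof.
split=> [|p q /homogP hp /homogP hq]; apply/homogP => m.
  by rewrite mcoeff0 eqxx.
rewrite mcoeffB; have [p0|/hp //] := eqVneq p@_m 0.
by rewrite p0 sub0r oppr_eq0 => /hq.
Qed.
HB.instance Definition _ d := GRing.isZmodClosed.Build _ (homog d) (homog_zmod d).

Lemma homogM d e p q : p \in homog d -> q \in homog e -> p * q \in homog (d + e).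
Proof.
move=> /homogP hp /homogP hq; rewrite malgME.
rewrite rpred_sum // => a _; rewrite rpred_sum // => b _.
apply/homogP => m; rewrite mcoeffU; case: (_ =P m) => [<-|_]; last by rewrite mulr0n eqxx.
rewrite mulr1n mulf_eq0 negb_or => /andP[/hp <- /hq <-]; exact: mdegM.
Qed.

Lemma homog1 : 1 \in homog 0.
Proof.
by apply/homogP => m; rewrite mcoeff1; case: (m =P _) => [->|_]; rewrite ?mdeg1 ?mulr0n ?eqxx.
Qed.

Definition homogs : {pred series {malg R[{cmonom K}]}} :=
  fun a => `[< forall d, coefs a d \in homog d >].

Lemma homogsP a : reflect (forall d, coefs a d \in homog d) (a \in homogs).
Proof. exact: asboolP. Qed.

Lemma homogs_subring : subring_closed homogs.
Proof.
split=> [|a b /homogsP ha /homogsP hb|a b /homogsP ha /homogsP hb];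
  apply/homogsP => d.
- by rewrite coefs1; have [->|_] := eqVneq d 0%N; rewrite ?homog1 ?rpred0.
- by rewrite coefsB rpredB.
- rewrite coefsM rpred_sum // => i _.
  have h := homogM (ha i) (hb (d - i)%N).
  have e : (i + (d - i))%N = d by rewrite subnKC // -ltnS.
  by rewrite e in h; exact: h.
Qed.
HB.instance Definition _ := GRing.isSubringClosed.Build _ homogs homogs_subring.

Record mseries := MSeries { mser :> series {malg R[{cmonom K}]};
                            _ : mser \in homogs }.
HB.instance Definition _ := [isSub for mser].
HB.instance Definition _ := [Choice of mseries by <:].
HB.instance Definition _ := GRing.SubChoice_isSubComPzRing.Build _ _ mseries
  (subringClosedP homogs).

Lemma homogC c : c%:MP \in homog 0.
Proof.
apply/homogP => m; rewrite mcoeffC; case: (m =P _) => [->|_].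
  by rewrite mdeg1.
by rewrite mulr0n eqxx.
Qed.

Lemma homogZ d c p : p \in homog d -> c *: p \in homog d.
Proof. by move=> hp; rewrite -mul_malgC -[d]add0n homogM ?homogC. Qed.

Definition hcomp (d : nat) (p : {malg R[{cmonom K}]}) : {malg R[{cmonom K}]} :=
  \sum_(m <- msupp p | mdeg m == d) << p@_m *g m >>.

Lemma hcomp_homog d p : hcomp d p \in homog d.
Proof.
rewrite rpred_sum // => m /eqP md; apply/homogP => m'; rewrite mcoeffU.
by case: (m =P m') => [<-|_] //; rewrite mulr0n eqxx.
Qed.

Lemma poly_mser_subproof p : Series (hcomp^~ p) \in homogs.
Proof. by apply/homogsP => d; apply: hcomp_homog. Qed.

Definition poly_mser p : mseries := MSeries (poly_mser_subproof p).

Definition mvar (k : K) : {malg R[{cmonom K}]} := mkmalgU (ucm k) 1.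

(* the constant coefficient, i.e. the value at x_k |-> 0 *)
Definition mser_aug (a : mseries) : R := (coefs a 0)@_(mone : {cmonom K}).

(* The power series F(a, b) for a and b without constant coefficient:       *)
(* then a^i b^j contributes to the degree d component only if i + j <= d.   *)
Section Substitution.
Variables (F : nat -> nat -> R) (a b : mseries).

Lemma fsubst_subproof : Series (fun d => \sum_(i < d.+1) \sum_(j < d.+1)
  F i j *: coefs (a ^+ i * b ^+ j : mseries) d) \in homogs.
Proof.
apply/homogsP => d; rewrite rpred_sum // => i _; rewrite rpred_sum // => j _.
by apply: homogZ; have /homogsP := valP (a ^+ i * b ^+ j).
Qed.

Definition fsubst : mseries := MSeries fsubst_subproof.
End Substitution.

Section Renaming.
Variable s : K -> K.

Definition poly_ren : {malg R[{cmonom K}]} -> {malg R[{cmonom K}]} :=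
  mmap (fun c : R => c%:MP)
       (fun m : {cmonom K} => \prod_(k <- finsupp m) mvar (s k) ^+ m k).

Lemma mvar_homog k : mvar k \in homog 1.
Proof.
apply/homogP => m; rewrite mcoeffU; case: (_ =P m) => [<-|_].
  by rewrite mdegU.
by rewrite mulr0n eqxx.
Qed.

Lemma poly_ren_homog d p : p \in homog d -> poly_ren p \in homog d.
Proof.
move=> /homogP hp; rewrite /poly_ren mmapE big_seq rpred_sum // => m.
rewrite -mcoeff_neq0 => /hp <-; rewrite mul_malgC homogZ //.
rewrite mdegE; elim: (enum_fset _) => [|k r ih]; first by rewrite !big_nil homog1.
rewrite !big_cons homogM //.
elim: (m k) => [|n ihn]; first by rewrite homog1.
by rewrite exprS -add1n homogM // mvar_homog.
Qed.

Lemma mser_ren_subproof (a : mseries) :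
  Series (fun d => poly_ren (coefs a d)) \in homogs.
Proof.
by apply/homogsP => d; apply: poly_ren_homog; have /homogsP := valP a.
Qed.

Definition mser_ren (a : mseries) : mseries := MSeries (mser_ren_subproof a).
End Renaming.

End PowerSeries.

(* F(x, y) = sum_(i, j) F i j x^i y^j; associativity is an identity in    *)
(* R[[x_0, x_1, x_2]].                                                    *)
Record fgl (R : idomainType) := FGL {
  fgl_coef :> nat -> nat -> R;
  fgl_unit : forall i, fgl_coef i 0%N = (i == 1%N)%:R;
  fgl_comm : forall i j, fgl_coef i j = fgl_coef j i;
  fgl_assoc :
    let x (k : nat) : mseries R 'I_3 := poly_mser (mvar R (inord k)) in
    fsubst fgl_coef (fsubst fgl_coef (x 0%N) (x 1%N)) (x 2%N) =
    fsubst fgl_coef (x 0%N) (fsubst fgl_coef (x 1%N) (x 2%N))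
}.

Definition gen_cartan_matrix (n : nat) (A : 'M[int]_n) :=
  [/\ forall i, A i i = 2,
      forall i j, i != j -> A i j <= 0
    & forall i j, A i j = 0 <-> A j i = 0].

Record root_datum (C : fieldType) (n : nat) (A : 'M[int]_n) := RootDatum {
  rd_gcm : gen_cartan_matrix A;
  rd_h : vectType C;
  rd_root : 'I_n -> 'Hom(rd_h, C^o);
  rd_coroot : 'I_n -> rd_h;
  rd_dim : \dim {: rd_h} = (n.*2 - \rank (map_mx intr A : 'M[C]_n))%N;
  rd_root_free : free [tuple rd_root i | i < n];
  rd_coroot_free : free [tuple rd_coroot i | i < n];
  rd_pairing : forall i j, rd_root j (rd_coroot i) = (A i j)%:~R
}.

Section Weyl.
Variables (C : fieldType) (n : nat) (A : 'M[int]_n) (D : root_datum C A).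
Local Notation V := 'Hom(rd_h D, C^o).

Definition refl_fun (i : 'I_n) (l : V) : V :=
  l - (l (rd_coroot D i) : C) *: rd_root D i.

Lemma refl_fun_is_linear i : linear (refl_fun i).
Proof.
move=> a l m; rewrite /refl_fun !lfunE /= scalerBr.
rewrite addrACA -opprD scalerA -scalerDl; congr (_ - _ *: _).
by rewrite lfunE.
Qed.
HB.instance Definition _ i :=
  GRing.isLinear.Build C V V _ (refl_fun i) (refl_fun_is_linear i).

Definition refl (i : 'I_n) : 'End(V) := linfun (refl_fun i).

Definition refl_word (s : seq 'I_n) : 'End(V) :=
  foldr (fun i w => (refl i \o w)%VF) \1%VF s.

Definition weyl_pred : {pred 'End(V)} := fun w => `[< exists s, w = refl_word s >].

(* closed under inverses, since the simple reflections are involutions *)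
Record weyl := Weyl { weyl_val :> 'End(V); _ : weyl_val \in weyl_pred }.
HB.instance Definition _ := [isSub for weyl_val].
HB.instance Definition _ := [Choice of weyl by <:].

Lemma weyl_word_subproof s : refl_word s \in weyl_pred.
Proof. by apply/asboolP; exists s. Qed.

Definition weyl_word (s : seq 'I_n) : weyl := Weyl (weyl_word_subproof s).

Lemma weyl_wordP (w : weyl) : exists s, w = weyl_word s.
Proof. by have /asboolP[s e] := valP w; exists s; apply: val_inj. Qed.

Lemma refl_word_cat s t : refl_word (s ++ t) = (refl_word s \o refl_word t)%VF.
Proof.
elim: s => [|i s ih] /=; first by rewrite comp_lfun1l.
by rewrite ih comp_lfunA.
Qed.

Lemma weyl_mul_subproof (v w : weyl) : (v \o w)%VF \in weyl_pred.
Proof.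
have [s ->] := weyl_wordP v; have [t ->] := weyl_wordP w.
by apply/asboolP; exists (s ++ t); rewrite refl_word_cat.
Qed.

Definition weyl_mul v w := Weyl (weyl_mul_subproof v w).
Definition weyl_one := weyl_word [::].
Definition weyl_inv w := weyl_word (rev (sval (cid (weyl_wordP w)))).

Lemma refl_refl i : (refl i \o refl i)%VF = \1%VF.
Proof.
apply/lfunP => l; rewrite comp_lfunE id_lfunE.
rewrite [refl i l]lfunE [LHS]lfunE /= /refl_fun.
set c : C := l _; rewrite add_lfunE opp_lfunE scale_lfunE rd_pairing.
case: (rd_gcm D) => -> _ _; rewrite -[_%:~R]/(2 : C) -/c.
rewrite -[c *: (2 : C^o)]/(c * 2) -addrA -opprD -scalerDl.
by rewrite mulr_natr mulr2n opprD !addrA addrK subrr scale0r subr0.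
Qed.

Lemma refl_word_rev s : (refl_word s \o refl_word (rev s))%VF = \1%VF.
Proof.
elim: s => [|i s ih] /=; first by rewrite comp_lfun1l.
rewrite rev_cons -cats1 refl_word_cat /= comp_lfun1r -!comp_lfunA.
by rewrite (comp_lfunA (refl_word s)) ih comp_lfun1l refl_refl.
Qed.

Lemma weyl_mulA : associative weyl_mul.
Proof. by move=> u v w; apply: val_inj; rewrite /= comp_lfunA. Qed.

Lemma weyl_mul1 : left_id weyl_one weyl_mul.
Proof. by move=> w; apply: val_inj; rewrite /= comp_lfun1l. Qed.

Lemma weyl_mulr1 : right_id weyl_one weyl_mul.
Proof. by move=> w; apply: val_inj; rewrite /= comp_lfun1r. Qed.

Lemma weyl_mulV : right_inverse weyl_one weyl_inv weyl_mul.
Proof.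
move=> w; apply: val_inj; rewrite /weyl_inv; case: cid => s /= e.
by rewrite {1}e refl_word_rev.
Qed.

Lemma weyl_mulVl : left_inverse weyl_one weyl_inv weyl_mul.
Proof.
move=> w; apply: val_inj; rewrite /weyl_inv; case: cid => s /= e.
by rewrite {1}e /= -{2}[s]revK refl_word_rev.
Qed.

HB.instance Definition _ := isGroup.Build weyl
  weyl_mulA weyl_mul1 weyl_mulr1 weyl_mulVl weyl_mulV.

Definition simple_refl (i : 'I_n) : weyl := weyl_word [:: i].

Definition reduced (s : seq 'I_n) : Prop :=
  forall t, weyl_word t = weyl_word s -> (size s <= size t)%N.

Definition red_word (w : weyl) : seq 'I_n :=
  xget [::] [set s | weyl_word s = w /\ reduced s].

Definition Zbasis (L : {pred V}) (r : nat) (b : 'I_r -> V) : Prop :=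
  (forall l, l \in L <-> exists c : 'I_r -> int, l = \sum_i b i *~ c i) /\
  (forall c : 'I_r -> int, \sum_i b i *~ c i = 0 -> forall i, c i = 0).

Record demazure_lattice := DemazureLattice {
  dl_pred :> zmodClosed V;
  dl_free : exists r (b : 'I_r -> V), Zbasis dl_pred b;
  dl_root : forall i, rd_root D i \in dl_pred;
  dl_int : forall l i, l \in dl_pred -> exists z : int, l (rd_coroot D i) = z%:~R;
  dl_ext : forall i, exists r (b : 'I_r -> V) (k : 'I_r),
    Zbasis dl_pred b /\ b k = rd_root D i
}.

Section Lattice.
Variable L : demazure_lattice.

Record lat := Lat { lat_val :> V; _ : lat_val \in (L : {pred V}) }.
HB.instance Definition _ := [isSub for lat_val].
HB.instance Definition _ := [Choice of lat by <:].
HB.instance Definition _ := GRing.SubChoice_isSubZmodule.Build _ _ lat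
  (zmodClosedP L).

Lemma weyl_lat_subproof (w : weyl) (l : lat) : w l \in (L : {pred V}).
Proof.
have [s ->] := weyl_wordP w; elim: s => [|i s ih] /=.
  by rewrite lfunE; apply: valP.
rewrite comp_lfunE lfunE /= /refl_fun; have [z ->] := dl_int i ih.
by rewrite scaler_int rpredB ?rpredMz ?dl_root.
Qed.

Definition weyl_lat (w : weyl) (l : lat) : lat := Lat (weyl_lat_subproof w l).

Definition simple_root (i : 'I_n) : lat := Lat (dl_root L i).

Definition roots : set lat := [set a | exists w i, a = weyl_lat w (simple_root i)].
Definition pos_roots : set lat :=
  [set a | roots a /\ exists c : 'I_n -> nat, a = \sum_i simple_root i *+ c i].

End Lattice.
End Weyl.

Arguments roots {C n A D} L _.
Arguments pos_roots {C n A D} L _.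

(* The closure of the ideal generated by G for the adic topology, in      *)
(* which the series of order at least k, k in nat, are a basis of         *)
(* neighbourhoods of 0.                                                   *)
Section AdicClosure.
Variables (R : idomainType) (K : choiceType) (G : set (mseries R K)).

Definition ideal_closure : {pred mseries R K} := fun a =>
  `[< forall k, exists2 b, b \in ideal_span G &
        forall d, (d < k)%N -> coefs a d = coefs b d >].

Lemma ideal_closure_zmod : zmod_closed ideal_closure.
Proof.
split=> [|a b /asboolP ha /asboolP hb]; apply/asboolP => k.
  by exists 0; rewrite ?rpred0.
have [a' Ga ea] := ha k; have [b' Gb eb] := hb k.
by exists (a' - b') => [|d dk]; rewrite ?rpredB // !coefsB ea ?eb.
Qed.
HB.instance Definition _ :=
  GRing.isZmodClosed.Build _ ideal_closure ideal_closure_zmod.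

Lemma coefs_mserM (a b : mseries R K) d : coefs (a * b) d =
  \sum_(i < d.+1) (coefs a i * coefs b (d - i)%N : {malg R[{cmonom K}]}).
Proof. by []. Qed.

Lemma ideal_closure_Ml a b : b \in ideal_closure -> a * b \in ideal_closure.
Proof.
move=> /asboolP hb; apply/asboolP => k; have [b' Gb eb] := hb k.
exists (a * b') => [|d dk]; first exact: (ideal_span_Ml a Gb).
rewrite [LHS]coefs_mserM [RHS]coefs_mserM; apply: eq_bigr => i _.
by rewrite eb // (leq_ltn_trans _ dk) // leq_subr.
Qed.
HB.instance Definition _ :=
  isMulAbsorbing.Build _ ideal_closure ideal_closure_Ml.
End AdicClosure.

(* The left Q-module with basis delta_w, w in W, with the twisted product *)
(* (q delta_v) (q' delta_w) = q v(q') delta_(v w). A Q-linear form f on   *)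
(* it is given by its values f w at the delta_w, so that the dual is the  *)
(* ring W -> Q of functions with the pointwise product.                   *)
Section Twisted.
Variables (W : groupType) (Q : comPzRingType) (act : W -> Q -> Q).

Definition tw_mul (a b : {malg Q[W]}) : {malg Q[W]} :=
  \sum_(v <- msupp a) \sum_(w <- msupp b)
    mkmalgU (v * w)%g (a@_v * act v b@_w).

Definition tw_delta (w : W) : {malg Q[W]} := mkmalgU w 1.
Definition tw_scal (q : Q) : {malg Q[W]} := mkmalgU 1%g q.

(* The subring generated by G. It is an R-subalgebra when R maps to Q and *)
(* G contains the image of R.                                             *)
Inductive tw_subalg (G : set {malg Q[W]}) : {malg Q[W]} -> Prop :=
| TwGen z of G z : tw_subalg G z
| TwOne : tw_subalg G (tw_scal 1)
| TwSub y z of tw_subalg G y & tw_subalg G z : tw_subalg G (y - z)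
| TwMul y z of tw_subalg G y & tw_subalg G z : tw_subalg G (tw_mul y z).

Definition tw_eval (f : W -> Q) (z : {malg Q[W]}) : Q :=
  \sum_(w <- msupp z) z@_w * f w.

End Twisted.

Section AssociatedGraded.
Variable B : comPzRingType.

Record ring_filtration (fil : nat -> set B) : Prop := RingFiltration {
  fil0 : forall i, fil i 0;
  filB : forall i a b, fil i a -> fil i b -> fil i (a - b);
  filS : forall i a, fil i.+1 a -> fil i a;
  fil1 : fil 0%N 1;
  filM : forall i j a b, fil i a -> fil j b -> fil (i + j)%N (a * b)
}.

Variables (fil : nat -> set B) (hfil : ring_filtration fil).

(* bigoplus_i (fil i) t^i, as a subring of B[t] *)
Definition rees_pred of ring_filtration fil : {pred series B} := fun a =>
  `[< (forall i, fil i (coefs a i))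
      /\ exists N, forall i, (N <= i)%N -> coefs a i = 0 >].

Lemma fil_sum i (I : Type) (r : seq I) (P : pred I) (E : I -> B) :
  (forall j, P j -> fil i (E j)) -> fil i (\sum_(j <- r | P j) E j).
Proof.
move=> h; apply: (big_ind (fil i)) => // [|a b ha hb]; first exact: fil0.
rewrite -[b]opprK; apply: filB => //; rewrite -sub0r.
by apply: filB => //; apply: fil0.
Qed.

Lemma rees_subring : subring_closed (rees_pred hfil).
Proof.
split=> [|a b /asboolP[ha [M hM]] /asboolP[hb [N hN]]
         |a b /asboolP[ha [M hM]] /asboolP[hb [N hN]]]; apply/asboolP.
- split=> [i|].
    rewrite coefs1; have [->|_] := eqVneq i 0%N; first exact: fil1.
    exact: fil0.
  by exists 1%N => -[].
- split=> [i|]; first by rewrite coefsB; apply: filB.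
  exists (maxn M N) => i; rewrite geq_max => /andP[iM iN].
  by rewrite coefsB hM ?hN ?subr0.
split=> [i|].
  rewrite coefsM; apply: fil_sum => j _.
  have e : (j + (i - j))%N = i by rewrite subnKC // -ltnS.
  by rewrite -[X in fil X]e; apply: filM.
exists (M + N)%N => i iMN; rewrite coefsM big1 // => j _.
have [Mj|jM] := leqP M j; first by rewrite hM ?mul0r.
rewrite [X in _ * X]hN ?mulr0 // leq_subRL; last by rewrite -ltnS.
by apply: leq_trans iMN; rewrite leq_add2r ltnW.
Qed.
HB.instance Definition _ :=
  GRing.isSubringClosed.Build _ (rees_pred hfil) rees_subring.

Record rees := Rees { rees_val :> series B; _ : rees_val \in rees_pred hfil }.
HB.instance Definition _ := [isSub for rees_val].
HB.instance Definition _ := [Choice of rees by <:].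
HB.instance Definition _ := GRing.SubChoice_isSubComPzRing.Build _ _ rees
  (subringClosedP (rees_pred hfil)).

Definition gr_ideal : {pred rees} := fun a => `[< forall i, fil i.+1 (coefs a i) >].

Lemma gr_ideal_zmod : zmod_closed gr_ideal.
Proof.
split=> [|a b /asboolP ha /asboolP hb]; apply/asboolP => i; first exact: fil0.
by rewrite coefsB; apply: filB.
Qed.
HB.instance Definition _ := GRing.isZmodClosed.Build _ gr_ideal gr_ideal_zmod.

Lemma gr_ideal_Ml a b : b \in gr_ideal -> a * b \in gr_ideal.
Proof.
move=> /asboolP hb; apply/asboolP => i; rewrite coefsM.
apply: fil_sum => j _; have /asboolP[ha _] := valP a.
have e : (j + (i - j).+1)%N = i.+1 by rewrite addnS subnKC // -ltnS.
by rewrite -[X in fil X]e; apply: filM.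
Qed.
HB.instance Definition _ := isMulAbsorbing.Build _ gr_ideal gr_ideal_Ml.

(* gr = bigoplus_i fil i / fil (i + 1), obtained as the quotient of the   *)
(* Rees ring by the ideal bigoplus_i fil (i + 1) t^i                      *)
Definition gr : comPzRingType := quo gr_ideal.

Section Class.
Variables (i : nat) (b : B) (ib : fil i b).

Lemma rees_mono_subproof : ser_mono i b \in rees_pred hfil.
Proof.
apply/asboolP; split=> [j|].
  by rewrite /=; case: eqP => [->|_] //; apply: fil0.
by exists i.+1 => j ij /=; rewrite gtn_eqF.
Qed.

(* the class of b in fil i / fil (i + 1) *)
Definition gr_class : gr := quo_pi gr_ideal (Rees rees_mono_subproof).
End Class.

End AssociatedGraded.

Section FormalDemazure.
Variables (R : idomainType) (F : fgl R).
Variables (C : fieldType) (n : nat) (A : 'M[int]_n) (D : root_datum C A).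
Variable L : demazure_lattice D.
Local Notation Lam := (lat L).
Local Notation W := (weyl D).

Definition xvar (l : Lam) : mseries R Lam := poly_mser (mvar R l).

Definition fga_rel : set (mseries R Lam) :=
  [set xvar 0] `|`
  [set a | exists l m, a = xvar (l + m) - fsubst F (xvar l) (xvar m)].

Definition fga : comPzRingType := quo (ideal_closure fga_rel).
Definition fga_pi : mseries R Lam -> fga := @quo_pi _ (ideal_closure fga_rel).
Definition fga_repr : fga -> mseries R Lam := @quo_repr _ (ideal_closure fga_rel).
Definition fga_x (l : Lam) : fga := fga_pi (xvar l).

Definition fga_act (w : W) (s : fga) : fga :=
  fga_pi (mser_ren (weyl_lat w) (fga_repr s)).

Definition fga_aug (s : fga) : R := mser_aug (fga_repr s).
Definition fga_augideal : set fga := [set s | fga_aug s = 0].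

(* The symmetric algebra of the R-module spanned by Lam, presented as     *)
(* R[x_l | l in Lam] modulo x_(l + m) = x_l + x_m                         *)
Definition sym_rel : set {malg R[{cmonom Lam}]} :=
  [set p | exists l m, p = mvar R (l + m) - (mvar R l + mvar R m)].

Definition sym : comPzRingType := quo (ideal_span sym_rel).
Definition sym_pi : {malg R[{cmonom Lam}]} -> sym := @quo_pi _ (ideal_span sym_rel).
Definition sym_repr : sym -> {malg R[{cmonom Lam}]} :=
  @quo_repr _ (ideal_span sym_rel).
Definition sym_x (l : Lam) : sym := sym_pi (mvar R l).

Definition sym_act (w : W) (p : sym) : sym :=
  sym_pi (poly_ren (weyl_lat w) (sym_repr p)).

(* p is the class of s in I_F^i / I_F^(i + 1), identified with S_R^i(Lam) *)
(* by x_l |-> l                                                           *)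
Definition is_symbol (i : nat) (s : fga) (p : sym) : Prop :=
  exists2 g : {malg R[{cmonom Lam}]}, g \in homog i &
    ideal_pow fga_augideal i.+1 (s - fga_pi (poly_mser g)) /\ p = sym_pi g.

Definition symbol (i : nat) (s : fga) : sym := xget 0 [set p | is_symbol i s p].

Definition Qx : comPzRingType := loc [set fga_x a | a in pos_roots L].
Definition Qx_in : fga -> Qx := @loc_in _ [set fga_x a | a in pos_roots L].
Definition Qx_act (w : W) : Qx -> Qx := loc_ext (fga_act w).

(* X_a for a = w(alpha_i): here s_a = w s_i w^-1, and x_a is invertible   *)
(* in Q also for negative a                                               *)
Definition demazure_elt (w : W) (i : 'I_n) : {malg Qx[W]} :=
  tw_mul Qx_act
    (tw_scal W (cinv (Qx_in (fga_x (weyl_lat w (simple_root L i))))))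
    (tw_delta Qx 1%g - tw_delta Qx (w * simple_refl D i * w^-1)%g).

Definition demazure_alg : set {malg Qx[W]} :=
  tw_subalg Qx_act
    ([set tw_scal W (Qx_in s) | s in setT] `|`
     [set z | exists w i, z = demazure_elt w i]).

(* Hom_S(D_F, S), as the forms f on Q_W with f(D_F) contained in S *)
Definition demazure_dual : set (W -> Qx) :=
  [set f | forall z, demazure_alg z -> range Qx_in (tw_eval f z)].

Definition demazure_dual_fil (i : nat) : set (W -> Qx) :=
  [set f | demazure_dual f /\
           forall w, (Qx_in @` ideal_pow fga_augideal i) (f w)].

Definition Qa : comPzRingType := loc [set sym_x a | a in pos_roots L].
Definition Qa_in : sym -> Qa := @loc_in _ [set sym_x a | a in pos_roots L].
Definition Qa_act (w : W) : Qa -> Qa := loc_ext (sym_act w).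

Definition nil_gen (i : 'I_n) : {malg Qa[W]} :=
  tw_mul Qa_act (tw_scal W (- cinv (Qa_in (sym_x (simple_root L i)))))
    (tw_delta Qa 1%g - tw_delta Qa (simple_refl D i)).

Definition nil_elt (w : W) : {malg Qa[W]} :=
  foldr (fun i z => tw_mul Qa_act (nil_gen i) z) (tw_delta Qa 1%g) (red_word w).

Definition nil_hecke : set {malg Qa[W]} :=
  tw_subalg Qa_act
    ([set tw_scal W (Qa_in p) | p in setT] `|` range nil_gen).

Definition nil_hecke_dual : set (W -> Qa) :=
  [set f | (forall z, nil_hecke z -> range Qa_in (tw_eval f z)) /\
           finite_set [set w | tw_eval f (nil_elt w) <> 0]].

(* phi_i(f)(delta_w) = (f(delta_w))_i, where S is seen inside Q           *)
Definition phi_deg (i : nat) (f : W -> Qx) : W -> Qa := fun w =>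
  xget 0 [set q | exists2 s, f w = Qx_in s & q = Qa_in (symbol i s)].

End FormalDemazure.

Arguments fga_augideal {R} F {C n A D} L _.
Arguments demazure_alg {R} F {C n A D} L _.
Arguments demazure_dual {R} F {C n A D} L _.
Arguments demazure_dual_fil {R} F {C n A D} L i _.
Arguments nil_hecke R {C n A D} L _.
Arguments nil_hecke_dual R {C n A D} L _.
Arguments phi_deg {R} F {C n A D} L i f _.

(* Main.v *)
(* For f in the dual of the Demazure algebra the divided difference                 *)
(* w |-> (f w - f (w s_i)) / x_(w a_i) lowers the filtration degree by one, and on   *)
(* symbols it is, up to sign, the action of the nil Hecke generator x_i, since the   *)
(* symbol of x_l is l. Hence the image of phi is stable under the nil Hecke algebra, *)
(* and a product of k + 1 generators kills the symbols of degree k: the image lies   *)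
(* in the dual of the nil Hecke algebra. Injectivity compares homogeneous            *)
(* components, S being a domain whose graded ring is Sym(Lam).                       *)
(*   Surjectivity rests on the fact that the products X_w of Demazure elements along *)
(* chosen reduced words span the Demazure algebra over S, although they depend on    *)
(* the words. For an element z with top coefficient at w one shows that z_w times    *)
(* the product of the x_b, b > 0 and w^-1 b < 0, lies in S, one root a at a time: a  *)
(* function satisfying the congruence f w = f (s_a w) modulo x_a in the ring where   *)
(* the other x_b are inverted keeps doing so under the Demazure operators, and the   *)
(* intersection of these rings over all a is S, because x_a and x_b form a regular   *)
(* sequence. A function h is then determined by its values h(X_w), which are         *)
(* arbitrary, and h lies in degree k if h(X_w) lies in I^(k - len w) for all w; so   *)
(* the values on the x_w of a form on the nil Hecke algebra can be lifted degree by  *)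
(* degree.                                                                           *)

From HB Require Import structures.
From mathcomp Require Import all_boot all_order all_algebra.
From mathcomp.multinomials Require mpoly.
Import -(notations, coercions) mpoly.
Require Import Defs.
From mathcomp Require Import generic_quotient ring_quotient.
From mathcomp Require Import boolp classical_sets functions cardinality reals.
From mathcomp Require Import complex finmap monalg ring zify.

Set Implicit Arguments.
Unset Strict Implicit.
Unset Printing Implicit Defensive.

Import GRing.Theory.
Local Open Scope classical_set_scope.
Local Open Scope ring_scope.

(** * Evaluation of polynomials *)

(** Choose a basis b_i of the lattice and let B be the polynomial ring over R in variables X_i.
    Sending x_l to the sum, for the formal group law, of the X_i t with the coordinates of l as
    multiplicities defines a ring morphism from S to B[[t]]; sending l to the ordinary sum defines
    one from Sym to B. Both are injective, the k-th power of the augmentation ideal is the preimage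
    of the series of order at least k, and on that power the coefficient of t^k is the image of the
    symbol ([fga_model]). Hence S is a domain, symbols multiply, and division by x_l, l nonzero,
    lowers the order by exactly one ([Iord_div]).

    For f in the dual, f(w) - f(w s_i) is a multiple of x_(w alpha_i). Taking symbols, the divided
    differences become the nil Hecke generators up to sign ([phi_dem]), and symbols of degree 0 are
    killed ([phi_dem0]). The image of phi is therefore stable under the nil Hecke algebra and each
    of its elements vanishes on x_w for w long ([range_phi_sub]). Injectivity separates the
    homogeneous components of a sum of symbols ([rees_phi_inj]).

    For surjectivity, let X_w be the product of Demazure elements along a chosen reduced word. It is
    triangular with respect to the delta_v, so that a function h is determined by its values h(X_w),
    which are arbitrary. The point is that h lies in degree k of the dual as soon as each h(X_w) has
    order at least k - len w ([dual_lift]). This rests on the X_w spanning the Demazure algebra over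
    S, that is, on the integrality of the top coefficients of its elements after multiplication by
    the inverse of the leading coefficient of X_w ([dalg_lead]), which is tested along one root at a
    time ([Reg_cap], [local_gkm_dem]). Given f in the dual of the nil Hecke algebra, the component
    of degree d of f(x_v) is lifted to S and prescribed, up to sign, as the value at X_v of a
    function of degree d + len v. The images of these functions, finitely many because f has finite
    support, add up to f ([range_phi_sup]). *)

(** Of the polynomial ring only this is used: it is a domain with a universal property. *)
Lemma polynomial_ring (R : idomainType) (r : nat) :
  exists (B : idomainType) (c : {rmorphism R -> B}) (X : 'I_r -> B),
    forall (E : comNzRingType) (e : {rmorphism R -> E}) (t : 'I_r -> E),
    exists psi : {rmorphism B -> E},
      (forall a, psi (c a) = e a) /\ (forall i, psi (X i) = t i).
Proof.
exists (mpoly.mpoly r R), (@mpoly.mpolyC r R).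
exists (fun i => mpoly.mpolyX R (mpoly.mnm1 i)) => E e t.
exists (mpoly.mmap e t); split=> [a|i]; first by rewrite /= mpoly.mmapC.
by rewrite /= mpoly.mmapX mpoly.mmap1U.
Qed.

Section Evaluation.
Variables (R : idomainType) (K : choiceType) (B : comPzRingType).
Variables (c : {rmorphism R -> B}) (t : K -> B).

Definition mev_mon (m : {cmonom K}) : B := \prod_(k <- finsupp m) t k ^+ m k.
(** The target may be the zero ring, as it will be a quotient such as [fga] or [sym]. *)
Definition mev (p : {malg R[{cmonom K}]}) : B :=
  \sum_(m <- msupp p) c p@_m * mev_mon m.

Lemma mev_monEw (d : {fset K}) (m : {cmonom K}) : (finsupp m `<=` d)%fset ->
  mev_mon m = \prod_(k <- d) t k ^+ m k.
Proof.
move=> le; rewrite /mev_mon (big_fset_incl _ le) // => k _.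
by rewrite -cmE_eq0 => /eqP ->; rewrite expr0.
Qed.

Lemma mev_mon1 : mev_mon mone = 1.
Proof. by rewrite /mev_mon mdom1 big_seq_fset0. Qed.

Lemma mev_monM m n : mev_mon (mmul m n) = mev_mon m * mev_mon n.
Proof.
rewrite {1}/mev_mon mdomD (mev_monEw (fsubsetUl _ (finsupp n))).
rewrite (mev_monEw (fsubsetUr (finsupp m) _)) -big_split /=.
by apply: eq_bigr => k _; rewrite cmM exprD.
Qed.

Lemma mev_monU k : mev_mon (ucm k) = t k.
Proof. by rewrite /mev_mon mdomU big_seq_fset1 cmUU expr1. Qed.

Lemma mevEw (d : {fset {cmonom K}}) p : (msupp p `<=` d)%fset ->
  mev p = \sum_(m <- d) c p@_m * mev_mon m.
Proof.
move=> le; rewrite /mev (big_fset_incl _ le) // => m _.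
by rewrite -mcoeff_eq0 => /eqP ->; rewrite rmorph0 mul0r.
Qed.

Lemma mevU a m : mev << a *g m >> = c a * mev_mon m.
Proof. by rewrite (mevEw (msuppU_le)) big_seq_fset1 mcoeffUU. Qed.

Lemma mev_is_zmod_morphism : zmod_morphism mev.
Proof.
move=> p q; rewrite (mevEw (msuppB_le p q)).
rewrite (mevEw (fsubsetUl _ (msupp q))) (mevEw (fsubsetUr (msupp p) _)).
rewrite -sumrB; apply: eq_bigr => m _.
by rewrite mcoeffB rmorphB mulrBl.
Qed.
HB.instance Definition _ := GRing.isZmodMorphism.Build _ _ mev mev_is_zmod_morphism.

Lemma mevC a : mev a%:MP = c a.
Proof. by rewrite mevU mev_mon1 mulr1. Qed.

Lemma mev_var k : mev (mvar R k) = t k.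
Proof. by rewrite mevU rmorph1 mul1r mev_monU. Qed.

Lemma mev_is_monoid_morphism : monoid_morphism mev.
Proof.
split=> [|p q]; first by rewrite mevC rmorph1.
rewrite malgME raddf_sum /= {2 3}/mev mulr_suml; apply: eq_bigr => m _.
rewrite raddf_sum mulr_sumr; apply: eq_bigr => n _ /=.
by rewrite mevU rmorphM mev_monM mulrACA.
Qed.
HB.instance Definition _ :=
  GRing.isMonoidMorphism.Build _ _ mev mev_is_monoid_morphism.

End Evaluation.

Section Generation.
Variables (R : idomainType) (K : choiceType).
Local Notation P := {malg R[{cmonom K}]}.

Lemma mvarE k : mvar R k = << 1 *g ucm k >> :> P. Proof. by []. Qed.

Lemma malgU_prod a (m : {cmonom K}) :
  << a *g m >> = a%:MP * \prod_(k <- finsupp m) mvar R k ^+ m k.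
Proof.
(* Induction on a list carrying the support of [n]: the power of the head variable splits off as the
   monomial [A], the rest is [D]. *)
have idP d (f : K -> nat) (n : {cmonom K}) :
  (forall k, n k = (k \in d) * f k)%N -> uniq d ->
  << 1 *g n >> = \prod_(k <- d) mvar R k ^+ f k :> P.
  elim: d n => [|k d ih] n e /=.
    have -> : n = mone by apply/eqP/cmP => k; rewrite e mul0n cm1.
    by rewrite big_nil mpolyC1E.
  move=> /andP[kd ud]; rewrite big_cons.
  have pw j : << 1 *g [cmonom j | _ in [fset k]%fset]%M >> = mvar R k ^+ j.
    elim: j => [|j IH].
      have -> : [cmonom 0%N | _ in [fset k]%fset]%M = mone.
        by apply/eqP/cmP => l; rewrite cm1 cmE fsfun_fun; case: ifP.
      by rewrite expr0 mpolyC1E.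
    have -> : [cmonom j.+1 | _ in [fset k]%fset]%M =
        mmul (ucm k) [cmonom j | _ in [fset k]%fset]%M.
      apply/eqP/cmP => l; rewrite cmM cmU !cmE !fsfun_fun !in_fset1.
      by rewrite eq_sym; case: eqP => //=; rewrite add1n.
    by rewrite exprS -IH mvarE malgM_def fgmulUU mulr1.
  have e' l : [cmonom f l | l in seq_fset tt d]%M l = ((l \in d) * f l)%N.
    by rewrite cmE fsfun_fun seq_fsetE; case: (l \in d); rewrite ?mul1n ?mul0n.
  set A := [cmonom f k | _ in [fset k]%fset]%M; set D := [cmonom f l | l in _]%M in e' *.
  have -> : n = mmul A D.
    apply/eqP/cmP => l; rewrite cmM e e' in_cons cmE fsfun_fun in_fset1.
    have [->|_] /= := eqVneq l k; first by rewrite (negPf kd) addn0 mul1n.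
    by case: (l \in d); rewrite ?mul1n ?mul0n.
  transitivity (<< 1 *g A >> * << 1 *g D >> : P); first by rewrite malgM_def fgmulUU mulr1.
  exact: (congr2 _ (pw (f k)) (ih _ e' ud)).
have em k : m k = ((k \in finsupp m) * m k)%N by case: mdomP; rewrite ?mul1n ?mul0n.
by rewrite -(idP _ m m em (fset_uniq _)) malgM_def fgmulUU mulr1 mul1m.
Qed.

Lemma malg_ind (Q : P -> Prop) :
  (forall a, Q a%:MP) -> (forall k, Q (mvar R k)) ->
  (forall p q, Q p -> Q q -> Q (p + q)) ->
  (forall p q, Q p -> Q q -> Q (p * q)) -> forall p, Q p.
Proof.
move=> QC Qv QD QM p; rewrite (monalgE p).
apply: (big_ind Q) => [|//|m _]; first by rewrite -malgC0E; apply: QC.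
rewrite malgU_prod; apply/QM; first exact: QC.
have Q1 : Q 1 by rewrite -mpolyC1E.
apply: (big_ind Q Q1 QM) => k _.
elim: (m k) => [|j ih]; first by rewrite expr0.
by rewrite exprS; apply: (QM) (Qv k) ih.
Qed.

Lemma malg_ext (B : pzRingType) (f g : {rmorphism P -> B}) :
  (forall a, f a%:MP = g a%:MP) -> (forall k, f (mvar R k) = g (mvar R k)) ->
  f =1 g.
Proof.
move=> eC ev; apply: malg_ind => // p q ep eq; first by rewrite !rmorphD ep eq.
by rewrite !rmorphM ep eq.
Qed.

Lemma mev_uniq (B : comPzRingType) (c : {rmorphism R -> B}) (t : K -> B)
    (f : {rmorphism P -> B}) :
  (forall a, f a%:MP = c a) -> (forall k, f (mvar R k) = t k) -> f =1 mev c t.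
Proof.
move=> fc ft; apply: (malg_ext (f := f) (g := mev c t)) => [a|k].
  exact: etrans (fc a) (esym (mevC _ _ _)).
exact: etrans (ft k) (esym (mev_var _ _ _)).
Qed.

End Generation.

(** * Power series and formal group laws *)

Section Order.
Variable B : comPzRingType.
Implicit Types a b : series B.

(** Congruence modulo t^k; [ser_ord] is divisibility by t^k. *)
Definition ser_eqm k a b := forall d, (d < k)%N -> coefs a d = coefs b d.
Definition ser_ord k a := forall d, (d < k)%N -> coefs a d = 0.

Lemma ser_eqmP k a b : ser_eqm k a b <-> ser_ord k (a - b).
Proof.
split=> h d dk; first by rewrite coefsB h // subrr.
by apply/eqP; rewrite -subr_eq0 -coefsB h.
Qed.

Lemma ser_ord0 a : ser_ord 0 a. Proof. by []. Qed.

Lemma ser_ord_zero k : ser_ord k 0. Proof. by []. Qed.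

Lemma ser_ordN k a : ser_ord k a -> ser_ord k (- a).
Proof. by move=> ha d dk; rewrite coefsN ha // oppr0. Qed.

Lemma ser_ordD k a b : ser_ord k a -> ser_ord k b -> ser_ord k (a + b).
Proof. by move=> ha hb d dk; rewrite coefsD ha // hb // addr0. Qed.

Lemma ser_ord_sum k (I : Type) (r : seq I) (Q : pred I) (E : I -> series B) :
  (forall i, Q i -> ser_ord k (E i)) -> ser_ord k (\sum_(i <- r | Q i) E i).
Proof.
move=> h; apply: (big_ind (ser_ord k)) => // a b; exact: ser_ordD.
Qed.

Lemma ser_ord_le k l a : (l <= k)%N -> ser_ord k a -> ser_ord l a.
Proof. by move=> lk ha d dl; apply: ha; apply: leq_trans lk. Qed.

Lemma ser_ordM i j a b : ser_ord i a -> ser_ord j b -> ser_ord (i + j) (a * b).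
Proof.
move=> ha hb d dij; rewrite coefsM big1 // => k _.
have [ki|ik] := ltnP k i; first by rewrite ha ?mul0r.
by rewrite hb ?mulr0 //; have := ltn_ord k; lia.
Qed.

Lemma ser_ordX i a : ser_ord 1 a -> ser_ord i (a ^+ i).
Proof.
move=> h; elim: i => [//|i ih]; rewrite exprS -add1n; exact: ser_ordM.
Qed.

Lemma ser_ordP a : (forall k, ser_ord k a) -> a = 0.
Proof. by move=> h; apply: seriesP => d; apply: (h d.+1). Qed.

Lemma coefsM_ord i j a b : ser_ord i a -> ser_ord j b ->
  coefs (a * b) (i + j) = coefs a i * coefs b j.
Proof.
move=> ha hb; rewrite coefsM (bigD1 (inord i)) //= inordK; last by lia.
rewrite addKn big1 ?addr0 // => k ki.
have [lt|le] := ltnP k i; first by rewrite ha ?mul0r.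
rewrite hb ?mulr0 //; have := ltn_ord k.
suff : i <> k by lia.
by move=> e; case/eqP: ki; apply: ord_inj; rewrite inordK //; lia.
Qed.

Lemma coefs_monoM d (x y : B) e :
  ser_mono d x * ser_mono e y = ser_mono (d + e) (x * y).
Proof.
apply: seriesP => k; rewrite coefsM /=.
have [->|ne] := eqVneq k (d + e)%N.
  rewrite (bigD1 (inord d)) //= inordK; last by lia.
  rewrite eqxx addKn eqxx big1 ?addr0 // => i id.
  case: ifP => [/eqP ei|]; rewrite ?mul0r //.
  by case/eqP: id; apply: ord_inj; rewrite inordK //; lia.
rewrite big1 // => i _; case: ifP => [/eqP ei|]; rewrite ?mul0r //.
case: ifP => [/eqP ei'|]; rewrite ?mulr0 //.
by case/eqP: ne; have := ltn_ord i; lia.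
Qed.

Lemma coefs_sum (I : Type) (r : seq I) (Q : pred I) (E : I -> series B) d :
  coefs (\sum_(i <- r | Q i) E i) d = \sum_(i <- r | Q i) coefs (E i) d.
Proof. by elim/big_rec2: _ => // i y x _ <-; rewrite coefsD. Qed.

Lemma ser_mono_is_zmod_morphism d : zmod_morphism (@ser_mono B d).
Proof. by move=> x y; apply: seriesP => k; rewrite coefsB /=; case: ifP; rewrite ?subrr. Qed.
HB.instance Definition _ d :=
  GRing.isZmodMorphism.Build _ _ (@ser_mono B d) (@ser_mono_is_zmod_morphism d).

Lemma ser_mono_ord d x : ser_ord d (ser_mono d x : series B).
Proof. by move=> e ed /=; rewrite ltn_eqF. Qed.

Definition ser_cst := @ser_mono B 0.
HB.instance Definition _ := GRing.Additive.on ser_cst.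

Lemma ser_cst_is_monoid_morphism : monoid_morphism ser_cst.
Proof. by split=> [|x y]; rewrite ?/ser_cst ?coefs_monoM //; apply: seriesP => -[]. Qed.
HB.instance Definition _ :=
  GRing.isMonoidMorphism.Build _ _ ser_cst ser_cst_is_monoid_morphism.

Lemma coefs_cstM x a d : coefs (ser_cst x * a) d = x * coefs a d.
Proof.
rewrite coefsM big_ord_recl /= subn0 big1 ?addr0 // => i _.
by rewrite mul0r.
Qed.

Lemma ser_ord_cstM k x a : ser_ord k a -> ser_ord k (ser_cst x * a).
Proof. by move=> h d dk; rewrite coefs_cstM h // mulr0. Qed.

(** The infinite sum, meaningful when [E i] has order at least [i]: the terms beyond [d] then do not
    contribute to degree [d]. *)
Definition ser_sum (E : nat -> series B) : series B :=
  Series (fun d => \sum_(i < d.+1) coefs (E i) d).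

Lemma ser_sum_eqm (E : nat -> series B) N : (forall k, ser_ord k (E k)) ->
  ser_eqm N (ser_sum E) (\sum_(i < N) E i).
Proof.
move=> h d dN; rewrite coefs_sum /= -(big_mkord xpredT (fun i => coefs (E i) d)).
rewrite -(big_mkord xpredT (fun i => coefs (E i) d)).
rewrite [RHS](@big_cat_nat _ _ _ d.+1) //= [X in _ + X]big1_seq ?addr0 // => i.
by rewrite mem_index_iota => /andP[_ /andP[di _]]; apply: h.
Qed.

End Order.

Section PowerSeriesSubstitution.
Variables (R : idomainType) (B : comPzRingType) (c : {rmorphism R -> B}).
Implicit Types (F : nat -> nat -> R) (a b : series B).

(** The formula of [fsubst] over any coefficient ring. For series without constant term it agrees up
    to any degree with truncations that are polynomial in [a] and [b], hence compatible with ring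
    morphisms. *)
Definition sfs F a b : series B := Series (fun d =>
  \sum_(i < d.+1) \sum_(j < d.+1) c (F i j) * coefs (a ^+ i * b ^+ j) d).

Definition sfs_trunc F a b N : series B :=
  \sum_(i < N) \sum_(j < N) ser_cst (c (F i j)) * (a ^+ i * b ^+ j).

Lemma sfs_eqm F a b N : ser_ord 1 a -> ser_ord 1 b ->
  ser_eqm N (sfs F a b) (sfs_trunc F a b N).
Proof.
move=> ha hb d dN; rewrite /sfs_trunc coefs_sum.
pose g i j := c (F i j) * coefs (a ^+ i * b ^+ j) d.
have g0 i j : (d < i + j)%N -> g i j = 0.
  by move=> dij; rewrite /g (ser_ordM (ser_ordX ha) (ser_ordX hb)) ?mulr0.
transitivity (\sum_(0 <= i < d.+1) \sum_(0 <= j < d.+1) g i j).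
  by rewrite big_mkord; apply: eq_bigr => i _; rewrite big_mkord.
transitivity (\sum_(0 <= i < N) \sum_(0 <= j < N) g i j); last first.
  rewrite big_mkord; apply: eq_bigr => i _; rewrite big_mkord coefs_sum.
  by apply: eq_bigr => j _; rewrite coefs_cstM.
rewrite [RHS](@big_cat_nat _ _ _ d.+1) //= [X in _ + X]big1_seq ?addr0.
  apply: eq_bigr => i _; rewrite [RHS](@big_cat_nat _ _ _ d.+1) //=.
  rewrite [X in _ + X]big1_seq ?addr0 // => j.
  by rewrite mem_index_iota => /andP[_ /andP[di _]]; apply: g0; lia.
move=> i; rewrite mem_index_iota => /andP[_ /andP[di _]].
by rewrite big1 // => j _; apply: g0; lia.
Qed.

Lemma sfs_ord F a b : ser_ord 1 a -> ser_ord 1 b -> F 0%N 0%N = 0 ->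
  ser_ord 1 (sfs F a b).
Proof.
by move=> ha hb F0 [|//] _ /=; rewrite !big_ord1 F0 rmorph0 mul0r.
Qed.

End PowerSeriesSubstitution.

Lemma sum_triangle (V : nmodType) (N : nat) (f : nat -> nat -> V) :
  \sum_(d < N) \sum_(i < d.+1) f i (d - i)%N = \sum_(i < N) \sum_(j < N - i) f i j.
Proof.
elim: N => [|N ih]; first by rewrite !big_ord0.
rewrite big_ord_recr ih /= [in RHS]big_ord_recr /= big_ord_recr /=.
rewrite subSnn big_ord1 subnn addrA -big_split /=; congr (_ + _).
by apply: eq_bigr => i _; rewrite subSn ?big_ord_recr // ltnW.
Qed.

Section SubstitutionMorphism.
Variables (R : idomainType) (A : comPzRingType) (k0 : R -> A).
Variables (B1 B2 : comPzRingType) (c1 : {rmorphism R -> B1}) (c2 : {rmorphism R -> B2}).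
Variables (v : {rmorphism A -> series B1}) (u : {rmorphism A -> series B2}).
Hypothesis vk : forall r, v (k0 r) = ser_cst (c1 r).
Hypothesis uk : forall r, u (k0 r) = ser_cst (c2 r).
Hypothesis uv : forall k a, ser_ord k (v a) -> ser_ord k (u a).

(** The truncations on both sides are the images of one element [p] of [A]. Under [v] the difference
    s - p has order above d, and [uv] carries this over to [u]. Substitutions and renamings are both
    instances. *)
Lemma sfs_morph F (a b s : A) : ser_ord 1 (v a) -> ser_ord 1 (v b) ->
  v s = sfs c1 F (v a) (v b) -> u s = sfs c2 F (u a) (u b).
Proof.
move=> ha hb es; apply: seriesP => d.
pose p := \sum_(i < d.+1) \sum_(j < d.+1) k0 (F i j) * (a ^+ i * b ^+ j).
have vp : v p = sfs_trunc c1 F (v a) (v b) d.+1.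
  rewrite /p rmorph_sum; apply: eq_bigr => i _; rewrite rmorph_sum; apply: eq_bigr => j _.
  by rewrite !rmorphM !rmorphXn /= vk.
have up : u p = sfs_trunc c2 F (u a) (u b) d.+1.
  rewrite /p rmorph_sum; apply: eq_bigr => i _; rewrite rmorph_sum; apply: eq_bigr => j _.
  by rewrite !rmorphM !rmorphXn /= uk.
have : ser_ord d.+1 (v (s - p)).
  by rewrite rmorphB vp es; apply/ser_eqmP; apply: sfs_eqm.
move/uv; rewrite rmorphB up => /ser_eqmP ->//.
by rewrite (sfs_eqm _ _ (uv ha) (uv hb) (ltnSn d)).
Qed.
End SubstitutionMorphism.

Section FormalGroupLaw.
Variables (R : idomainType) (F : fgl R).

Lemma fgl00 : F 0%N 0%N = 0. Proof. by rewrite fgl_unit. Qed.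
Lemma fgl_i0 i : F i 0%N = (i == 1%N)%:R. Proof. exact: fgl_unit. Qed.
Lemma fgl_0i i : F 0%N i = (i == 1%N)%:R. Proof. by rewrite fgl_comm fgl_unit. Qed.

(** The coefficients of G in F(x, y) = x + y + x y G(x, y). *)
Definition fgl_mixed (i j : nat) : R := F i.+1 j.+1.

Variables (B : comPzRingType) (c : {rmorphism R -> B}).
Implicit Types a b : series B.
Local Notation FB := (sfs c F).

Lemma sfs_mixed a b : ser_ord 1 a -> ser_ord 1 b ->
  FB a b = a + b + a * b * sfs c fgl_mixed a b.
Proof.
move=> ha hb; apply: seriesP => d; rewrite (sfs_eqm _ _ ha hb (ltnW (ltnSn d.+1))).
rewrite !coefsD; have hab : ser_ord 2 (a * b) := ser_ordM ha hb.
have -> : coefs (a * b * sfs c fgl_mixed a b) d =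
    coefs (a * b * sfs_trunc c fgl_mixed a b d.+1) d.
  apply/eqP; rewrite -subr_eq0 -coefsB -mulrBr; apply/eqP.
  apply: (ser_ordM hab (proj1 (ser_eqmP _ _ _) (@sfs_eqm _ _ c fgl_mixed a b d.+1 ha hb))).
  by lia.
rewrite -!coefsD; congr coefs; rewrite /sfs_trunc big_ord_recl /=.
rewrite big_ord_recl fgl00 rmorph0 raddf0 mul0r add0r [X in X + _]big_ord_recl /=.
rewrite fgl_0i rmorph1 rmorph1 !expr1 expr0 !mul1r big1 ?addr0; last first.
  by move=> i _; rewrite fgl_0i rmorph0 raddf0 mul0r.
have -> : \sum_(i < d.+1) \sum_(j < d.+2)
   ser_cst (c (F (bump 0 i) j)) * (a ^+ bump 0 i * b ^+ j) =
   \sum_(i < d.+1) (ser_cst (c (i == 0%N :> nat)%:R) * a +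
     a * b * \sum_(j < d.+1) ser_cst (c (fgl_mixed i j)) * (a ^+ i * b ^+ j)).
  apply: eq_bigr => i _; rewrite big_ord_recl /= fgl_i0 expr0 mulr1 /bump /= add1n eqSS.
  congr (_ + _); first by case: eqP => [->|]; rewrite ?expr1 // !rmorph0 !mul0r.
  rewrite mulr_sumr; apply: eq_bigr => j _; rewrite /fgl_mixed /= add1n !exprS; ring.
rewrite big_split /= -mulr_sumr big_ord_recl /= !rmorph1 mul1r big1 ?addr0; last first.
  by move=> i _; rewrite !rmorph0 mul0r.
by rewrite addrA [b + a]addrC.
Qed.

Lemma sfs_comm a b : FB a b = FB b a.
Proof.
apply: seriesP => d /=; rewrite exchange_big; apply: eq_bigr => i _.
by apply: eq_bigr => j _; rewrite fgl_comm; congr (_ * _);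
  exact: (congr1 (fun x => coefs x d) (mulrC _ _)).
Qed.

Lemma sfs_ord1 a b : ser_ord 1 a -> ser_ord 1 b -> ser_ord 1 (FB a b).
Proof. by move=> ha hb; apply: sfs_ord => //; rewrite fgl00. Qed.

(** By [sfs_mixed], F(a, b + e) - F(a, b) - e = a e G(a, b + e) + a b (G(a, b + e) - G(a, b)), and
    both terms have order at least k + 1. *)
Lemma sfs_eqmD k a b e : (0 < k)%N -> ser_ord 1 a -> ser_ord 1 b -> ser_ord k e ->
  ser_eqm k.+1 (FB a (b + e)) (FB a b + e).
Proof.
move=> k0 ha hb he; have he1 : ser_ord 1 e := ser_ord_le k0 he.
have hbe := ser_ordD hb he1; apply/ser_eqmP.
rewrite !sfs_mixed //; set G := sfs c fgl_mixed a.
have -> : a + (b + e) + a * (b + e) * G (b + e) - (a + b + a * b * G b + e) =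
  a * e * G (b + e) + a * b * (G (b + e) - G b) by ring.
rewrite -[k.+1]add1n; apply: ser_ordD.
  by rewrite -[(1 + k)%N]addn0; apply: ser_ordM => //; apply: ser_ordM.
apply: (ser_ord_le (_ : _ <= 2 + k)%N) => //; apply: ser_ordM; first exact: (ser_ordM ha hb).
apply/ser_eqmP => d dk; rewrite /G !(sfs_eqm _ _ _ _ dk) // /sfs_trunc !coefs_sum.
apply: eq_bigr => i _; rewrite !coefs_sum; apply: eq_bigr => j _; rewrite !coefs_cstM.
congr (_ * _); apply/eqP; rewrite -subr_eq0 -coefsB -mulrBr; apply/eqP.
suff h : ser_ord k ((b + e) ^+ j - b ^+ j) by apply: (ser_ordM (ser_ord0 _) h).
elim: (nat_of_ord j) => [|m ih]; first by rewrite subrr.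
have -> : (b + e) ^+ m.+1 - b ^+ m.+1 = (b + e) * ((b + e) ^+ m - b ^+ m) + e * b ^+ m.
  by rewrite !exprS; ring.
apply: ser_ordD; first by rewrite -[k]add0n; apply: ser_ordM.
by rewrite -[k]addn0; apply: ser_ordM.
Qed.

(* Successive approximation: each step corrects the next coefficient. *)
Lemma sfs_inverse a : ser_ord 1 a -> exists2 b, ser_ord 1 b & FB a b = 0.
Proof.
move=> ha.
pose st b := b - FB a b.
pose bn n := iter n st 0.
have inv n : ser_ord 1 (bn n) /\ ser_ord n.+1 (FB a (bn n)).
  elim: n => [|n [h1 h2]] /=.
    by split=> //; apply: sfs_ord1.
  have hN : ser_ord n.+1 (- FB a (bn n)) := ser_ordN h2.
  split; first by apply: ser_ordD => //; apply: ser_ord_le hN.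
  move=> d dn; rewrite /st (sfs_eqmD _ _ _ hN) //.
  by rewrite subrr.
pose b := Series (fun d => coefs (bn d) d).
have bE n : ser_eqm n.+1 b (bn n).
  have step m d : (d <= m)%N -> coefs (bn m.+1) d = coefs (bn m) d.
    by move=> dm; rewrite [bn _.+1]iterS -/(bn m) /st coefsB (proj2 (inv m)) ?subr0.
  move=> d; rewrite ltnS => dn /=; rewrite -(subnKC dn).
  elim: (n - d)%N => [|m ih]; first by rewrite addn0.
  by rewrite addnS step ?ih // leq_addr.
have b1 : ser_ord 1 b by move=> d d1; rewrite (bE 0%N d d1).
exists b => //; apply: seriesP => d.
have [h1 h2] := inv d; have hE : ser_ord d.+1 (b - bn d) by apply/ser_eqmP.
have -> : b = bn d + (b - bn d) by ring.
rewrite (sfs_eqmD _ _ _ hE) //.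
by rewrite coefsD h2 // hE // addr0.
Qed.

End FormalGroupLaw.

(* Unfolding these during unification makes failing rewrites diverge. *)
#[local] Opaque mkmalgU mvar.

(** * Continuous substitution into power series *)

Section MSeriesTheory.
Variables (R : idomainType) (K : choiceType).
Local Notation P := {malg R[{cmonom K}]}.
Local Notation M := (mseries R K).

Definition mvl : {rmorphism M -> series P} := val.

Lemma mvl_inj : injective mvl. Proof. exact: val_inj. Qed.

Lemma coefs_homog (a : M) d : coefs a d \in homog d.
Proof. by have /homogsP := valP a. Qed.

Lemma hcompE d e (p : P) : p \in homog d -> hcomp e p = if e == d then p else 0.
Proof.
move=> /homogP hp; rewrite /hcomp.
have {}hp m : m \in msupp p -> mdeg m = d by rewrite -mcoeff_neq0; apply: hp.
case: eqP => [->|ed].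
  rewrite [RHS](monalgE p) [RHS]big_seq_cond [LHS]big_seq_cond; apply: eq_bigl => m.
  by rewrite andbT; case: (boolP (m \in _)) => //= /hp ->; rewrite eqxx.
rewrite big_seq_cond big_pred0 // => m; case: (boolP (m \in _)) => //= /hp ->.
by apply/eqP => e'; case: ed.
Qed.

Lemma poly_mser_mono d (p : P) : p \in homog d -> mvl (poly_mser p) = ser_mono d p.
Proof. by move=> hp; apply: seriesP => e /=; rewrite (hcompE e hp). Qed.

Lemma mser_cst_subproof r : ser_cst r%:MP \in @homogs R K.
Proof.
apply/homogsP => d /=; case: eqP => [->|_]; rewrite ?rpred0 //; exact: homogC.
Qed.
Definition mser_cst r : M := MSeries (mser_cst_subproof r).

Lemma mser_cst_is_zmod_morphism : zmod_morphism mser_cst.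
Proof. by move=> x y; apply: mvl_inj; rewrite rmorphB /= !raddfB. Qed.
HB.instance Definition _ :=
  GRing.isZmodMorphism.Build _ _ mser_cst mser_cst_is_zmod_morphism.

Lemma mser_cst_is_monoid_morphism : monoid_morphism mser_cst.
Proof.
split=> [|x y]; apply: mvl_inj; first by rewrite rmorph1 /= !rmorph1.
by rewrite rmorphM /= !rmorphM.
Qed.
HB.instance Definition _ :=
  GRing.isMonoidMorphism.Build _ _ mser_cst mser_cst_is_monoid_morphism.

Definition xv k : M := poly_mser (mvar R k).

Lemma xv_mono k : mvl (xv k) = ser_mono 1 (mvar R k).
Proof. by apply: poly_mser_mono; apply: mvar_homog. Qed.

Lemma mev_mon_xv m : mvl (mev_mon xv m) =
  ser_mono (mdeg m) (\prod_(k <- finsupp m) mvar R k ^+ m k).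
Proof.
rewrite /mev_mon rmorph_prod mdegE; elim: (enum_fset _) => [|k s ih].
  by rewrite !big_nil; apply: seriesP => -[].
rewrite !big_cons ih rmorphXn /= -[X in X ^+ _]/(mvl (xv k)) xv_mono -coefs_monoM; congr (_ * _).
elim: (m k) => [|j IH]; first by rewrite !expr0; apply: seriesP => -[].
by rewrite !exprS IH coefs_monoM.
Qed.

Lemma poly_mserE (p : P) : poly_mser p = mev mser_cst xv p.
Proof.
apply: mvl_inj; apply: seriesP => d; rewrite /mev rmorph_sum coefs_sum.
rewrite [LHS]/= /hcomp big_mkcond; apply: eq_bigr => m _.
rewrite rmorphM -[X in X * _]/(ser_cst (p@_m)%:MP) mev_mon_xv coefs_cstM /=.
by rewrite eq_sym; case: eqP; rewrite ?mulr0 // malgU_prod.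
Qed.

Lemma mser_eqm (a : M) N :
  ser_eqm N (mvl a) (mvl (\sum_(d < N) poly_mser (coefs a d))).
Proof.
move=> d dN; rewrite rmorph_sum coefs_sum (bigD1 (Ordinal dN)) //=.
rewrite (hcompE _ (coefs_homog a d)) eqxx big1 ?addr0 // => i id.
rewrite (hcompE _ (coefs_homog a i)); case: eqP => // e.
by case/eqP: id; apply: ord_inj.
Qed.

Lemma mser_sum_subproof (E : nat -> M) : ser_sum (fun d => mvl (E d)) \in @homogs R K.
Proof. by apply/homogsP => d; rewrite rpred_sum // => i _; apply: coefs_homog. Qed.
Definition mser_sum E : M := MSeries (mser_sum_subproof E).

Lemma mser_sum_eqm (E : nat -> M) N : (forall k, ser_ord k (mvl (E k))) ->
  ser_eqm N (mvl (mser_sum E)) (mvl (\sum_(i < N) E i)).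
Proof. by move=> h; rewrite rmorph_sum; apply: ser_sum_eqm. Qed.

Lemma mvl_fsubst (F : nat -> nat -> R) (a b : M) :
  mvl (fsubst F a b) = sfs (@malgC _ R) F (mvl a) (mvl b).
Proof.
apply: seriesP => d; apply: eq_bigr => i _; apply: eq_bigr => j _.
by rewrite -mul_malgC -!rmorphXn -rmorphM.
Qed.

Section Continuous.
Variables (B : comPzRingType) (c : {rmorphism R -> B}) (t : K -> series B).
Hypothesis t1 : forall k, ser_ord 1 (t k).

(** A product of [mdeg m] series of order 1, whose lowest coefficient is the product of the linear
    coefficients. *)
Lemma mev_mon_lead m : ser_ord (mdeg m) (mev_mon t m) /\
  coefs (mev_mon t m) (mdeg m) = mev_mon (fun k => coefs (t k) 1) m.
Proof.
rewrite /mev_mon mdegE; elim: (enum_fset _) => [|k s [ih1 ih2]].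
  by rewrite !big_nil.
rewrite !big_cons.
have [h1 h2] : ser_ord (m k) (t k ^+ m k) /\
    coefs (t k ^+ m k) (m k) = coefs (t k) 1 ^+ m k.
  elim: (m k) => [|j [IH1 IH2]]; first by rewrite !expr0.
  rewrite !exprS -add1n; split; first exact: ser_ordM.
  by rewrite coefsM_ord // IH2.
by split; [apply: ser_ordM|rewrite coefsM_ord // h2 ih2].
Qed.

Definition scst : {rmorphism R -> series B} := @ser_cst B \o c.
Definition mevs : P -> series B := mev scst t.

Lemma mevs_ord d (p : P) : p \in homog d -> ser_ord d (mevs p).
Proof.
move=> /homogP hp; rewrite /mevs /mev big_seq; apply: ser_ord_sum => m.
rewrite -mcoeff_neq0 => /hp <-; apply: ser_ord_cstM; exact: (mev_mon_lead m).1.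
Qed.

Lemma mevs_lead d (p : P) : p \in homog d ->
  coefs (mevs p) d = mev c (fun k => coefs (t k) 1) p.
Proof.
move=> /homogP hp; rewrite /mevs /mev coefs_sum big_seq [RHS]big_seq.
apply: eq_bigr => m; rewrite -mcoeff_neq0 => /hp <-.
by rewrite coefs_cstM (mev_mon_lead m).2.
Qed.

(** The continuous extension of [mevs]: the component of degree d goes to order at least d, so that
    the sum converges. *)
Definition msubst (a : M) : series B := ser_sum (fun d => mevs (coefs a d)).

Lemma msubst_eqm a N : ser_eqm N (msubst a) (\sum_(d < N) mevs (coefs a d)).
Proof. by apply: ser_sum_eqm => k; apply/mevs_ord/coefs_homog. Qed.

Lemma msubst_is_zmod_morphism : zmod_morphism msubst.
Proof.
move=> a b; apply: seriesP => e; rewrite coefsB /= -sumrB; apply: eq_bigr => d _.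
by rewrite /mevs raddfB coefsB.
Qed.
HB.instance Definition _ :=
  GRing.isZmodMorphism.Build _ _ msubst msubst_is_zmod_morphism.

(** Both sides are sums of terms [f i j] of order at least i + j, over i + j < N on the left and
    over i, j < N on the right; the additional terms vanish modulo t^N. *)
Lemma mevs_truncM (a b : M) N :
  ser_eqm N (\sum_(d < N) mevs (coefs (a * b) d))
    ((\sum_(d < N) mevs (coefs a d)) * (\sum_(d < N) mevs (coefs b d))).
Proof.
pose f i j := mevs (coefs a i) * mevs (coefs b j).
have fo i j : ser_ord (i + j) (f i j).
  by apply: ser_ordM; apply/mevs_ord/coefs_homog.
have -> : \sum_(d < N) mevs (coefs (a * b) d) =
    \sum_(d < N) \sum_(i < d.+1) f i (d - i)%N.
  apply: eq_bigr => d _; rewrite [coefs _ _](coefsM (mvl a) (mvl b)) /mevs rmorph_sum.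
  by apply: eq_bigr => i _; rewrite rmorphM.
rewrite sum_triangle mulr_suml => e eN; rewrite !coefs_sum; apply: eq_bigr => i _.
rewrite mulr_sumr !coefs_sum -!(big_mkord xpredT (fun j => coefs (f i j) e)).
rewrite [RHS](@big_cat_nat _ _ _ (N - i)) ?leq_subr //=.
rewrite [X in _ + X]big1_seq ?addr0 // => j.
by rewrite mem_index_iota => /andP[_ /andP[ij _]]; apply: fo; lia.
Qed.

Lemma msubst_is_monoid_morphism : monoid_morphism msubst.
Proof.
split=> [|a b]; apply: seriesP => e.
  have -> : msubst 1 = mevs 1; last by rewrite /mevs rmorph1.
  apply: seriesP => d; rewrite (msubst_eqm _ (ltnSn d)) big_ord_recl big1 ?addr0 //.
  by move=> i _; rewrite [X in mevs X](_ : _ = 0) /mevs ?raddf0.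
rewrite (msubst_eqm _ (ltnSn e)) mevs_truncM // !coefsM.
apply: eq_bigr => i _; have := ltn_ord i; rewrite ltnS => ie.
by rewrite !(@msubst_eqm _ e.+1) ?ltnS ?leq_subr.
Qed.
HB.instance Definition _ :=
  GRing.isMonoidMorphism.Build _ _ msubst msubst_is_monoid_morphism.

Definition msubstr : {rmorphism M -> series B} := msubst.

Lemma msubst_ord k a : ser_ord k (mvl a) -> ser_ord k (msubst a).
Proof.
move=> h d dk /=; rewrite big1 // => i _; have := ltn_ord i; rewrite ltnS => id.
by rewrite [coefs a i]h ?(leq_ltn_trans id) // /mevs raddf0.
Qed.

(** Only the linear parts of the [t j] and the lowest form of [a] reach degree k; this is how
    symbols are computed in the model. *)
Lemma msubst_lead k a : ser_ord k (mvl a) ->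
  coefs (msubst a) k = mev c (fun j => coefs (t j) 1) (coefs a k).
Proof.
move=> h; rewrite /= big_ord_recr /= big1 ?add0r => [|i _].
  by apply: mevs_lead; apply: coefs_homog.
by rewrite [coefs a i]h // /mevs raddf0.
Qed.

Lemma msubst_poly d (p : P) : p \in homog d -> msubst (poly_mser p) = mevs p.
Proof.
move=> hp; apply: seriesP => e /=.
have E i : coefs (mevs (hcomp i p)) e = if i == d then coefs (mevs p) e else 0.
  by rewrite (hcompE i hp); case: eqP; rewrite ?/mevs ?raddf0.
under eq_bigr do rewrite E.
rewrite -big_mkcond /=; have [de|ed] := leqP d e.
  rewrite (big_pred1 (inord d : 'I_e.+1)) // => i.
  by apply/eqP/eqP => [id|->]; [apply: ord_inj|]; rewrite inordK.
rewrite big_pred0 => [|i]; first by rewrite (mevs_ord hp).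
by apply/eqP => id; have := ltn_ord i; lia.
Qed.

Lemma msubst_cst r : msubst (mser_cst r) = ser_cst (c r).
Proof.
have -> : mser_cst r = poly_mser r%:MP.
  apply: mvl_inj; rewrite (poly_mser_mono (homogC _ r)); exact: seriesP.
by rewrite (msubst_poly (homogC _ r)) /mevs mevC.
Qed.

Lemma msubst_xv k : msubst (xv k) = t k.
Proof. by rewrite (msubst_poly (mvar_homog R k)) /mevs mev_var. Qed.

Lemma msubst_fsubst (F : nat -> nat -> R) (a b : M) :
  ser_ord 1 (mvl a) -> ser_ord 1 (mvl b) ->
  msubst (fsubst F a b) = sfs c F (msubst a) (msubst b).
Proof.
move=> ha hb.
apply: (@sfs_morph _ _ mser_cst _ _ (@malgC _ R) c mvl msubst) => //.
- exact: msubst_cst.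
- exact: msubst_ord.
- exact: mvl_fsubst.
Qed.

End Continuous.

End MSeriesTheory.
Arguments mvl {R K}.

Section Renaming.
Variables (R : idomainType) (K : choiceType) (s : K -> K).
Local Notation P := {malg R[{cmonom K}]}.
Local Notation M := (mseries R K).

Lemma poly_renE (p : P) : poly_ren s p = mev (@malgC _ R) (fun k => mvar R (s k)) p.
Proof. by rewrite /poly_ren mmapE. Qed.

Lemma mser_ren_is_zmod_morphism : zmod_morphism (@mser_ren R K s).
Proof.
move=> a b; apply: mvl_inj; apply: seriesP => d.
by rewrite [LHS]/= !rmorphB !coefsB /= !poly_renE raddfB.
Qed.
HB.instance Definition _ :=
  GRing.isZmodMorphism.Build _ _ (@mser_ren R K s) mser_ren_is_zmod_morphism.

Lemma mser_ren_is_monoid_morphism : monoid_morphism (@mser_ren R K s).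
Proof.
split=> [|a b]; apply: mvl_inj; apply: seriesP => d.
  rewrite rmorph1 [LHS]/= poly_renE !coefs1; case: eqP => _; first by rewrite rmorph1.
  by rewrite raddf0.
rewrite [RHS](coefsM (mvl (mser_ren s a)) (mvl (mser_ren s b))).
transitivity (poly_ren s (coefs (mvl a * mvl b) d)); first by [].
rewrite coefsM poly_renE rmorph_sum; apply: eq_bigr => i _.
by rewrite rmorphM [in RHS]/= !poly_renE.
Qed.
HB.instance Definition _ :=
  GRing.isMonoidMorphism.Build _ _ (@mser_ren R K s) mser_ren_is_monoid_morphism.

Lemma mser_ren_ord k (a : M) : ser_ord k (mvl a) -> ser_ord k (mvl (mser_ren s a)).
Proof. by move=> h d dk /=; rewrite [coefs a d]h // poly_renE raddf0. Qed.

Lemma mser_ren_poly (p : P) : mser_ren s (poly_mser p) = poly_mser (poly_ren s p).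
Proof.
rewrite !poly_mserE; elim/malg_ind: p => [a|k|p q ep eq|p q ep eq].
- rewrite poly_renE !mevC; apply: mvl_inj; apply: seriesP => d.
  by rewrite /= poly_renE; case: eqP => _; rewrite ?mevC ?raddf0.
- rewrite poly_renE !mev_var; apply: mvl_inj; rewrite xv_mono; apply: seriesP => d.
  transitivity (poly_ren s (coefs (mvl (xv R k)) d)); first by [].
  by rewrite xv_mono poly_renE /=; case: eqP => _; rewrite ?mev_var ?raddf0.
- by rewrite poly_renE !rmorphD /= ep eq !poly_renE.
by rewrite poly_renE !rmorphM /= ep eq !poly_renE.
Qed.

Lemma mser_ren_xv k : mser_ren s (xv R k) = xv R (s k).
Proof. by rewrite mser_ren_poly poly_renE mev_var. Qed.

Lemma mser_ren_fsubst (F : nat -> nat -> R) (a b : M) :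
  ser_ord 1 (mvl a) -> ser_ord 1 (mvl b) ->
  mser_ren s (fsubst F a b) = fsubst F (mser_ren s a) (mser_ren s b).
Proof.
move=> ha hb; apply: mvl_inj; rewrite mvl_fsubst.
apply: (@sfs_morph _ _ (@mser_cst R K) _ _ (@malgC _ R) (@malgC _ R)
  (@mvl R K) (@mvl R K \o @mser_ren R K s)) => //.
- move=> r; apply: seriesP => d; rewrite /= poly_renE.
  by case: eqP => _; rewrite ?mevC ?raddf0.
- exact: mser_ren_ord.
- exact: mvl_fsubst.
Qed.

End Renaming.

Section SeriesDomain.
Variable B : idomainType.

Lemma ser_lead (a : series B) : a <> 0 ->
  exists k, ser_ord k a /\ coefs a k != 0.
Proof.
move=> a0; have [|/forallNP h] := pselect (exists k, coefs a k != 0); last first.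
  by case: a0; apply: seriesP => d; have /negP := h d; rewrite negbK => /eqP.
move=> ex; case: (ex_minnP ex) => k ak kmin; exists k; split=> // d dk.
by apply/eqP/negPn/negP => /kmin; rewrite leqNgt dk.
Qed.

(** Over a domain the order is a valuation. *)
Lemma ser_ordM_inv i j (a b : series B) : ser_ord i a -> coefs a i != 0 ->
  ser_ord (i + j) (a * b) -> ser_ord j b.
Proof.
move=> ha ai; elim: j => [//|j ih] hab.
have hb : ser_ord j b by apply: ih; apply: ser_ord_le hab; rewrite addnS.
move=> d; rewrite ltnS leq_eqVlt => /orP[/eqP ->|/hb //].
have : coefs (a * b) (i + j) = 0 by apply: hab; rewrite addnS.
by rewrite coefsM_ord // => /eqP; rewrite mulf_eq0 (negPf ai) => /eqP.
Qed.

Lemma ser_mulf_eq0 (a b : series B) : a * b = 0 -> a = 0 \/ b = 0.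
Proof.
move=> ab; have [->|a0] := pselect (a = 0); first by left.
right; have [k [ha ak]] := ser_lead a0; apply: ser_ordP => j.
by apply: (ser_ordM_inv ha ak); rewrite ab.
Qed.
End SeriesDomain.

(** * The group of series without constant term under a formal group law *)

Section FormalGroup.
Variables (R : idomainType) (F : fgl R) (B : comPzRingType) (c : {rmorphism R -> B}).

Definition ord1_pred : {pred series B} := fun a => `[< ser_ord 1 a >].
(** The law and the coefficient morphism are parameters of the type so that its group structure can
    depend on them. *)
Record fgroup_of (phF : fgl R) (phc : {rmorphism R -> B}) :=
  FGroup { fg_val : series B; _ : fg_val \in ord1_pred }.
HB.instance Definition _ phF phc := [isSub for @fg_val phF phc].
HB.instance Definition _ phF phc := [Choice of fgroup_of phF phc by <:].

Local Notation G := (fgroup_of F c).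

Lemma fg_ord1 (a : G) : ser_ord 1 (fg_val a).
Proof. by apply/asboolP; apply: (valP a). Qed.

Definition fg_mk a (ha : ser_ord 1 a) : G := @FGroup F c a (introT (asboolP _) ha).

Lemma fg_ext (a b : G) : fg_val a = fg_val b -> a = b.
Proof. exact: val_inj. Qed.

Definition fg_zero : G := fg_mk (@ser_ord_zero B 1).
Definition fg_add (a b : G) : G := fg_mk (sfs_ord1 F c (fg_ord1 a) (fg_ord1 b)).
Lemma fg_opp_subproof (a : G) : exists b : G, fg_add b a = fg_zero.
Proof.
have [b hb e] := sfs_inverse F c (fg_ord1 a).
by exists (fg_mk hb); apply: fg_ext; rewrite /= sfs_comm.
Qed.
Definition fg_opp a : G := sval (cid (fg_opp_subproof a)).

Lemma fg_addC : commutative fg_add.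
Proof. by move=> a b; apply: fg_ext; apply: sfs_comm. Qed.

Lemma fg_add0 : left_id fg_zero fg_add.
Proof.
move=> a; apply: fg_ext; rewrite [LHS]/= sfs_mixed ?add0r ?mul0r ?addr0 //.
exact: fg_ord1.
Qed.

Lemma fg_addN : left_inverse fg_zero fg_opp fg_add.
Proof. by move=> a; rewrite /fg_opp; case: cid. Qed.

(** The identity in R[[x_0, x_1, x_2]] is specialized by the continuous substitution of [t k] for
    x_k. *)
Lemma fg_addA : associative fg_add.
Proof.
move=> x y z; apply: fg_ext; rewrite /=.
pose t (k : 'I_3) := if k == 0 :> nat then fg_val x else
  if k == 1%N :> nat then fg_val y else fg_val z.
have t1 k : ser_ord 1 (t k) by rewrite /t; case: eqP => _; [|case: eqP => _]; apply: fg_ord1.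
pose X k : mseries R 'I_3 := xv R (inord k).
have Xo k : ser_ord 1 (mvl (X k)) by rewrite xv_mono; apply: ser_mono_ord.
have Xt k : msubst c t (X k) = t (inord k) by exact: msubst_xv.
have [e0 e1 e2] : [/\ t (inord 0) = fg_val x, t (inord 1) = fg_val y & t (inord 2) = fg_val z].
  by rewrite /t !inordK.
have : fsubst F (fsubst F (X 0%N) (X 1%N)) (X 2%N) =
    fsubst F (X 0%N) (fsubst F (X 1%N) (X 2%N)) by exact: (fgl_assoc F).
move: (Xo 0%N) (Xo 1%N) (Xo 2%N) (Xt 0%N) (Xt 1%N) (Xt 2%N); rewrite e0 e1 e2.
move: (X 0%N) (X 1%N) (X 2%N) => a0 a1 a2 o0 o1 o2 E0 E1 E2.
have oF a b : ser_ord 1 (mvl a) -> ser_ord 1 (mvl b) -> ser_ord 1 (mvl (fsubst F a b)).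
  by move=> ha hb; rewrite mvl_fsubst; apply: sfs_ord1.
move=> /(congr1 (msubst c t)); rewrite !msubst_fsubst ?E0 ?E1 ?E2 //; try exact: oF.
Qed.

HB.instance Definition _ :=
  GRing.isZmodule.Build G fg_addA fg_addC fg_add0 fg_addN.

Lemma fg_valD (a b : G) : fg_val (a + b) = sfs c F (fg_val a) (fg_val b).
Proof. by []. Qed.

Lemma fg_val0 : fg_val (0 : G) = 0. Proof. by []. Qed.

Definition fg_lead (a : G) : B := coefs (fg_val a) 1.

(** The mixed terms of F have order at least 2, so that on linear coefficients F is addition. *)
Lemma fg_lead_is_zmod_morphism : zmod_morphism fg_lead.
Proof.
have D a b : fg_lead (a + b) = fg_lead a + fg_lead b.
  rewrite /fg_lead fg_valD (sfs_mixed _ _ (fg_ord1 a) (fg_ord1 b)) !coefsD.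
  have h2 : ser_ord 2 (fg_val a * fg_val b) := ser_ordM (fg_ord1 a) (fg_ord1 b).
  by rewrite (ser_ordM h2 (@ser_ord0 _ _)) ?addr0.
by move=> a b; apply/eqP; rewrite eq_sym subr_eq -D subrK.
Qed.
HB.instance Definition _ :=
  GRing.isZmodMorphism.Build G B fg_lead fg_lead_is_zmod_morphism.

End FormalGroup.

(** * Ideals and lattices *)

Lemma ideal_span_gen (A : comPzRingType) (G : set A) x : G x -> x \in ideal_span G.
Proof.
move=> Gx; apply/ideal_spanP; exists [:: (1, x)]; last by rewrite big_seq1 mul1r.
by move=> p; rewrite inE => /eqP ->.
Qed.

Lemma ideal_span_ind (A : comPzRingType) (G : set A) (I : set A) :
  I 0 -> (forall x y, I x -> I y -> I (x + y)) -> (forall a x, G x -> I (a * x)) ->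
  forall x, x \in ideal_span G -> I x.
Proof.
move=> I0 ID IG x /ideal_spanP[s sG ->]; rewrite big_seq.
by apply: (big_ind I) => // p /sG; apply: IG.
Qed.

Lemma ideal_span_kill (A A' : comPzRingType) (f : {rmorphism A -> A'}) (G : set A) :
  (forall x, G x -> f x = 0) -> forall x, x \in ideal_span G -> f x = 0.
Proof.
move=> h; apply: ideal_span_ind => [|x y|a x /h]; first exact: rmorph0.
  by rewrite rmorphD => -> ->; rewrite addr0.
by rewrite rmorphM => ->; rewrite mulr0.
Qed.

Lemma pchar0_int (R : idomainType) (z : int) :
  [pchar R] =i pred0 -> z%:~R = 0 :> R -> z = 0.
Proof.
move=> /pcharf0P h; case: z => m /eqP; first by rewrite -pmulrn h => /eqP ->.
by rewrite NegzE mulrNz oppr_eq0 -pmulrn h.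
Qed.

Definition additive_of (U V : zmodType) (f : U -> V) (hf : zmod_morphism f) :
  {additive U -> V} :=
  HB.pack_for {additive U -> V} f (GRing.isZmodMorphism.Build U V f hf).

Section Lattice.
Variables (C : fieldType) (n : nat) (A : 'M[int]_n) (D : root_datum C A).
Variable L : demazure_lattice D.
Local Notation Lam := (lat L).

Lemma lat_valD (l m : Lam) : lat_val (l + m) = lat_val l + lat_val m. Proof. by []. Qed.
Lemma lat_ext (l m : Lam) : lat_val l = lat_val m -> l = m. Proof. exact: val_inj. Qed.
Lemma lat_valMz (l : Lam) z : lat_val (l *~ z) = lat_val l *~ z.
Proof. exact: (raddfMz (val : {additive Lam -> _})). Qed.
Lemma lat_val_sum (I : Type) (r : seq I) (Q : pred I) (E : I -> Lam) :
  lat_val (\sum_(i <- r | Q i) E i) = \sum_(i <- r | Q i) lat_val (E i).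
Proof. exact: (raddf_sum (val : {additive Lam -> _})). Qed.

(** Coordinates in a basis are unique, hence additive. *)
Lemma Zbasis_coord r (b : 'I_r -> _) : Zbasis L b ->
  exists (bl : 'I_r -> Lam) (co : 'I_r -> {additive Lam -> int}),
    [/\ forall i, lat_val (bl i) = b i,
        forall l, l = \sum_i bl i *~ co i l &
        forall i j, co i (bl j) = (i == j)%:Z].
Proof.
move=> [hb hfree].
have bL i : b i \in (L : {pred _}).
  apply/hb; exists (fun j => (j == i)%:Z); rewrite (bigD1 i) //= eqxx big1 ?addr0 //.
  by move=> j /negPf ->.
pose bl i : Lam := Lat (bL i).
have cE (l : Lam) : {c : 'I_r -> int | l = \sum_i bl i *~ c i}.
  apply: cid; have /hb[c e] := valP l; exists c; apply: lat_ext.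
  by rewrite lat_val_sum [LHS]e; apply: eq_bigr => i _; rewrite lat_valMz.
have uniq c d : \sum_i bl i *~ c i = \sum_i bl i *~ d i -> forall i, c i = d i.
  move=> e i; apply/eqP; rewrite -subr_eq0; apply/eqP.
  apply: (hfree (fun i => c i - d i)).
  under eq_bigr do rewrite mulrzBr.
  rewrite sumrB; move/(congr1 (@lat_val _ _ _ _ L)): e; rewrite !lat_val_sum.
  under eq_bigr do rewrite lat_valMz.
  under [in RHS]eq_bigr do rewrite lat_valMz.
  by move=> ->; rewrite subrr.
pose co i l := sval (cE l) i.
have coE l : l = \sum_i bl i *~ co i l by rewrite /co; case: (cE l).
have coB i : zmod_morphism (co i).
  move=> x y; apply: (uniq (fun i => co i (x - y)) (fun i => co i x - co i y)).
  rewrite -coE; under eq_bigr do rewrite mulrzBr.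
  by rewrite sumrB -!coE.
exists bl, (fun i => additive_of (coB i)).
split=> // i j; apply: (uniq (fun i => co i (bl j)) (fun i => (i == j)%:Z)).
rewrite -coE (bigD1 j) //= eqxx big1 ?addr0 // => k /negPf -> //.
Qed.

Lemma lat_basis : exists r (bl : 'I_r -> Lam) (co : 'I_r -> {additive Lam -> int}),
  (forall l, l = \sum_i bl i *~ co i l) /\ (forall i j, co i (bl j) = (i == j)%:Z).
Proof.
have [r [b hb]] := dl_free L; have [bl [co [_ h1 h2]]] := Zbasis_coord hb.
by exists r, bl, co.
Qed.

(** The form in which the extension of a simple root to a basis is used: a coordinate functional. *)
Lemma simple_root_dual i : exists co : {additive Lam -> int}, co (simple_root L i) = 1.
Proof.
have [r [b [k [hb bk]]]] := dl_ext L i; have [bl [co [e1 e2 e3]]] := Zbasis_coord hb.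
exists (co k); rewrite -[simple_root L i](_ : bl k = _) ?e3 ?eqxx //.
by apply: lat_ext; rewrite e1 bk.
Qed.

End Lattice.

(** * The formal group algebra and its associated graded ring *)

Section FormalGroupAlgebra.
Variables (R : idomainType) (F : fgl R).
Variables (C : fieldType) (n : nat) (A : 'M[int]_n) (D : root_datum C A).
Variable L : demazure_lattice D.
Local Notation Lam := (lat L).
Local Notation M := (mseries R Lam).
Local Notation P := {malg R[{cmonom Lam}]}.
Local Notation S := (fga F L).
Local Notation J := (ideal_closure (@fga_rel R F C n A D L)).

Definition fpi : {rmorphism M -> S} := @quo_pi M J.

Lemma fpi_repr (s : S) : fpi (fga_repr s) = s. Proof. exact: quo_reprK. Qed.
Lemma fpiP a b : fpi a = fpi b <-> a - b \in J.
Proof. exact: quo_piP. Qed.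

Definition xS (l : Lam) : S := fpi (xv R l).
Definition cS : {rmorphism R -> S} := fpi \o @mser_cst R Lam.

Lemma fga_rel_J a : @fga_rel R F C n A D L a -> fpi a = 0.
Proof.
move=> ha; rewrite -(rmorph0 fpi); apply/fpiP; rewrite subr0; apply/asboolP => k.
by exists a => //; apply: ideal_span_gen.
Qed.

Lemma xv_ord l : ser_ord 1 (mvl (xv R (l : Lam))).
Proof. by rewrite xv_mono; apply: ser_mono_ord. Qed.

Lemma xS0 : xS 0 = 0.
Proof. by apply: fga_rel_J; left. Qed.

Lemma xSD l m : exists h, xS (l + m) = xS l + xS m + xS l * xS m * h.
Proof.
exists (fpi (fsubst (fgl_mixed F) (xv R l) (xv R m))).
transitivity (fpi (fsubst F (xv R l) (xv R m))).
  by apply/eqP; rewrite -subr_eq0 -rmorphB; apply/eqP/fga_rel_J; right; exists l, m.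
have -> : fsubst F (xv R l) (xv R m) = xv R l + xv R m +
    xv R l * xv R m * fsubst (fgl_mixed F) (xv R l) (xv R m).
  apply: mvl_inj; rewrite mvl_fsubst sfs_mixed; try exact: xv_ord.
  by rewrite !rmorphD !rmorphM -!mvl_fsubst.
by rewrite !rmorphD !rmorphM.
Qed.

(* The k-th power of the augmentation ideal, see ideal_pow_Iord. *)
Definition Iord k (s : S) := exists2 a, ser_ord k (mvl a) & s = fpi a.

Lemma Iord0 k : Iord k 0. Proof. by exists 0; rewrite ?rmorph0. Qed.
Lemma IordD k s t : Iord k s -> Iord k t -> Iord k (s + t).
Proof.
move=> [a ha ->] [b hb ->]; exists (a + b); last by rewrite rmorphD.
by rewrite rmorphD; apply: ser_ordD.
Qed.
Lemma IordN k s : Iord k s -> Iord k (- s).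
Proof.
move=> [a ha ->]; exists (- a); last by rewrite rmorphN.
by rewrite rmorphN; apply: ser_ordN.
Qed.
Lemma IordB k s t : Iord k s -> Iord k t -> Iord k (s - t).
Proof. by move=> hs ht; apply: IordD => //; apply: IordN. Qed.
Lemma IordM i j s t : Iord i s -> Iord j t -> Iord (i + j) (s * t).
Proof.
move=> [a ha ->] [b hb ->]; exists (a * b); last by rewrite rmorphM.
by rewrite rmorphM; apply: ser_ordM.
Qed.
Lemma Iord_all s : Iord 0 s. Proof. by exists (fga_repr s); rewrite ?fpi_repr. Qed.
Lemma Iord_le k l s : (l <= k)%N -> Iord k s -> Iord l s.
Proof. by move=> lk [a ha ->]; exists a => //; apply: ser_ord_le ha. Qed.
Lemma IordMl k s t : Iord k t -> Iord k (s * t).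
Proof. by move=> ht; rewrite -[k]add0n; apply: IordM => //; apply: Iord_all. Qed.
Lemma Iord_sum k (I : Type) (r : seq I) (Q : pred I) (E : I -> S) :
  (forall i, Q i -> Iord k (E i)) -> Iord k (\sum_(i <- r | Q i) E i).
Proof. by move=> h; apply: (big_ind (Iord k)) => [|x y|//]; [apply: Iord0|apply: IordD]. Qed.
Lemma Iord_x l : Iord 1 (xS l). Proof. by exists (xv R l) => //; apply: xv_ord. Qed.

Lemma Iord_poly d (p : P) : p \in homog d -> Iord d (fpi (poly_mser p)).
Proof. by move=> hp; exists (poly_mser p) => //; rewrite (poly_mser_mono hp);
  apply: ser_mono_ord. Qed.

(** A representative of [s] is, for every k, an element of [J] plus a series of order k; as [J] is
    closed, it lies in [J]. *)
Lemma Iord_separated s : (forall k, Iord k s) -> s = 0.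
Proof.
move=> h; rewrite -[s]fpi_repr -(rmorph0 fpi); apply/fpiP; rewrite subr0.
apply/asboolP => k; have [a ha e] := h k.
have /asboolP/(_ k)[b bJ eb] : fga_repr s - a \in J by apply/fpiP; rewrite fpi_repr.
exists b => // d dk; rewrite -eb // -[RHS]/(coefs (mvl (fga_repr s - a)) d).
by rewrite rmorphB coefsB [X in _ - X]ha // subr0.
Qed.

Lemma Iord_complete (E : nat -> S) : (forall k, Iord k (E k)) ->
  exists s, forall N, Iord N (s - \sum_(i < N) E i).
Proof.
move=> h; have /choice[a ha] k : exists a, ser_ord k (mvl a) /\ E k = fpi a.
  by have [a ? ?] := h k; exists a.
exists (fpi (mser_sum a)) => N.
exists (mser_sum a - \sum_(i < N) a i).
  rewrite rmorphB; apply/ser_eqmP; apply: mser_sum_eqm => k; exact: (ha k).1.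
by rewrite rmorphB rmorph_sum; congr (_ - _); apply: eq_bigr => i _; rewrite (ha i).2.
Qed.

(** [g] is the component of degree k of a representative of order k. *)
Lemma fga_split k s : exists2 g : P, g \in homog k &
  Iord k s -> Iord k.+1 (s - fpi (poly_mser g)).
Proof.
have [[a ha ->]|ns] := pselect (Iord k s); last by exists 0; rewrite ?rpred0.
exists (coefs a k) => [|_]; first exact: coefs_homog.
exists (a - poly_mser (coefs a k)); last by rewrite rmorphB.
rewrite rmorphB (poly_mser_mono (coefs_homog a k)) => d.
rewrite ltnS leq_eqVlt coefsB /= => /orP[/eqP ->|dk]; first by rewrite eqxx subrr.
by rewrite [X in X - _]ha // ltn_eqF // subr0.
Qed.

Lemma fpi_poly_mev (p : P) : fpi (poly_mser p) = mev cS xS p.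
Proof.
rewrite poly_mserE; apply: (@malg_ext R Lam _ (fpi \o mev (@mser_cst R Lam) (xv R (K:=Lam)))
  (mev cS xS)).
  by move=> a; rewrite /= !mevC.
by move=> k; rewrite /= !mev_var.
Qed.

(** A product of d factors of order 1 changes by order d + 1 when the factors are changed, one after
    the other, by order 2. *)
Lemma mev_congr (t t' : Lam -> S) d (p : P) :
  (forall l, Iord 1 (t l)) -> (forall l, Iord 1 (t' l)) ->
  (forall l, Iord 2 (t l - t' l)) -> p \in homog d ->
  Iord d.+1 (mev cS t p - mev cS t' p).
Proof.
move=> h h' hh /homogP hp; rewrite /mev -sumrB big_seq; apply: Iord_sum => m.
rewrite -mcoeff_neq0 => /hp <- {hp}; rewrite -mulrBr; apply: IordMl.
suff [] : [/\ Iord (mdeg m) (mev_mon t m), Iord (mdeg m) (mev_mon t' m)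
  & Iord (mdeg m).+1 (mev_mon t m - mev_mon t' m)] by [].
have pr i j a a' b b' : [/\ Iord i a, Iord i a' & Iord i.+1 (a - a')] ->
    [/\ Iord j b, Iord j b' & Iord j.+1 (b - b')] ->
    [/\ Iord (i + j) (a * b), Iord (i + j) (a' * b') & Iord (i + j).+1 (a * b - a' * b')].
  move=> [h1 h2 h3] [k1 k2 k3]; split; try exact: IordM.
  have -> : a * b - a' * b' = (a - a') * b + a' * (b - b') by ring.
  by apply: IordD; [rewrite -addSn|rewrite -addnS]; apply: IordM.
have p1 : [/\ Iord 0 1, Iord 0 1 & Iord 1 (1 - 1)].
  by rewrite subrr; split; [apply: Iord_all|apply: Iord_all|apply: Iord0].
rewrite /mev_mon mdegE; elim: (enum_fset _) => [|k s ih]; first by rewrite !big_nil.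
rewrite !big_cons; apply/pr => //; elim: (m k) => [|j IH]; first by rewrite !expr0.
by rewrite !exprS -add1n; apply/pr.
Qed.

Section Basis.
Variables (r : nat) (bl : 'I_r -> Lam) (co : 'I_r -> {additive Lam -> int}).
Hypothesis blE : forall l, l = \sum_i bl i *~ co i l.
Hypothesis coE : forall i j, co i (bl j) = (i == j)%:Z.

(** The additive map with the values of [xS] on the basis; it linearizes [xS] modulo order 2. *)
Definition lamS (l : Lam) : S := \sum_i xS (bl i) *~ co i l.

Lemma lamSD l m : lamS (l + m) = lamS l + lamS m.
Proof. by rewrite -big_split; apply: eq_bigr => i _; rewrite raddfD mulrzDr. Qed.

Lemma Iord_lamS l : Iord 1 (lamS l).
Proof.
apply: Iord_sum => i _; case: (co i l) => m.
  elim: m => [|m ih]; first exact: Iord0.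
  by rewrite intS mulrzDr; apply: IordD => //; apply: Iord_x.
rewrite NegzE mulrNz; apply: IordN; elim: m.+1 => [|k ih]; first exact: Iord0.
by rewrite intS mulrzDr; apply: IordD => //; apply: Iord_x.
Qed.

(** By [xSD], [xS] is additive modulo order 2, so that the vectors where it agrees with [lamS] form
    a subgroup; it contains the basis. *)
Lemma Iord_xS_lamS l : Iord 2 (xS l - lamS l).
Proof.
pose e l := Iord 2 (xS l - lamS l).
have ED l1 l2 : Iord 2 (xS (l1 + l2) - lamS (l1 + l2) - (xS l1 - lamS l1) - (xS l2 - lamS l2)).
  have [h ->] := xSD l1 l2; rewrite lamSD.
  have -> : xS l1 + xS l2 + xS l1 * xS l2 * h - (lamS l1 + lamS l2) - (xS l1 - lamS l1) - (xS l2 - lamS l2)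
    = h * (xS l1 * xS l2).
    by move: (xS l1) (xS l2) (lamS l1) (lamS l2) => a b c d; ring.
  by apply: IordMl; apply: (IordM (i := 1) (j := 1)); apply: Iord_x.
have eD l1 l2 : e l1 -> e l2 -> e (l1 + l2).
  move=> h1 h2; rewrite /e; have := IordD (IordD (ED l1 l2) h2) h1; congr Iord.
  by move: (xS _) (xS l1) (xS l2) (lamS _) (lamS l1) (lamS l2) => a b c d e' f; ring.
have lam0 : lamS 0 = 0 by rewrite /lamS big1 // => i _; rewrite raddf0 mulr0z.
have e0 : e 0 by rewrite /e xS0 lam0 subrr; apply: Iord0.
have eN l1 : e l1 -> e (- l1).
  move=> h1; have := ED l1 (- l1); rewrite subrr xS0 lam0 => h2.
  rewrite /e; have := IordN (IordD h2 h1); congr Iord.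
  by move: (xS l1) (xS (- l1)) (lamS l1) (lamS _) => a b c d; ring.
have eB i : e (bl i).
  suff E : lamS (bl i) = xS (bl i) by rewrite /e E subrr; apply: Iord0.
  rewrite /lamS (eq_bigr (fun j => if j == i then xS (bl j) else 0)).
    by rewrite -big_mkcond big_pred1_eq.
  by move=> j _; rewrite coE; case: (j == i); [exact: mulr1z|exact: mulr0z].
have eZ i z : e (bl i *~ z).
  have eP m : e (bl i *~ Posz m).
    elim: m => [|m ih]; first by rewrite mulr0z.
    by rewrite intS mulrzDr; apply/eD; rewrite ?mulr1z.
  by case: z => m //; rewrite NegzE mulrNz; apply: eN.
rewrite -/(e l) [l]blE; apply: (big_ind e) => //.
Qed.

(** Rewrites every variable in those of the basis. This changes neither the class of a polynomial in
    Sym nor, by [Iord_red], the leading class of a form in S. *)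
Definition redP : {rmorphism P -> P} :=
  mev (@malgC _ R) (fun l => \sum_i mvar R (bl i) *~ co i l).

Lemma redP_var l : redP (mvar R l) = \sum_i mvar R (bl i) *~ co i l.
Proof. exact: mev_var. Qed.

Lemma redP_cst a : redP a%:MP = a%:MP.
Proof. exact: mevC. Qed.

Lemma mev_red p : mev cS xS (redP p) = mev cS lamS p.
Proof.
apply: (mev_uniq (f := mev cS xS \o redP)) => [a|l].
  transitivity (mev cS xS (redP a%:MP)); [by []|rewrite redP_cst].
  exact: mevC.
transitivity (mev cS xS (redP (mvar R l))); [by []|rewrite redP_var rmorph_sum].
apply: eq_bigr => i _; rewrite rmorphMz; congr (_ *~ _); exact: mev_var.
Qed.

Lemma Iord_red d (p : P) : p \in homog d ->
  Iord d.+1 (fpi (poly_mser p) - fpi (poly_mser (redP p))).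
Proof.
move=> hp; rewrite !fpi_poly_mev.
rewrite mev_red.
apply: mev_congr hp => l; [exact: Iord_x|exact: Iord_lamS|exact: Iord_xS_lamS].
Qed.

Definition Ispan d (s : S) := exists2 h : 'I_r -> S,
  forall i, Iord d (h i) & s = \sum_i xS (bl i) * h i.

(** The leading form of [s], evaluated at [lamS], is a sum of monomials of degree k + 1, each with a
    factor [lamS l] that is a combination of the x_(b_i). *)
Lemma Ispan_step k s : Iord k.+1 s ->
  exists h : 'I_r -> S, (forall i, Iord k (h i)) /\ Iord k.+2 (s - \sum_i xS (bl i) * h i).
Proof.
move=> hs; have [g hg /(_ hs) hsg] := fga_split k.+1 s.
have Ired := Iord_red hg.
have Isp0 d : Ispan d 0.
  by exists (fun=> 0) => [i|]; [apply: Iord0|rewrite big1 // => i _; rewrite mulr0].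
have IspD d a b : Ispan d a -> Ispan d b -> Ispan d (a + b).
  move=> [h h1 ->] [h' h1' ->]; exists (fun i => h i + h' i) => [i|]; first exact: IordD.
  by rewrite -big_split; apply: eq_bigr => i _; rewrite mulrDr.
have IspM d e a b : Iord e a -> Ispan d b -> Ispan (d + e) (a * b).
  move=> ha [h h1 ->]; exists (fun i => h i * a) => [i|]; first exact: IordM.
  by rewrite mulr_sumr; apply: eq_bigr => i _; rewrite mulrCA [a * _]mulrC.
have Isplam l : Ispan 0 (lamS l).
  exists (fun i => 1 *~ co i l) => [i|]; first exact: Iord_all.
  by apply: eq_bigr => i _; exact: (esym (mulrzr _ _)).
suff [h h1 h2] : Ispan k (fpi (poly_mser (redP g))).
  exists h; split=> //; rewrite -h2.
  have := IordD hsg Ired; congr Iord.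
  by move: (fpi _) (fpi _) => a b; ring.
rewrite fpi_poly_mev.
rewrite mev_red.
rewrite /mev big_seq; apply: (big_ind (Ispan k) (Isp0 k) (IspD k)) => m.
rewrite -mcoeff_neq0; move/homogP: hg => hg /hg mk.
rewrite -[k]addn0; apply/IspM; first exact: Iord_all.
(* Degree 0 is allowed so that the induction over the variables can start from the empty product. *)
suff : mdeg m = 0%N \/ Ispan (mdeg m).-1 (mev_mon lamS m) by rewrite mk; case.
rewrite /mev_mon mdegE; elim: (enum_fset _) => [|l q ih]; first by left; rewrite big_nil.
rewrite !big_cons; have lamX j : Iord j (lamS l ^+ j).
  elim: j => [|j IH]; first exact: Iord_all.
  by rewrite exprS -add1n; apply: IordM => //; apply: Iord_lamS.
have Iq : Iord (\sum_(j <- q) m j) (\prod_(j <- q) lamS j ^+ m j).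
  elim: (q) => [|j w IH]; first by rewrite !big_nil; apply: Iord_all.
  rewrite !big_cons; apply: IordM => //; elim: (m j) => [|j' IH']; first exact: Iord_all.
  by rewrite exprS -add1n; apply: IordM => //; apply: Iord_lamS.
case E : (m l) => [|j]; first by rewrite expr0 mul1r add0n.
right; rewrite addSn /= exprS -mulrA mulrC.
by rewrite -[(j + _)%N]add0n; apply: IspM => //; apply: IordM.
Qed.

(** Corrects the cofactors by [Ispan_step] infinitely often, using completeness. It reconciles the
    topological [Iord] with the algebraic powers of the augmentation ideal, whose elements are
    finite sums of products. *)
Lemma Iord_span k s : Iord k.+1 s -> Ispan k s.
Proof.
move=> hs.
pose next (st : S * nat) : 'I_r -> S := 
  if pselect (Iord st.2.+1 st.1) is left h then sval (cid (Ispan_step h)) else fun=> 0.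
(* [rest j] is what remains of [s] after j corrections, of order at least k + j + 1. *)
pose rest := fix rest j := if j is j'.+1 then
  rest j' - \sum_i xS (bl i) * next (rest j', (k + j')%N) i else s.
pose h j := next (rest j, (k + j)%N).
have inv j : Iord (k + j).+1 (rest j) /\ forall i, Iord (k + j) (h j i).
  have st m : Iord (k + m).+1 (rest m) ->
     (forall i, Iord (k + m) (h m i)) /\ Iord (k + m).+2 (rest m.+1).
    rewrite /h /= /next /=; case: pselect => // p _; case: cid => w [w1 w2] /=.
    by split.
  elim: j => [|j [ih1 ih2]]; first by rewrite addn0; split=> //; have := st 0%N;
    rewrite addn0 => /(_ hs)[].
  have [h1 h2] := st _ ih1; split; first by rewrite addnS.
  by have := st j.+1; rewrite addnS => /(_ h2)[].
have restE j : rest j = s - \sum_i xS (bl i) * \sum_(m < j) h m i.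
  have restS m : rest m.+1 = rest m - \sum_i xS (bl i) * h m i by [].
  elim: j => [|j ih].
    by rewrite big1 ?subr0 // => i _; rewrite big_ord0 mulr0.
  rewrite restS ih -addrA -opprD -big_split; congr (_ - _); apply: eq_bigr => i _.
  rewrite big_ord_recr; exact: (esym (mulrDr _ _ _)).
have /choice[H HE] i : exists t, forall N, Iord N (t - \sum_(m < N) h m i).
  apply: (@Iord_complete (fun m => h m i)) => j; apply: Iord_le ((inv j).2 i); exact: leq_addl.
exists H => [i|].
  rewrite -[H i](subrK (\sum_(m < k) h m i)); apply: IordD; first exact: HE.
  by apply: Iord_sum => m _; apply: Iord_le ((inv m).2 i); exact: leq_addr.
apply/eqP; rewrite -subr_eq0; apply/eqP/Iord_separated => N.
have -> : s - \sum_i xS (bl i) * H i =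
   rest N - \sum_i xS (bl i) * (H i - \sum_(m < N) h m i).
  have -> : \sum_i xS (bl i) * (H i - \sum_(m < N) h m i) =
      \sum_i xS (bl i) * H i - \sum_i xS (bl i) * \sum_(m < N) h m i.
    by rewrite -sumrB; apply: eq_bigr => i _; exact: mulrBr.
  by rewrite restE opprB addrA subrK.
apply: IordB; first by apply: Iord_le (inv N).1; lia.
by apply: Iord_sum => i _; apply: IordMl; apply: HE.
Qed.

End Basis.
End FormalGroupAlgebra.

(** * A faithful model of the formal group algebra and of the symmetric algebra *)

Section Model.
Variables (R : idomainType) (charR0 : [pchar R] =i pred0) (F : fgl R).
Variables (C : fieldType) (n : nat) (A : 'M[int]_n) (D : root_datum C A).
Variable L : demazure_lattice D.
Local Notation Lam := (lat L).
Local Notation M := (mseries R Lam).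
Local Notation P := {malg R[{cmonom Lam}]}.
Local Notation S := (fga F L).
Local Notation Sym := (sym R L).
Local Notation J := (ideal_closure (@fga_rel R F C n A D L)).

Definition spi : {rmorphism P -> Sym} := @quo_pi P (ideal_span (@sym_rel R C n A D L)).
Lemma spi_repr (p : Sym) : spi (sym_repr p) = p. Proof. exact: quo_reprK. Qed.
Lemma spiP p q : spi p = spi q <-> p - q \in ideal_span (@sym_rel R C n A D L).
Proof. exact: quo_piP. Qed.

Definition xSym (l : Lam) : Sym := spi (mvar R l).

Lemma xSymD l m : xSym (l + m) = xSym l + xSym m.
Proof.
rewrite /xSym -rmorphD; apply/spiP; apply: ideal_span_gen; by exists l, m.
Qed.

Lemma xSym_zmod : zmod_morphism xSym.
Proof. by move=> l m; apply/eqP; rewrite eq_sym subr_eq -xSymD subrK. Qed.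
HB.instance Definition _ := GRing.isZmodMorphism.Build Lam Sym xSym xSym_zmod.

Section Construction.
Variables (r : nat) (bl : 'I_r -> Lam) (co : 'I_r -> {additive Lam -> int}).
Hypothesis blE : forall l, l = \sum_i bl i *~ co i l.
Hypothesis coE : forall i j, co i (bl j) = (i == j)%:Z.
Variables (B : idomainType) (c : {rmorphism R -> B}) (X : 'I_r -> B).
Hypothesis univ : forall (E : comNzRingType) (e : {rmorphism R -> E}) (t : 'I_r -> E),
    exists psi : {rmorphism B -> E},
      (forall a, psi (c a) = e a) /\ (forall i, psi (X i) = t i).

Definition lamB (l : Lam) : B := \sum_i X i *~ co i l.

(** Specializing X_i to 1 and the other variables to 0 reads off the i-th coordinate in R, where in
    characteristic 0 an integer vanishes only if it is 0. *)
Lemma lamB_eq0 l : lamB l = 0 -> l = 0.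
Proof.
move=> l0; rewrite [l]blE big1 // => i _.
suff -> : co i l = 0 by rewrite mulr0z.
have [psi [_ pX]] := univ (@idfun R : {rmorphism R -> R}) (fun j => (j == i)%:R).
apply: (pchar0_int charR0); have := congr1 psi l0.
rewrite rmorph0 rmorph_sum (bigD1 i) //= rmorphMz pX eqxx big1 ?addr0 // => j ji.
by rewrite rmorphMz pX (negPf ji) mul0rz.
Qed.

Lemma c_inj a : c a = 0 -> a = 0.
Proof.
have [psi [pc _]] := univ (@idfun R : {rmorphism R -> R}) (fun j => 0).
by move=> /(congr1 psi); rewrite pc rmorph0.
Qed.

Definition linP : {rmorphism P -> B} := mev c lamB.

Lemma linP_var l : linP (mvar R l) = lamB l. Proof. exact: mev_var. Qed.
Lemma linP_cst a : linP a%:MP = c a. Proof. exact: mevC. Qed.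

(** The morphism from [B] back to polynomials that sends X_i to the variable of b_i, composed with
    [linP], is [redP]. *)
Lemma linP_red p : linP p = 0 -> redP R bl co p = 0.
Proof.
have [psi [pc pX]] := @univ P (@malgC _ R) (fun i => mvar R (bl i)).
have e : psi \o linP =1 redP R bl co.
  apply: mev_uniq => [a|l].
    transitivity (psi (linP a%:MP)); first by [].
    by rewrite linP_cst pc.
  transitivity (psi (linP (mvar R l))); first by [].
  rewrite linP_var rmorph_sum; apply: eq_bigr => i _.
  by rewrite rmorphMz pX.
by move=> p0; rewrite -e /= p0 rmorph0.
Qed.

Definition fgX (i : 'I_r) : fgroup_of F c := fg_mk F c (@ser_mono_ord B 1 (X i)).
(** The homomorphism from the lattice to the formal group over B[[t]] with b_i |-> X_i t. *)
Definition fgth (l : Lam) : fgroup_of F c := \sum_i fgX i *~ co i l.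
Definition th (l : Lam) : series B := fg_val (fgth l).

Lemma fgthD l m : fgth (l + m) = fgth l + fgth m.
Proof. by rewrite -big_split; apply: eq_bigr => i _; rewrite raddfD mulrzDr. Qed.

Lemma th1 l : ser_ord 1 (th l). Proof. exact: fg_ord1. Qed.

Lemma thD l m : th (l + m) = sfs c F (th l) (th m).
Proof. by rewrite /th fgthD. Qed.

Lemma th0 : th 0 = 0.
Proof. by rewrite /th /fgth big1 ?fg_val0 // => i _; rewrite raddf0 mulr0z. Qed.

Lemma th_lead l : coefs (th l) 1 = lamB l.
Proof.
rewrite -[LHS]/(fg_lead (fgth l)) raddf_sum; apply: eq_bigr => i _.
by rewrite raddfMz.
Qed.

Definition ThM : {rmorphism M -> series B} := msubstr c th1.

Lemma ThM_xv l : ThM (xv R l) = th l. Proof. exact: msubst_xv th1 l. Qed.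

Lemma ThM_ord k a : ser_ord k (mvl a) -> ser_ord k (ThM a).
Proof. exact: msubst_ord. Qed.

Lemma ThM_fsubst l m : ThM (fsubst F (xv R l) (xv R m)) = sfs c F (th l) (th m).
Proof.
rewrite -!ThM_xv; apply: (msubst_fsubst c th1); exact: xv_ord.
Qed.

(** The generators die because [fgth] is a homomorphism, their limits because B[[t]] is
    separated. *)
Lemma ThM_J a : a \in J -> ThM a = 0.
Proof.
have kill b : b \in ideal_span (@fga_rel R F C n A D L) -> ThM b = 0.
  apply: (ideal_span_kill (f := ThM)) => {}b [->|[l [m ->]]].
    exact: (etrans (ThM_xv 0) th0).
  rewrite rmorphB; apply/eqP; rewrite subr_eq0; apply/eqP.
  apply: etrans (ThM_xv (l + m)) _; rewrite thD; exact: esym (ThM_fsubst l m).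
move=> /asboolP h; apply: ser_ordP => k; have [b bJ e] := h k.
have -> : a = b + (a - b) by rewrite addrC subrK.
rewrite rmorphD kill // add0r; apply: ThM_ord.
by rewrite rmorphB; apply/ser_eqmP.
Qed.

Definition Theta (s : S) : series B := ThM (fga_repr s).

Lemma Theta_pi a : Theta (fpi F L a) = ThM a.
Proof.
have : fga_repr (fpi F L a) - a \in J by apply/fpiP; rewrite fpi_repr.
by move=> /ThM_J; rewrite rmorphB => /subr0_eq.
Qed.

Lemma Theta_zmod : zmod_morphism Theta.
Proof. by move=> s t; rewrite -[s]fpi_repr -[t]fpi_repr -rmorphB !Theta_pi rmorphB. Qed.
HB.instance Definition _ := GRing.isZmodMorphism.Build S (series B) Theta Theta_zmod.

Lemma Theta_monoid : monoid_morphism Theta.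
Proof.
split=> [|s t]; first by rewrite -(rmorph1 (fpi F L)) Theta_pi rmorph1.
by rewrite -[s]fpi_repr -[t]fpi_repr -rmorphM !Theta_pi rmorphM.
Qed.
HB.instance Definition _ := GRing.isMonoidMorphism.Build S (series B) Theta Theta_monoid.

Lemma Theta_ord k s : Iord k s -> ser_ord k (Theta s).
Proof. by move=> [a ha ->]; rewrite Theta_pi; apply: ThM_ord. Qed.

Lemma mev_lead : mev c (fun l => coefs (th l) 1) =1 linP.
Proof.
move=> p; rewrite /linP /=; congr mev; apply/funext => l; exact: th_lead.
Qed.

Lemma ThM_lead k a : ser_ord k (mvl a) -> coefs (ThM a) k = linP (coefs a k).
Proof. by move=> h; rewrite -mev_lead; exact: (msubst_lead c th1 h). Qed.

Lemma Theta_lead k (g : P) s : g \in homog k ->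
  Iord k.+1 (s - fpi F L (poly_mser g)) -> coefs (Theta s) k = linP g.
Proof.
move=> hg /Theta_ord h.
have : coefs (Theta s - Theta (fpi F L (poly_mser g))) k = 0.
  by rewrite -rmorphB; apply: h.
rewrite coefsB => /subr0_eq ->; rewrite Theta_pi ThM_lead; last by rewrite (poly_mser_mono hg);
  apply: ser_mono_ord.
by rewrite [coefs _ _](_ : _ = g) // /= (hcompE _ hg) eqxx.
Qed.

(** If [s] has order k and the coefficient of its image in degree k vanishes, then [linP] kills its
    leading form, so [redP] does too, and [s] has order k + 1. *)
Lemma Iord_Theta k s : ser_ord k (Theta s) -> Iord k s.
Proof.
elim: k => [|k ih] h; first exact: Iord_all.
have hs : Iord k s by apply: ih; apply: ser_ord_le h.
have [g hg /(_ hs) hsg] := fga_split k s.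
have := Theta_lead hg hsg; rewrite h // => /esym/linP_red g0.
have := Iord_red F blE coE hg; rewrite g0.
rewrite [poly_mser 0](_ : _ = 0) ?rmorph0 ?subr0; last by rewrite poly_mserE raddf0.
by move=> h'; rewrite -[s](subrK (fpi F L (poly_mser g))); apply: IordD.
Qed.

Lemma Theta_inj s : Theta s = 0 -> s = 0.
Proof. by move=> s0; apply: Iord_separated => k; apply: Iord_Theta; rewrite s0. Qed.

Lemma coefs0_mone (a : M) : coefs a 0 = (mser_aug a)%:MP.
Proof.
apply/malgP => m; rewrite mcoeffC; case: eqP => [->//|m1].
rewrite mulr0n; apply/eqP/negPn/negP => h; apply: m1; apply: mdeg_eq0I.
by have /homogP := coefs_homog a 0; apply.
Qed.

Lemma fga_augE s : fga_augideal F L s <-> Iord 1 s.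
Proof.
rewrite /fga_augideal /= /fga_aug; split=> [h|/Theta_ord h].
  exists (fga_repr s); last by rewrite fpi_repr.
  by case=> // _; rewrite [LHS](coefs0_mone (fga_repr s)) h monalgU0.
apply: c_inj; have := h 0%N isT.
by rewrite /Theta (ThM_lead (k := 0)) // coefs0_mone linP_cst.
Qed.

(** Orders add in products; conversely [Iord_span] splits off one factor from the augmentation
    ideal. *)
Lemma ideal_powE k s : ideal_pow (fga_augideal F L) k s <-> Iord k s.
Proof.
elim: k s => [|k ih] s; first by split=> // _; apply: Iord_all.
split=> [|hs].
  apply: ideal_span_ind => [|x y|a x [i /fga_augE hi [j /ih hj <-]]].
  - exact: Iord0.
  - exact: IordD.
  by apply: IordMl; rewrite -add1n; apply: IordM.
have [h hh ->] := Iord_span blE coE hs.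
rewrite /= rpred_sum // => i _; apply: ideal_span_gen.
exists (xS F (bl i)); first by apply/fga_augE; apply: Iord_x.
by exists (h i) => //; apply/ih.
Qed.

Definition symB (p : Sym) : B := linP (sym_repr p).

Lemma symB_pi p : symB (spi p) = linP p.
Proof.
suff : linP (sym_repr (spi p) - p) = 0.
  by rewrite rmorphB => /subr0_eq.
apply: (ideal_span_kill (f := linP) (G := @sym_rel R C n A D L)); last first.
  by apply/spiP; rewrite spi_repr.
move=> x [l [m ->]].
have e : lamB (l + m) = lamB l + lamB m.
  by rewrite -big_split; apply: eq_bigr => i _; rewrite raddfD mulrzDr.
apply: etrans (rmorphB linP _ _) _; apply/eqP; rewrite subr_eq0; apply/eqP.
apply: (etrans (linP_var (l + m))); rewrite e.
apply/esym/(etrans (rmorphD linP (mvar R l) (mvar R m))).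
exact: (congr2 +%R (linP_var l) (linP_var m)).
Qed.

Lemma symB_zmod : zmod_morphism symB.
Proof. by move=> s t; rewrite -[s]spi_repr -[t]spi_repr -rmorphB !symB_pi rmorphB. Qed.
HB.instance Definition _ := GRing.isZmodMorphism.Build Sym B symB symB_zmod.

Lemma symB_monoid : monoid_morphism symB.
Proof.
split=> [|s t]; first by rewrite -(rmorph1 spi) symB_pi rmorph1.
by rewrite -[s]spi_repr -[t]spi_repr -rmorphM !symB_pi rmorphM.
Qed.
HB.instance Definition _ := GRing.isMonoidMorphism.Build Sym B symB symB_monoid.

Lemma symB_inj p : symB p = 0 -> p = 0.
Proof.
rewrite -[p]spi_repr symB_pi => /linP_red r0.
have e : spi \o redP R bl co =1 spi.
  apply: malg_ext => [a|l].
    exact: (congr1 spi (redP_cst _ _ a)).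
  transitivity (spi (redP R bl co (mvar R l))); first by [].
  rewrite redP_var.
  rewrite rmorph_sum -[RHS]/(xSym l) [in RHS](blE l) raddf_sum.
  apply: eq_bigr => i _; apply: etrans (rmorphMz spi _ _) _.
  exact: esym (raddfMz xSym _ _).
by rewrite -[LHS]e /= r0 rmorph0.
Qed.

Lemma symB_x l : symB (xSym l) = lamB l.
Proof. by rewrite symB_pi linP_var. Qed.

Lemma is_symbolP k s p : is_symbol k s p -> symB p = coefs (Theta s) k.
Proof.
move=> [g hg [/ideal_powE hs ->]]; rewrite [LHS]symB_pi; symmetry; exact: Theta_lead.
Qed.

End Construction.

(** Packages the model without reference to the basis: orders are read off from [Th], and [Sb] turns
    symbols into lowest coefficients. *)
Lemma fga_model : exists (B : idomainType) (Th : {rmorphism S -> series B})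
    (Sb : {rmorphism Sym -> B}),
  [/\ injective Th, injective Sb,
      forall k s, Iord k s <-> ser_ord k (Th s),
      forall k s, ideal_pow (fga_augideal F L) k s <-> Iord k s &
      (forall k s p, is_symbol k s p -> Sb p = coefs (Th s) k) /\
      forall l, Sb (xSym l) = 0 -> l = 0].
Proof.
have [r [bl [co [blE coE]]]] := lat_basis L.
have [B [c [X univ]]] := polynomial_ring R r.
exists B, (Theta co c X), (symB co c X); split.
- by move=> s t /eqP; rewrite -subr_eq0 -rmorphB => /eqP /(Theta_inj blE coE univ)/eqP;
  rewrite subr_eq0 => /eqP.
- by move=> s t /eqP; rewrite -subr_eq0 -rmorphB => /eqP /(symB_inj blE univ)/eqP;
  rewrite subr_eq0 => /eqP.
- move=> k s; split; [exact: Theta_ord|exact: (Iord_Theta blE coE univ)].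
- exact: (ideal_powE blE coE univ).
split; first exact: (is_symbolP blE coE univ).
by move=> l; rewrite /= symB_x; exact: (lamB_eq0 blE univ).
Qed.

End Model.

Lemma mev_mon_ser_mono (K : choiceType) (B : comPzRingType) (t : K -> B) m :
  mev_mon (fun k => ser_mono 1 (t k) : series B) m = ser_mono (mdeg m) (mev_mon t m).
Proof.
rewrite /mev_mon mdegE; elim: (enum_fset _) => [|k s ih].
  by rewrite !big_nil; apply: seriesP => -[].
rewrite !big_cons ih -coefs_monoM; congr (_ * _).
elim: (m k) => [|j IH]; first by rewrite !expr0; apply: seriesP => -[].
by rewrite !exprS IH coefs_monoM.
Qed.

Section PolyMser.
Variables (R : idomainType) (K : choiceType).
Implicit Types p q : {malg R[{cmonom K}]}.

Lemma poly_mserB p q : poly_mser (p - q) = poly_mser p - poly_mser q.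
Proof. by rewrite !poly_mserE; apply: rmorphB. Qed.
Lemma poly_mserD p q : poly_mser (p + q) = poly_mser p + poly_mser q.
Proof. by rewrite !poly_mserE; apply: rmorphD. Qed.
Lemma poly_mserM p q : poly_mser (p * q) = poly_mser p * poly_mser q.
Proof. by rewrite !poly_mserE; apply: rmorphM. Qed.
Lemma poly_mser0 : poly_mser (0 : {malg R[{cmonom K}]}) = 0.
Proof. by rewrite poly_mserE; apply: rmorph0. Qed.
Lemma poly_mser1 : poly_mser (1 : {malg R[{cmonom K}]}) = 1.
Proof. by rewrite poly_mserE; apply: rmorph1. Qed.
End PolyMser.

(** * Symbols, strictness of x_l, and the grading of the symmetric algebra *)

Section Consequences.
Variables (R : idomainType) (charR0 : [pchar R] =i pred0) (F : fgl R).
Variables (C : fieldType) (n : nat) (A : 'M[int]_n) (D : root_datum C A).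
Variable L : demazure_lattice D.
Local Notation Lam := (lat L).
Local Notation P := {malg R[{cmonom Lam}]}.
Local Notation S := (fga F L).
Local Notation Sym := (sym R L).
Local Notation pi := (fpi F L).
Local Notation x := (xS F).
Local Notation sp := (spi R L).

Lemma fga_mulf_eq0 (s t : S) : s * t = 0 -> s = 0 \/ t = 0.
Proof.
have [B [Th [Sb [Tinj _ _ _ _]]]] := fga_model charR0 F L.
move=> /(congr1 Th); rewrite rmorphM rmorph0 => /ser_mulf_eq0[] h; [left|right];
  by apply: Tinj; rewrite h rmorph0.
Qed.

Lemma sym_mulf_eq0 (p q : Sym) : p * q = 0 -> p = 0 \/ q = 0.
Proof.
have [B [Th [Sb [_ Sinj _ _ _]]]] := fga_model charR0 F L.
move=> /(congr1 Sb); rewrite rmorphM rmorph0 => /eqP; rewrite mulf_eq0.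
by move=> /orP[]/eqP h; [left|right]; apply: Sinj; rewrite h rmorph0.
Qed.

Lemma xSym_eq0 (l : Lam) : xSym R l = 0 -> l = 0.
Proof.
have [B [Th [Sb [_ _ _ _ [_ h]]]]] := fga_model charR0 F L.
by move=> e; apply: h; rewrite e rmorph0.
Qed.

Lemma ideal_pow_Iord k (s : S) : ideal_pow (fga_augideal F L) k s <-> Iord k s.
Proof. by have [B [Th [Sb [_ _ _ h _]]]] := fga_model charR0 F L; apply: h. Qed.

Lemma is_symbolI k (s : S) p : is_symbol k s p <->
  exists2 g : P, g \in homog k & Iord k.+1 (s - pi (poly_mser g)) /\ p = sp g.
Proof. by split=> -[g hg [/ideal_pow_Iord h ->]]; exists g. Qed.

Lemma is_symbol_Iord k (s : S) p : is_symbol k s p -> Iord k s.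
Proof.
move=> /is_symbolI[g hg [h _]]; rewrite -[s](subrK (pi (poly_mser g))).
by apply: IordD; [apply: Iord_le h|apply: Iord_poly].
Qed.

Lemma symbol_ex k (s : S) : Iord k s -> exists p, is_symbol k s p.
Proof.
move=> hs; have [g hg /(_ hs) h] := fga_split k s.
by exists (sp g); apply/is_symbolI; exists g.
Qed.

Lemma symbol_uniq k (s : S) p q : is_symbol k s p -> is_symbol k s q -> p = q.
Proof.
have [B [Th [Sb [_ Sinj _ _ [h _]]]]] := fga_model charR0 F L.
by move=> /h e /h e'; apply: Sinj; rewrite e e'.
Qed.

Lemma symbolP k (s : S) : Iord k s -> is_symbol k s (symbol k s).
Proof. by move=> /symbol_ex[p hp]; apply: (xgetPex 0 (P := [set p | is_symbol k s p]));
  exists p. Qed.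

Lemma symbolE k (s : S) p : is_symbol k s p -> symbol k s = p.
Proof. by move=> hp; apply: (symbol_uniq _ hp); apply/symbolP/(is_symbol_Iord hp). Qed.

Lemma is_symbolB k (s t : S) p q :
  is_symbol k s p -> is_symbol k t q -> is_symbol k (s - t) (p - q).
Proof.
move=> /is_symbolI[g hg [h ->]] /is_symbolI[g' hg' [h' ->]]; apply/is_symbolI.
exists (g - g'); first exact: rpredB.
split; last by rewrite rmorphB.
have := IordB h h'; congr Iord; rewrite poly_mserB rmorphB.
by rewrite !opprD !opprK addrACA.
Qed.

Lemma is_symbolM i j (s t : S) p q :
  is_symbol i s p -> is_symbol j t q -> is_symbol (i + j) (s * t) (p * q).
Proof.
move=> hp hq; have hs := is_symbol_Iord hp; have ht := is_symbol_Iord hq.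
move: hp hq => /is_symbolI[g hg [h ->]] /is_symbolI[g' hg' [h' ->]]; apply/is_symbolI.
exists (g * g'); first exact: homogM.
split; last by rewrite rmorphM.
rewrite poly_mserM rmorphM.
have hg1 : Iord i (pi (poly_mser g)) := Iord_poly _ hg.
have -> : s * t - pi (poly_mser g) * pi (poly_mser g') =
  (s - pi (poly_mser g)) * t + pi (poly_mser g) * (t - pi (poly_mser g')).
  by rewrite mulrBl mulrBr addrA subrK.
by apply: IordD; [rewrite -addSn|rewrite -addnS]; apply: IordM.
Qed.

Lemma is_symbol0 k (s : S) : Iord k.+1 s -> is_symbol k s 0.
Proof.
move=> hs; apply/is_symbolI; exists 0; first exact: rpred0.
by rewrite poly_mser0 !rmorph0 subr0.
Qed.

Lemma is_symbol1 : is_symbol 0 (1 : S) 1.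
Proof.
apply/is_symbolI; exists 1; first exact: homog1.
by rewrite poly_mser1 !rmorph1 subrr; split=> //; apply: Iord0.
Qed.

Lemma is_symbol_x (l : Lam) : is_symbol 1 (x l) (xSym R l).
Proof.
apply/is_symbolI; exists (mvar R l); first exact: mvar_homog.
split; last exact: erefl.
rewrite -[pi _]/(x l) subrr; exact: Iord0.
Qed.

Lemma symbolB k (s t : S) : Iord k s -> Iord k t ->
  symbol k (s - t) = symbol k s - symbol k t.
Proof. by move=> hs ht; apply/symbolE/is_symbolB; apply: symbolP. Qed.

Lemma symbol0 k : symbol k (0 : S) = 0.
Proof. exact/symbolE/is_symbol0/Iord0. Qed.

Lemma symbolM i j (s t : S) : Iord i s -> Iord j t ->
  symbol (i + j) (s * t) = symbol i s * symbol j t.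
Proof. by move=> hs ht; apply/symbolE/is_symbolM; apply: symbolP. Qed.

Lemma symbol1 : symbol 0 (1 : S) = 1. Proof. exact/symbolE/is_symbol1. Qed.

Lemma symbol_x (l : Lam) : symbol 1 (x l) = xSym R l. Proof. exact/symbolE/is_symbol_x. Qed.

Lemma symbol_eq0 k (s : S) : Iord k s -> symbol k s = 0 <-> Iord k.+1 s.
Proof.
move=> hs; split=> [e|h].
  have [B [Th [Sb [_ Sinj hI _ [h _]]]]] := fga_model charR0 F L.
  apply/hI => d; rewrite ltnS leq_eqVlt => /orP[/eqP ->|]; last by move/hI: hs; apply.
  by rewrite -(h _ _ _ (symbolP hs)) e rmorph0.
exact/symbolE/is_symbol0.
Qed.

(** The lowest coefficient of the image of x_l is that of the nonzero vector l, in a domain. *)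
Lemma Iord_div k (l : Lam) (s : S) : l <> 0 -> Iord k.+1 (x l * s) -> Iord k s.
Proof.
move=> l0; have [B [Th [Sb [_ Sinj hI _ [h hS]]]]] := fga_model charR0 F L.
move=> /hI; rewrite rmorphM -add1n => hxs; apply/hI.
apply: ser_ordM_inv hxs; first by apply/hI; apply: Iord_x.
by rewrite -(h _ _ _ (is_symbol_x l)); apply/eqP => /hS.
Qed.

(** Otherwise dividing 0 by x_l as in [Iord_div] would put 1 into the augmentation ideal, whence 1 =
    0 in Sym and l = 0. *)
Lemma xS_eq0 (l : Lam) : x l = 0 -> l = 0.
Proof.
move=> e; apply: contrapT => l0; have h : Iord 1 (1 : S).
  by apply: (Iord_div l0); rewrite e mul0r; apply: Iord0.
move: h; rewrite -symbol_eq0; last exact: Iord_all.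
rewrite symbol1 => e1; apply: l0; apply: xSym_eq0.
by rewrite -[xSym R l]mulr1 e1 mulr0.
Qed.

(* Successive approximation: the quotients converge because x l is strict    *)
(* for the filtration.                                                       *)
Lemma xS_closed (l : Lam) (s : S) : l <> 0 ->
  (forall k, exists b, Iord k (s - x l * b)) -> exists b, s = x l * b.
Proof.
move=> l0 h; have /choice[b hb] k : exists b, Iord k.+2 (s - x l * b) by exact: h k.+2.
pose E k := if k is k'.+1 then b k'.+1 - b k' else b 0%N.
have hE k : Iord k (E k).
  case: k => [|k]; first exact: Iord_all.
  apply: (Iord_div l0).
  have -> : x l * E k.+1 = (s - x l * b k) - (s - x l * b k.+1).
    by rewrite opprB [RHS]addrC addrA subrK; exact: mulrBr.
  by apply: IordB; [apply: hb|apply: Iord_le (hb k.+1)].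
have sumE k : \sum_(i < k.+1) E i = b k.
  elim: k => [|k ih]; first by rewrite big_ord1.
  by rewrite big_ord_recr ih; exact: (subrKC (b k) (b k.+1)).
have [t ht] := Iord_complete hE.
exists t; apply/eqP; rewrite -subr_eq0; apply/eqP/Iord_separated => k.
have -> : s - x l * t = (s - x l * b k) - x l * (t - \sum_(i < k.+1) E i).
  by rewrite sumE mulrBr opprB addrA subrK.
apply: IordB; first exact: Iord_le (leqW (leqnSn _)) (hb k).
by apply: IordMl; apply: Iord_le (ht k.+1).
Qed.

(* Homogeneous components in Sym, by means of the grading x_l |-> x_l t.     *)
Definition sym_grade (p : Sym) : series Sym :=
  mev (scst (sp \o (@malgC _ R) : {rmorphism R -> Sym}))
    (fun l => ser_mono 1 (xSym R l)) (sym_repr p).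

Lemma sp_mev (g : P) :
  sp g = mev (sp \o (@malgC _ R) : {rmorphism R -> Sym}) (xSym R (L := L)) g.
Proof. by apply: mev_uniq. Qed.

Lemma sym_grade_pi (g : P) : sym_grade (sp g) =
  mev (scst (sp \o (@malgC _ R) : {rmorphism R -> Sym}))
    (fun l => ser_mono 1 (xSym R l)) g.
Proof.
pose f : {rmorphism P -> series Sym} :=
  mev (scst (sp \o (@malgC _ R) : {rmorphism R -> Sym})) (fun l => ser_mono 1 (xSym R l)).
suff : f (sym_repr (sp g) - g) = 0 by rewrite rmorphB => /subr0_eq.
apply: (ideal_span_kill (f := f) (G := @sym_rel R C n A D L)); last first.
  by apply/spiP; rewrite spi_repr.
move=> p [l [m ->]]; apply: etrans (rmorphB f _ _) _; apply/eqP; rewrite subr_eq0; apply/eqP.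
apply: etrans (mev_var _ _ _) _; rewrite xSymD raddfD.
apply/esym/(etrans (rmorphD f (mvar R l) (mvar R m))).
exact: (congr2 +%R (mev_var _ _ _) (mev_var _ _ _)).
Qed.

Lemma sym_grade_zmod : zmod_morphism sym_grade.
Proof. by move=> s t; rewrite -[s]spi_repr -[t]spi_repr -rmorphB !sym_grade_pi rmorphB. Qed.
HB.instance Definition _ := GRing.isZmodMorphism.Build Sym (series Sym) sym_grade sym_grade_zmod.

Lemma sym_grade_homog k (g : P) : g \in homog k -> sym_grade (sp g) = ser_mono k (sp g).
Proof.
move=> /homogP hg; rewrite sym_grade_pi [in RHS]sp_mev /mev raddf_sum big_seq [RHS]big_seq.
apply: eq_bigr => m; rewrite -mcoeff_neq0 => /hg <-.
rewrite mev_mon_ser_mono; apply: seriesP => d.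
by rewrite coefs_cstM /=; case: eqP => // _; rewrite mulr0.
Qed.

Lemma sym_grade_symbol k (s : S) : Iord k s ->
  sym_grade (symbol k s) = ser_mono k (symbol k s).
Proof. by move=> /symbolP/is_symbolI[g hg [_ ->]]; apply: sym_grade_homog. Qed.

(** Lifts the homogeneous components of [p] to S, which is how elements of Sym are brought back to
    the Demazure side. *)
Lemma sym_decomp (p : Sym) : exists (s : nat -> S) N,
  [/\ forall k, Iord k (s k), forall k, symbol k (s k) = coefs (sym_grade p) k,
      forall k, (N <= k)%N -> coefs (sym_grade p) k = 0 &
      p = \sum_(k < N) coefs (sym_grade p) k].
Proof.
rewrite -[p]spi_repr; set g := sym_repr p.
pose N := (\max_(m <- msupp g) (mdeg m).+1)%N.
have gN m : m \in msupp g -> (mdeg m < N)%N.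
  by move=> mg; rewrite /N (big_fsetD1 m) //= leq_max ltnS leqnn.
have hN k : (N <= k)%N -> hcomp k g = 0.
  move=> Nk; rewrite /hcomp big_seq_cond big_pred0 // => m.
  by apply/negP => /andP[/gN h /eqP e]; move: Nk; rewrite -e leqNgt h.
have gE : g = \sum_(k < N) hcomp k g.
  rewrite /hcomp [LHS]monalgE (exchange_big_dep xpredT) //= big_seq [RHS]big_seq.
  apply: eq_bigr => m /gN mN; rewrite (big_pred1 (Ordinal mN)) //.
have cE k : coefs (sym_grade (sp g)) k = sp (hcomp k g).
  have -> : sym_grade (sp g) = \sum_(i < N) ser_mono i (sp (hcomp i g)).
    rewrite {1}gE rmorph_sum raddf_sum; apply: eq_bigr => i _.
    exact: sym_grade_homog (hcomp_homog i g).
  rewrite coefs_sum (eq_bigr (fun i : 'I_N => if i == k :> nat then sp (hcomp k g) else 0));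
    last first.
    by move=> i _ /=; rewrite eq_sym; case: eqP => // ->.
  rewrite -big_mkcond /=; have [kN|Nk] := ltnP k N.
    by rewrite (big_pred1 (Ordinal kN)).
  rewrite hN // rmorph0 big1 //.
exists (fun k => pi (poly_mser (hcomp k g))), N; split.
- by move=> k; apply/Iord_poly/hcomp_homog.
- move=> k; rewrite cE; apply: symbolE; apply/is_symbolI.
  exists (hcomp k g); first exact: hcomp_homog.
  by split=> //; rewrite subrr; apply: Iord0.
- by move=> k /hN e; rewrite cE e rmorph0.
by rewrite {1}gE rmorph_sum; apply: eq_bigr => k _; rewrite cE.
Qed.

End Consequences.

(** * Lattice endomorphisms and divisibility by x_l *)

Section RingIdentities.
Variable A : comPzRingType.
Implicit Types a b c d h : A.

Lemma quasi_opp a b h : a + b + a * b * h = 0 -> b = a * - (1 + b * h).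
Proof.
by move=> e; apply/eqP; rewrite -subr_eq0 -[X in _ == X]e; apply/eqP; ring.
Qed.

Lemma quasi_add a b h : a + b + a * b * h - a = b * (1 + a * h).
Proof. by ring. Qed.

Lemma mul_sub_mul a b c d : a * b - c * d = a * (b - d) + d * (a - c).
Proof. by ring. Qed.

End RingIdentities.

Lemma sub_sub_sub (V : zmodType) (a b c d : V) : a - b - (c - d) = (a - c) - (b - d).
Proof. by rewrite !opprD !opprK addrACA. Qed.

Section LatticeMaps.
Variables (R : idomainType) (charR0 : [pchar R] =i pred0) (F : fgl R).
Variables (C : fieldType) (n : nat) (A : 'M[int]_n) (D : root_datum C A).
Variable L : demazure_lattice D.
Local Notation Lam := (lat L).
Local Notation M := (mseries R Lam).
Local Notation P := {malg R[{cmonom Lam}]}.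
Local Notation S := (fga F L).
Local Notation Sym := (sym R L).
Local Notation pi := (fpi F L).
Local Notation x := (@xS R F C n A D L).
Local Notation sp := (spi R L).
Local Notation J := (ideal_closure (@fga_rel R F C n A D L)).

Section OneMap.
Variable rho : {additive Lam -> Lam}.

Definition ren : {rmorphism M -> M} := @mser_ren R Lam rho.

Lemma ren_xv l : ren (xv R l) = xv R (rho l). Proof. exact: mser_ren_xv. Qed.

Lemma ren_J a : a \in J -> ren a \in J.
Proof.
move=> /asboolP h; apply/asboolP => k; have [b bJ e] := h k.
exists (ren b) => [|d dk].
  apply: (@ideal_span_ind _ _ (fun y => ren y \in ideal_span _) _ _ _ b bJ) => [|y z|y z].
  - by rewrite rmorph0 rpred0.
  - by rewrite rmorphD => *; apply: rpredD.
  move=> hz; rewrite rmorphM; apply: ideal_span_Ml; apply: ideal_span_gen.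
  case: hz => [->|[l [m ->]]].
    left; apply: (etrans (ren_xv 0)); by rewrite raddf0.
  right; exists (rho l), (rho m); rewrite rmorphB -raddfD; congr (_ - _).
    exact: ren_xv.
  transitivity (fsubst F (ren (xv R l)) (ren (xv R m))).
    by apply: mser_ren_fsubst; apply: xv_ord.
  exact: (congr2 (fsubst F) (ren_xv l) (ren_xv m)).
have /(mser_ren_ord rho (k := k)) : ser_ord k (mvl (a - b)).
  by rewrite rmorphB; apply/ser_eqmP.
by rewrite -[mser_ren rho _]/(ren (a - b)) !rmorphB => /ser_eqmP; apply.
Qed.

(** Defined for all endomorphisms of the lattice and not only for Weyl group elements, because
    [xdvd_regular] needs a projection. *)
Definition fga_map (s : S) : S := pi (ren (fga_repr s)).

Lemma fga_map_pi a : fga_map (pi a) = pi (ren a).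
Proof. by apply/fpiP; rewrite -rmorphB; apply: ren_J; apply/fpiP; rewrite fpi_repr. Qed.

Lemma fga_map_zmod : zmod_morphism fga_map.
Proof. by move=> s t; rewrite -[s]fpi_repr -[t]fpi_repr -rmorphB !fga_map_pi !rmorphB. Qed.
HB.instance Definition _ := GRing.isZmodMorphism.Build S S fga_map fga_map_zmod.

Lemma fga_map_monoid : monoid_morphism fga_map.
Proof.
split=> [|s t]; first by rewrite -(rmorph1 pi) fga_map_pi !rmorph1.
by rewrite -[s]fpi_repr -[t]fpi_repr -rmorphM !fga_map_pi !rmorphM.
Qed.
HB.instance Definition _ := GRing.isMonoidMorphism.Build S S fga_map fga_map_monoid.

Lemma fga_map_x l : fga_map (x l) = x (rho l).
Proof. exact: (etrans (fga_map_pi _) (congr1 pi (ren_xv l))). Qed.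

Lemma fga_map_Iord k s : Iord k s -> Iord k (fga_map s).
Proof.
move=> [a ha ->]; rewrite fga_map_pi; exists (ren a) => //; exact: mser_ren_ord.
Qed.

Definition pren : {rmorphism P -> P} := mev (@malgC _ R) (fun l => mvar R (rho l)).

Lemma pren_var l : pren (mvar R l) = mvar R (rho l). Proof. exact: mev_var. Qed.

Definition sym_map (p : Sym) : Sym := sp (pren (sym_repr p)).

Lemma sym_map_pi g : sym_map (sp g) = sp (pren g).
Proof.
apply/spiP; rewrite -rmorphB.
have : sym_repr (sp g) - g \in ideal_span (@sym_rel R C n A D L).
  by apply/spiP; rewrite spi_repr.
apply: (@ideal_span_ind _ _ (fun y => pren y \in ideal_span _)) => [|y z|y z].
- by rewrite rmorph0 rpred0.
- move=> hy hz; rewrite (rmorphD pren y z); exact: (rpredD hy hz).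
move=> [l [m ->]]; rewrite (rmorphM pren); apply: ideal_span_Ml; apply: ideal_span_gen.
exists (rho l), (rho m).
apply: etrans (rmorphB pren _ _) _; congr (_ - _).
  by apply: etrans (pren_var (l + m)) _; congr (mvar R _); exact: raddfD.
apply: etrans (rmorphD pren (mvar R l) (mvar R m)) _.
exact: (congr2 +%R (pren_var l) (pren_var m)).
Qed.

Lemma sym_map_zmod : zmod_morphism sym_map.
Proof. by move=> s t; rewrite -[s]spi_repr -[t]spi_repr -rmorphB !sym_map_pi !rmorphB. Qed.
HB.instance Definition _ := GRing.isZmodMorphism.Build Sym Sym sym_map sym_map_zmod.

Lemma sym_map_monoid : monoid_morphism sym_map.
Proof.
split=> [|s t]; first by rewrite -(rmorph1 sp) sym_map_pi !rmorph1.
by rewrite -[s]spi_repr -[t]spi_repr -rmorphM !sym_map_pi !rmorphM.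
Qed.
HB.instance Definition _ := GRing.isMonoidMorphism.Build Sym Sym sym_map sym_map_monoid.

Lemma sym_map_x l : sym_map (xSym R l) = xSym R (rho l).
Proof. apply: etrans (sym_map_pi _) _; exact: (congr1 sp (pren_var l)). Qed.

Lemma pren_homog d g : g \in homog d -> pren g \in homog d.
Proof. by move=> hg; have := poly_ren_homog rho hg; rewrite poly_renE. Qed.

Lemma symbol_map k s : Iord k s -> symbol k (fga_map s) = sym_map (symbol k s).
Proof.
move=> /(symbolP charR0)/(is_symbolI charR0)[g hg [h ->]].
apply/(symbolE charR0)/(is_symbolI charR0); exists (pren g); first exact: pren_homog.
split; last exact: sym_map_pi.
have e : fga_map (pi (poly_mser g)) = pi (poly_mser (pren g)).
  rewrite fga_map_pi; congr (fpi _ _ _).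
  by apply: etrans (mser_ren_poly rho g) _; rewrite poly_renE.
by have := fga_map_Iord h; rewrite rmorphB [X in _ - X]e.
Qed.

End OneMap.

Lemma fga_map_ext (rho sig : {additive Lam -> Lam}) : rho =1 sig -> fga_map rho =1 fga_map sig.
Proof.
move=> e s; have E : (rho : Lam -> Lam) = sig by apply/funext.
exact: (congr1 (fun f => pi (mser_ren f (fga_repr s))) E).
Qed.

Lemma sym_map_ext (rho sig : {additive Lam -> Lam}) : rho =1 sig -> sym_map rho =1 sym_map sig.
Proof.
move=> e p; have E : (rho : Lam -> Lam) = sig by apply/funext.
exact: (congr1 (fun f : Lam -> Lam =>
  sp (mev (@malgC _ R) (fun l => mvar R (f l)) (sym_repr p))) E).
Qed.

(** Up to any given order an element is a polynomial in the x_l, and both maps respect the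
    filtration. *)
Lemma fga_dense (f g : {rmorphism S -> S}) :
  (forall k s, Iord k s -> Iord k (f s)) -> (forall k s, Iord k s -> Iord k (g s)) ->
  (forall r, f (cS F L r) = g (cS F L r)) -> (forall l, f (x l) = g (x l)) -> f =1 g.
Proof.
move=> hf hg hc hx s; apply/eqP; rewrite -subr_eq0; apply/eqP/Iord_separated => k.
pose p := \sum_(d < k) coefs (fga_repr s) d.
have hp : Iord k (s - pi (poly_mser p)).
  exists (fga_repr s - poly_mser p); last by rewrite rmorphB fpi_repr.
  rewrite rmorphB; apply/ser_eqmP.
  have -> : poly_mser p = \sum_(d < k) poly_mser (coefs (fga_repr s) d).
    rewrite poly_mserE /p rmorph_sum; apply: eq_bigr => i _; exact: esym (poly_mserE _).
  exact: mser_eqm.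
have E : f (pi (poly_mser p)) = g (pi (poly_mser p)).
  elim/malg_ind: (p) => [a|l|u v eu ev|u v eu ev].
  - have -> : pi (poly_mser a%:MP) = cS F L a by rewrite poly_mserE; congr (pi _); apply: mevC.
    exact: hc.
  - exact: hx.
  - by rewrite poly_mserD (rmorphD pi) (rmorphD f) (rmorphD g) eu ev.
  by rewrite poly_mserM (rmorphM pi) (rmorphM f) (rmorphM g) eu ev.
have -> : f s - g s = f (s - pi (poly_mser p)) - g (s - pi (poly_mser p)).
  by rewrite !rmorphB E opprB addrA subrK.
by apply: IordB; [apply: hf|apply: hg].
Qed.

Lemma fga_map_cst rho r : fga_map rho (cS F L r) = cS F L r.
Proof.
rewrite /cS /= fga_map_pi; congr (pi _); apply: mvl_inj; apply: seriesP => d.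
by rewrite /= poly_renE; case: eqP => _; rewrite ?mevC ?raddf0.
Qed.

Lemma fga_map_comp (rho sig : {additive Lam -> Lam}) s :
  fga_map rho (fga_map sig s) = fga_map (rho \o sig) s.
Proof.
apply: (@fga_dense (fga_map rho \o fga_map sig) (fga_map (rho \o sig))).
- by move=> k t ht; do 2!apply: fga_map_Iord.
- by move=> k t; apply: fga_map_Iord.
- by move=> r; rewrite /= !fga_map_cst.
by move=> l; rewrite /= !fga_map_x.
Qed.

Lemma fga_map_id s : fga_map idfun s = s.
Proof.
apply: (@fga_dense (fga_map idfun) idfun) => //.
- by move=> k t; apply: fga_map_Iord.
- exact: fga_map_cst.
by move=> l; rewrite /= fga_map_x.
Qed.

Lemma sym_map_comp (rho sig : {additive Lam -> Lam}) p :
  sym_map rho (sym_map sig p) = sym_map (rho \o sig) p.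
Proof.
rewrite -[p]spi_repr (sym_map_pi sig) (sym_map_pi rho) (sym_map_pi (rho \o sig)).
apply: (congr1 sp).
have h : (pren rho \o pren sig : {rmorphism P -> P}) =1
    mev (@malgC _ R) (fun l => mvar R (rho (sig l))).
  apply: mev_uniq => [a|l].
    exact: etrans (congr1 (pren rho) (mevC _ _ a)) (mevC _ _ a).
  exact: etrans (congr1 (pren rho) (pren_var sig l)) (pren_var _ _).
exact: (h (sym_repr p)).
Qed.

Lemma sym_map_id p : sym_map idfun p = p.
Proof.
apply: etrans _ (spi_repr p); apply: (congr1 sp).
have h : (idfun : {rmorphism P -> P}) =1 mev (@malgC _ R) (fun l => mvar R l) by apply: mev_uniq.
exact: esym (h (sym_repr p)).
Qed.

Definition xdvd (l : Lam) (s : S) := exists b, s = x l * b.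

Lemma xdvd0 l : xdvd l 0. Proof. by exists 0; rewrite mulr0. Qed.
Lemma xdvdD l s t : xdvd l s -> xdvd l t -> xdvd l (s + t).
Proof. by move=> [a ->] [b ->]; exists (a + b); rewrite mulrDr. Qed.
Lemma xdvdN l s : xdvd l s -> xdvd l (- s).
Proof. by move=> [a ->]; exists (- a); rewrite mulrN. Qed.
Lemma xdvdMl l s t : xdvd l t -> xdvd l (s * t).
Proof. by move=> [b ->]; exists (s * b); rewrite mulrCA. Qed.

Lemma xS_opp l : exists h, x l + x (- l) + x l * x (- l) * h = 0.
Proof. by have [h e] := xSD F l (- l); exists h; rewrite -e subrr xS0. Qed.

Lemma xdvd_opp l : xdvd l (x (- l)).
Proof.
have [h e] := xS_opp l; exists (- (1 + x (- l) * h)); exact: quasi_opp.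
Qed.

Lemma xdvd_shift l m z : xdvd l (x (m + l *~ z) - x m).
Proof.
have st m' : xdvd l (x (m' + l) - x m').
  have [h ->] := xSD F m' l; exists (1 + x m' * h); exact: quasi_add.
have sP k m' : xdvd l (x (m' + l *+ k) - x m').
  elim: k => [|k ih]; first by rewrite mulr0n addr0 subrr; apply: xdvd0.
  rewrite mulrSr addrA; have := xdvdD (st (m' + l *+ k)) ih.
  by rewrite addrA subrK.
case: z => k; first exact: sP.
rewrite NegzE mulrNz; have := xdvdN (sP k.+1 (m - l *+ k.+1)).
by rewrite subrK opprB.
Qed.

(** Holds on the x_m by [xdvd_shift], hence on polynomials, hence in the limit because the multiples
    of x_l are closed ([xS_closed]). *)
Lemma xdvd_map (l : Lam) (rho : {additive Lam -> Lam}) s : l <> 0 ->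
  (forall m, exists z, rho m = m + l *~ z) -> xdvd l (fga_map rho s - s).
Proof.
move=> l0 hrho; apply: (xS_closed charR0) => // k.
pose p := \sum_(d < k) coefs (fga_repr s) d.
have hp : Iord k (s - pi (poly_mser p)).
  exists (fga_repr s - poly_mser p); last by rewrite rmorphB fpi_repr.
  rewrite rmorphB; apply/ser_eqmP.
  have -> : poly_mser p = \sum_(d < k) poly_mser (coefs (fga_repr s) d).
    rewrite poly_mserE /p rmorph_sum; apply: eq_bigr => i _; exact: esym (poly_mserE _).
  exact: mser_eqm.
have [b hb] : xdvd l (fga_map rho (pi (poly_mser p)) - pi (poly_mser p)).
  elim/malg_ind: (p) => [a|m|u v eu ev|u v eu ev].
  - have -> : pi (poly_mser a%:MP) = cS F L a by rewrite poly_mserE; congr (pi _); apply: mevC.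
    by rewrite fga_map_cst subrr; apply: xdvd0.
  - rewrite -[pi _]/(x m) fga_map_x; have [z ->] := hrho m; exact: xdvd_shift.
  - rewrite poly_mserD (rmorphD pi) rmorphD opprD addrACA; exact: xdvdD.
  rewrite poly_mserM (rmorphM pi) rmorphM.
  rewrite mul_sub_mul.
  by apply: xdvdD; apply: xdvdMl.
exists b; rewrite -hb sub_sub_sub -rmorphB.
by apply: IordB => //; apply: fga_map_Iord.
Qed.

(** The projection u |-> u - co(u) l kills x_l, is the identity modulo x_l, and sends x_m to a
    nonzero element. S being a domain, it kills [a], which is therefore a multiple of x_l. *)
Lemma xdvd_regular (l m : Lam) (co : {additive Lam -> int}) (a : S) :
  co l = 1 -> m <> l *~ co m -> xdvd l (x m * a) -> xdvd l a.
Proof.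
move=> col ml [b e].
have l0 : l <> 0 by move=> l0; move: col; rewrite l0 raddf0.
have rz : zmod_morphism (fun u => u - l *~ co u).
  by move=> u v; rewrite raddfB mulrzBr; apply: sub_sub_sub.
pose rho := additive_of rz.
have rl : rho l = 0 by rewrite /= col mulr1z subrr.
have M2 u v : fga_map rho (x u * v) = x (rho u) * fga_map rho v.
  by rewrite rmorphM; congr (_ * _); apply: fga_map_x.
have : x (rho m) * fga_map rho a = 0 by rewrite -M2 e M2 rl xS0 mul0r.
move=> /(fga_mulf_eq0 charR0)[/(xS_eq0 charR0) /= /subr0_eq //|ra].
rewrite -[a]opprK -[- a]add0r -ra; apply: xdvdN; apply: xdvd_map => // u.
by exists (- co u); rewrite mulrNz.
Qed.

End LatticeMaps.

(** * Weyl groups and roots *)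

Section RankTwo.
Variables p q : int.

(* Coordinates of T(alpha_s) in the basis alpha_s, alpha_t, for the alternating *)
(* word T of length k ending in t, where p = - a_st and q = - a_ts.           *)
Fixpoint alt_coord (k : nat) : int * int := if k is k'.+1 then
  let: (a, b) := alt_coord k' in
  if odd k' then (- a + p * b, b) else (a, - b + q * a)
  else (1, 0).

(* 0 encodes an infinite order. *)
Definition cox_order : nat :=
  if p * q == 0 then 2%N else if p * q == 1 then 3%N
  else if p * q == 2 then 4%N else if p * q == 3 then 6%N else 0%N.

Lemma rank2_cases : 0 <= p -> 0 <= q -> (p = 0 <-> q = 0) ->
  4 <= p * q \/
  [\/ (p, q) = (0, 0), (p, q) = (1, 1), (p, q) = (1, 2) \/ (p, q) = (2, 1)
    | (p, q) = (1, 3) \/ (p, q) = (3, 1)].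
Proof.
move=> p0 q0 pq; have [h|h] := boolP (4 <= p * q); first by left.
right.
have [hp|hp] := eqVneq p 0; first by constructor 1; rewrite hp (proj1 pq hp).
have hq : q != 0 by apply/eqP => /(proj2 pq) /eqP; rewrite (negPf hp).
have p1 : 1 <= p by lia.
have q1 : 1 <= q by lia.
have p4 : p < 4 by nia.
have q4 : q < 4 by nia.
have [e|[e|e]] : p = 1 \/ p = 2 \/ p = 3 by lia.
- have [e'|[e'|e']] : q = 1 \/ q = 2 \/ q = 3 by lia.
  + by constructor 2; rewrite e e'.
  + by constructor 3; left; rewrite e e'.
  by constructor 4; left; rewrite e e'.
- have [e'|[e'|e']] : q = 1 \/ q = 2 \/ q = 3 by lia.
  + by constructor 3; right; rewrite e e'.
  + by move: h; rewrite e e'.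
  by move: h; rewrite e e'.
have [e'|[e'|e']] : q = 1 \/ q = 2 \/ q = 3 by lia.
+ by constructor 4; right; rewrite e e'.
+ by move: h; rewrite e e'.
by move: h; rewrite e e'.
Qed.

(** The inequality that alternates with the parity strengthens nonnegativity enough for the
    induction to pass. *)
Lemma alt_coord_inf k : 4 <= p * q -> 0 <= p -> 0 <= q ->
  let: (a, b) := alt_coord k in
  [/\ 0 <= a, 0 <= b & if odd k then 2 * a <= p * b else 2 * b <= q * a].
Proof.
move=> pq p0 q0; elim: k => [|k] /=; first by split; lia.
case: (alt_coord k) => a b [a0 b0]; case: (odd k) => /= h; split=> //; nia.
Qed.

End RankTwo.

Lemma alt_coord_pos p q k : 0 <= p -> 0 <= q -> (p = 0 <-> q = 0) ->
  (cox_order p q = 0%N \/ (k < cox_order p q)%N) ->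
  0 <= (alt_coord p q k).1 /\ 0 <= (alt_coord p q k).2.
Proof.
move=> p0 q0 pq; have [h _|[e|e|e|e]] := rank2_cases p0 q0 pq.
- have := alt_coord_inf k h p0 q0; by case: alt_coord => a b [].
- case: e => -> ->; rewrite /cox_order /=; case=> // kk.
  by do 2?[case: k kk => [|k] kk //].
- case: e => -> ->; rewrite /cox_order /=; case=> // kk.
  by do 3?[case: k kk => [|k] kk //].
- by case: e => -[-> ->]; rewrite /cox_order /=; case=> // kk;
    do 4?[case: k kk => [|k] kk //].
by case: e => -[-> ->]; rewrite /cox_order /=; case=> // kk;
  do 6?[case: k kk => [|k] kk //].
Qed.

Section AltWord.
Variable I : Type.
Variables s t : I.
Fixpoint alt_word (k : nat) : seq I :=
  if k is k'.+1 then (if odd k' then s else t) :: alt_word k' else [::].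

Lemma size_alt_word k : size (alt_word k) = k.
Proof. by elim: k => //= k ->. Qed.
End AltWord.

Lemma alt_word_rcons (I : Type) (s t : I) k :
  alt_word s t k.+1 = rcons (alt_word t s k) t.
Proof.
elim: k => [//|k ih].
rewrite -[LHS]/((if odd k.+1 then s else t) :: alt_word s t k.+1) ih /=.
by case: (odd k).
Qed.

Lemma alt_word_suffix (I : Type) (s t : I) k m : (m <= k)%N ->
  exists2 u, size u = (k - m)%N & alt_word s t k = u ++ alt_word s t m.
Proof.
move=> mk; rewrite -{2}(subnK mk); elim: (k - m)%N => [|d [u su e]]; first by exists [::].
by exists ((if odd (d + m) then s else t) :: u); rewrite /= ?su ?addSn //= e.
Qed.

Section Weyl.
Variables (C : fieldType) (charC0 : [pchar C] =i pred0).
Variables (n : nat) (A : 'M[int]_n) (D : root_datum C A).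
Local Notation V := 'Hom(rd_h D, C^o).
Local Notation W := (weyl D).

Lemma pcharC_int (z w : int) : z%:~R = w%:~R :> C -> z = w.
Proof.
move=> e; apply/eqP; rewrite -subr_eq0; apply/eqP/(pchar0_int charC0).
by rewrite intrB e subrr.
Qed.

Definition len (w : W) : nat := size (red_word w).

Lemma red_wordP (w : W) : weyl_word D (red_word w) = w /\ reduced D (red_word w).
Proof.
suff : exists s, weyl_word D s = w /\ reduced D s.
  move=> ex; exact: (xgetPex [::] ex).
have ex : exists k, `[< exists s, weyl_word D s = w /\ size s = k >].
  by have [s e] := weyl_wordP w; exists (size s); apply/asboolP; exists s.
case: (ex_minnP ex) => k /asboolP[s [e sk]] kmin; exists s; split=> // t et.
by rewrite sk; apply: kmin; apply/asboolP; exists t; rewrite et e.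
Qed.

Lemma red_wordK (w : W) : weyl_word D (red_word w) = w.
Proof. exact: (red_wordP w).1. Qed.

Lemma len_le s : (len (weyl_word D s) <= size s)%N.
Proof. by have [e h] := red_wordP (weyl_word D s); apply: h. Qed.

Lemma weyl_word_cat s t : weyl_word D (s ++ t) = (weyl_word D s * weyl_word D t)%g.
Proof. by apply: val_inj; apply: refl_word_cat. Qed.

Lemma weyl_word1 i : weyl_word D [:: i] = simple_refl D i. Proof. by []. Qed.
Lemma weyl_word0 : weyl_word D [::] = 1%g. Proof. by []. Qed.

Lemma weyl_word_cons i s : weyl_word D (i :: s) = (simple_refl D i * weyl_word D s)%g.
Proof. by rewrite -cat1s weyl_word_cat. Qed.

Lemma simple_reflK i : (simple_refl D i * simple_refl D i = 1)%g.
Proof.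
apply: val_inj; rewrite -weyl_word1 -weyl_word_cat /= comp_lfunA.
by rewrite refl_refl comp_lfun1l.
Qed.

Lemma simple_reflV i : (simple_refl D i)^-1%g = simple_refl D i.
Proof. by apply: mulg1_eq; apply: simple_reflK. Qed.

Lemma len_mul v w : (len (v * w)%g <= len v + len w)%N.
Proof.
by rewrite -{1}[v]red_wordK -{1}[w]red_wordK -weyl_word_cat -size_cat; apply: len_le.
Qed.

Lemma len_simple i : (len (simple_refl D i) <= 1)%N.
Proof. by rewrite -weyl_word1; apply: len_le. Qed.

Lemma len_eq0 w : len w = 0%N -> w = 1%g.
Proof. by move=> /size0nil e; rewrite -[w]red_wordK e. Qed.

Section Braid.
Variables (s t : 'I_n) (p q : int).
Hypotheses (ep : A s t = - p) (eq : A t s = - q).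
Local Notation rs := (rd_root D s).
Local Notation rt := (rd_root D t).

Definition pick (b : bool) := if b then s else t.

(** Effect of a reflection on the coefficients of l + x alpha_s + y alpha_t, where u and v are the
    pairings of l with the two coroots. *)
Definition step (u v : C) (b : bool) (xy : C * C) : C * C :=
  if b then (- xy.1 - u + p%:~R * xy.2, xy.2) else (xy.1, - xy.2 - v + q%:~R * xy.1).

Lemma refl_step (l : V) (b : bool) (xy : C * C) :
  refl D (if b then s else t) (l + xy.1 *: rs + xy.2 *: rt) =
  let xy' := step (l (rd_coroot D s)) (l (rd_coroot D t)) b xy in
  l + xy'.1 *: rs + xy'.2 *: rt.
Proof.
have ass i : A i i = 2 by case: (rd_gcm D).
rewrite lfunE /= /refl_fun; case: b; rewrite /= !add_lfunE !scale_lfunE !rd_pairing ass.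
  rewrite ep addrAC -[in LHS](addrA l); congr (_ + _ + _).
  rewrite -scalerBl; congr (_ *: _).
  rewrite -![_ *: (_ : C^o)]/(_ * _) rmorphN; ring.
rewrite eq -addrA -scalerBl; congr (_ + _ *: _).
rewrite -![_ *: (_ : C^o)]/(_ * _) rmorphN; ring.
Qed.

Definition steps u v (bs : seq bool) := foldr (step u v) (0, 0) bs.

Lemma refl_word_steps (l : V) (bs : seq bool) :
  refl_word D (map pick bs) l =
  let xy := steps (l (rd_coroot D s)) (l (rd_coroot D t)) bs in
  l + xy.1 *: rs + xy.2 *: rt.
Proof.
elim: bs => [|b bs ih] /=; first by rewrite id_lfunE !scale0r !addr0.
by rewrite comp_lfunE ih refl_step.
Qed.

Lemma alt_word_map k :
  alt_word s t k = map pick (alt_word true false k).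
Proof. by elim: k => //= k ->; case: (odd k). Qed.

Lemma alt_word_map' k :
  alt_word t s k = map pick (alt_word false true k).
Proof. by elim: k => //= k ->; case: (odd k). Qed.

(** Both words add to l a combination of alpha_s and alpha_t depending only on the two pairings of
    l, computed explicitly in each finite case. For infinite order both words are empty. *)
Lemma braid : 0 <= p -> 0 <= q -> (p = 0 <-> q = 0) ->
  weyl_word D (alt_word s t (cox_order p q)) = weyl_word D (alt_word t s (cox_order p q)).
Proof.
move=> p0 q0 pq; apply: val_inj; apply/lfunP => l /=.
rewrite alt_word_map alt_word_map' !refl_word_steps.
move: (l _) (l _) => u v; set X := steps _ _ _; set Y := steps _ _ _.
suff -> : X = Y by [].
rewrite /X /Y /cox_order; have [h|[e|e|e|e]] := rank2_cases p0 q0 pq.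
- have [h0 h1 h2 h3] : [/\ p * q != 0, p * q != 1, p * q != 2 & p * q != 3] by split; lia.
  by rewrite (negPf h0) (negPf h1) (negPf h2) (negPf h3).
- case: e => e1 e2; rewrite /steps /step e1 e2 /=; congr (_, _); ring.
- case: e => e1 e2; rewrite /steps /step e1 e2 /=; congr (_, _); ring.
- case: e => -[e1 e2]; rewrite /steps /step e1 e2 /=; congr (_, _); ring.
case: e => -[e1 e2]; rewrite /steps /step e1 e2 /=; congr (_, _); ring.
Qed.

End Braid.
End Weyl.

(** * Real roots, length and reflections *)

Section Roots.
Variables (C : fieldType) (charC0 : [pchar C] =i pred0).
Variables (n : nat) (A : 'M[int]_n) (D : root_datum C A) (L : demazure_lattice D).
Local Notation W := (weyl D).
Local Notation Lam := (lat L).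
Local Notation al := (simple_root L).
Local Notation s_ := (simple_refl D).
Local Notation act := (@weyl_lat C n A D L).

Lemma weyl_lat_zmod (w : W) : zmod_morphism (act w).
Proof. by move=> l m; apply: lat_ext; rewrite /= raddfB. Qed.
HB.instance Definition _ w := GRing.isZmodMorphism.Build Lam Lam (act w) (weyl_lat_zmod w).

Lemma weyl_lat1 l : act 1%g l = l.
Proof. by apply: lat_ext; rewrite /= id_lfunE. Qed.

Lemma weyl_latM v w l : act (v * w)%g l = act v (act w l).
Proof. by apply: lat_ext; rewrite /= comp_lfunE. Qed.

Lemma weyl_latK w : cancel (act w) (act w^-1%g).
Proof. by move=> l; rewrite -weyl_latM mulVg weyl_lat1. Qed.

Lemma weyl_latVK w : cancel (act w^-1%g) (act w).
Proof. by move=> l; rewrite -weyl_latM mulgV weyl_lat1. Qed.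

Lemma simple_reflKr x i : (x * s_ i * s_ i = x)%g.
Proof. by rewrite -mulgA simple_reflK mulg1. Qed.

Lemma pairing_ex i : exists pr : Lam -> int,
  forall l : Lam, (lat_val l (rd_coroot D i) : C) = (pr l)%:~R.
Proof.
have /choice[pr h] (l : Lam) : exists z : int, (lat_val l (rd_coroot D i) : C) = z%:~R.
  by apply: dl_int; apply: valP.
by exists pr.
Qed.

Definition pairing i : Lam -> int := sval (cid (pairing_ex i)).

Lemma pairingE i (l : Lam) : (lat_val l (rd_coroot D i) : C) = (pairing i l)%:~R.
Proof. by rewrite /pairing; case: cid. Qed.

Lemma pairing_simple i j : pairing i (al j) = A i j.
Proof. by apply: (pcharC_int charC0); rewrite -pairingE rd_pairing. Qed.

Lemma act_simple i l : act (s_ i) l = l - al i *~ pairing i l.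
Proof.
apply: lat_ext; rewrite lat_valD /= comp_lfun1r lfunE /= /refl_fun pairingE.
by rewrite scaler_int; congr (_ - _); exact: esym (lat_valMz (al i) _).
Qed.

Lemma pairingB i l m : pairing i (l - m) = pairing i l - pairing i m.
Proof.
apply: (pcharC_int charC0); rewrite intrB -!pairingE /= add_lfunE.
by rewrite opp_lfunE.
Qed.
HB.instance Definition _ i := GRing.isZmodMorphism.Build Lam int (pairing i) (pairingB i).

Lemma act_simple_root i : act (s_ i) (al i) = - al i.
Proof.
rewrite act_simple pairing_simple; case: (rd_gcm D) => -> _ _.
by rewrite -[2]/(1 + 1) mulrzDr mulr1z opprD addrA subrr sub0r.
Qed.

Definition comb (c : 'I_n -> int) : Lam := \sum_i al i *~ c i.

Lemma comb_free c : comb c = 0 -> forall i, c i = 0.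
Proof.
move=> e i; apply: (pcharC_int charC0).
have /freeP h := rd_root_free D.
have := h (fun i => (c i)%:~R) _ i; rewrite rmorph0; apply.
move/(congr1 (@lat_val _ _ _ _ L)): e; rewrite lat_val_sum => e; rewrite -[RHS]e.
apply: eq_bigr => j _; rewrite (nth_map j) ?size_enum_ord // nth_ord_enum.
by rewrite lat_valMz scaler_int.
Qed.

Lemma comb_inj c d : comb c = comb d -> c =1 d.
Proof.
move=> e i; apply/eqP; rewrite -subr_eq0; apply/eqP; move: i; apply: comb_free.
rewrite /comb; under eq_bigr do rewrite mulrzBr.
by rewrite sumrB -/(comb c) e subrr.
Qed.

Definition delta (i : 'I_n) (z : int) (j : 'I_n) : int := if j == i then z else 0.

Lemma comb_delta i z : comb (delta i z) = al i *~ z.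
Proof.
rewrite /comb (eq_bigr (fun j => if j == i then al j *~ z else 0)).
  by rewrite -big_mkcond big_pred1_eq.
by move=> j _; rewrite /delta; case: (j == i); rewrite ?mulr0z.
Qed.

Lemma combD c d : comb (fun i => c i + d i) = comb c + comb d.
Proof. by rewrite /comb -big_split; apply: eq_bigr => i _; rewrite mulrzDr. Qed.

Lemma combN c : comb (fun i => - c i) = - comb c.
Proof. by rewrite /comb -sumrN; apply: eq_bigr => i _; rewrite mulrNz. Qed.

Definition nonneg (l : Lam) := exists2 c : 'I_n -> int, forall i, 0 <= c i & l = comb c.

Lemma nonnegP l : nonneg l <-> exists c : 'I_n -> nat, l = \sum_i al i *+ c i.
Proof.
split=> [[c c0 ->]|[c ->]]; last by exists (fun i => (c i)%:Z).
exists (fun i => `|c i|%N); apply: eq_bigr => i _.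
by have := c0 i; case: (c i).
Qed.

Lemma nonneg_simple i : nonneg (al i).
Proof. by exists (delta i 1); rewrite ?comb_delta // => j; rewrite /delta; case: ifP. Qed.

Lemma nonnegD l m : nonneg l -> nonneg m -> nonneg (l + m).
Proof.
move=> [c c0 ->] [d d0 ->]; exists (fun i => c i + d i); rewrite ?combD // => i.
by have := c0 i; have := d0 i; lia.
Qed.

Lemma nonnegMz l z : 0 <= z -> nonneg l -> nonneg (l *~ z).
Proof.
case: z => // m _ hl; elim: m => [|m ih].
  by exists (fun=> 0) => //; rewrite /comb big1 // => i _; rewrite mulr0z.
by rewrite intS mulrzDr; apply: nonnegD.
Qed.

Lemma nonneg_anti l : nonneg l -> nonneg (- l) -> l = 0.
Proof.
move=> [c c0 e] [d d0 e']; rewrite e /comb big1 // => i _.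
suff -> : c i = 0 by rewrite mulr0z.
have /comb_inj/(_ i) : comb d = comb (fun i => - c i) by rewrite combN -e -e'.
by have := c0 i; have := d0 i; lia.
Qed.

Lemma simple_neq0 i : al i <> 0.
Proof. by move=> e; have [co h] := simple_root_dual L i; move: h; rewrite e raddf0. Qed.

Lemma act_eq0 w l : act w l = 0 -> l = 0.
Proof. by move=> e; rewrite -[l](weyl_latK w) e raddf0. Qed.

Lemma pairing_comb2 i s t a b : pairing i (al s *~ a + al t *~ b) = A i s * a + A i t * b.
Proof. by rewrite raddfD !raddfMz /= !pairing_simple !mulrzz. Qed.

Lemma alt_word_coord s t k :
  act (weyl_word D (alt_word s t k)) (al s) =
  al s *~ (alt_coord (- A s t) (- A t s) k).1 + al t *~ (alt_coord (- A s t) (- A t s) k).2.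
Proof.
elim: k => [|k ih]; first by rewrite weyl_word0 weyl_lat1 mulr1z mulr0z addr0.
rewrite [alt_word _ _ _]/= weyl_word_cons weyl_latM ih /=.
case: (alt_coord _ _ k) => a b /=; have ass i : A i i = 2 by case: (rd_gcm D).
case: (odd k) => /=; rewrite act_simple pairing_comb2 ass.
  by rewrite addrAC -mulrzBr; congr (al s *~ _ + _); ring.
by rewrite -addrA -mulrzBr; congr (_ + al t *~ _); ring.
Qed.

(* Peel off from a reduced word of w the longest alternating tail in s, t:    *)
(* the remaining factor is shorter and sends alpha_s, alpha_t to nonnegative  *)
(* combinations by induction, and the tail is a rank two computation.         *)
Lemma act_pos w i : (len w <= len (w * s_ i)%g)%N -> nonneg (act w (al i)).
Proof.
have [N] := ubnP (len w); elim: N w i => // N IH w s; rewrite ltnS => wN hs.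
have [/len_eq0 ->|w0] := eqVneq (len w) 0%N; first by rewrite weyl_lat1; apply: nonneg_simple.
have [t [v1 [ew lw]]] : exists t v1, w = (v1 * s_ t)%g /\ len w = (len v1).+1.
  have [rw [t e]] : exists rw t, red_word w = rcons rw t.
    by move: w0; rewrite /len; case: (lastP (red_word w)) => // rw t _; exists rw, t.
  have lw : len w = (size rw).+1 by rewrite /len e size_rcons.
  have ew : w = (weyl_word D rw * s_ t)%g.
    by rewrite -[LHS]red_wordK e -cats1 weyl_word_cat.
  exists t, (weyl_word D rw); split=> //; apply/eqP.
  rewrite eqn_leq {2}lw ltnS len_le andbT.
  by rewrite {1}ew (leq_trans (len_mul _ _)) // -addn1 leq_add2l len_simple.
have st : s != t.
  apply/eqP => est; move: hs; rewrite est ew simple_reflKr -ew lw.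
  by rewrite ltnn.
pose P k := `[< exists v, w = (v * weyl_word D (alt_word s t k))%g /\ len w = (len v + k)%N >].
have P1 : exists k, P k by exists 1%N; apply/asboolP; exists v1; rewrite addn1.
have Pb k : P k -> (k <= len w)%N by move=> /asboolP[v [_ ->]]; apply: leq_addl.
case: (ex_maxnP P1 Pb) => k /asboolP[v [ev lv]] kmax.
have k0 : (0 < k)%N by apply: kmax; apply/asboolP; exists v1; rewrite addn1.
have hc : (len v <= len (v * s_ (if odd k then s else t))%g)%N.
  rewrite leqNgt; apply/negP; set c := if odd k then s else t => lt.
  have ew' : w = (v * s_ c * weyl_word D (alt_word s t k.+1))%g.
    by rewrite [alt_word _ _ _]/= weyl_word_cons mulgA simple_reflKr.
  suff /kmax : P k.+1 by rewrite ltnn.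
  apply/asboolP; exists (v * s_ c)%g; split=> //; apply/eqP; rewrite eqn_leq.
  apply/andP; split; last by rewrite lv addnS -addSn leq_add2r.
  by rewrite {1}ew' (leq_trans (len_mul _ _)) // leq_add2l (leq_trans (len_le _ _)) ?size_alt_word.
have hd : (len v <= len (v * s_ (if odd k then t else s))%g)%N.
  rewrite leqNgt; apply/negP; case: k {kmax hc} k0 ev lv => // k _ ev lv.
  have -> : (if odd k.+1 then t else s) = (if odd k then s else t) by rewrite /=; case: odd.
  set d := if odd k then s else t => lt.
  have ew' : w = (v * s_ d * weyl_word D (alt_word s t k))%g.
    by rewrite ev [alt_word _ _ _]/= weyl_word_cons mulgA.
  have : (len w <= len (v * s_ d)%g + k)%N.
    by rewrite {1}ew' (leq_trans (len_mul _ _)) // leq_add2l (leq_trans (len_le _ _)) ?size_alt_word.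
  by rewrite lv; lia.
have [hvs hvt] : (len v <= len (v * s_ s)%g)%N /\ (len v <= len (v * s_ t)%g)%N.
  by move: hc hd; case: (odd k).
have vN : (len v < N)%N by apply: leq_trans wN; rewrite lv -addn1 leq_add2l.
rewrite ev weyl_latM alt_word_coord raddfD !raddfMz.
have [_ hneg hsym] := rd_gcm D.
have p0 : 0 <= - A s t by have := hneg s t st; lia.
have q0 : 0 <= - A t s by have := hneg t s; rewrite eq_sym => /(_ st); lia.
have pq0 : - A s t = 0 <-> - A t s = 0.
  have [h1 h2] := hsym s t.
  by split=> e; [rewrite h1 ?oppr0|rewrite h2 ?oppr0] => //; lia.
have [|a0 b0] := @alt_coord_pos (- A s t) (- A t s) k p0 q0 pq0; last first.
  by apply: nonnegD; apply: nonnegMz => //; apply: IH.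
(* Were the tail as long as the order of s_s s_t, a braid relation would make it end in [s], and
   multiplying by s_s would shorten [w]. *)
case em : (cox_order _ _) => [|m]; [by left|right; rewrite ltnNge; apply/negP => mk].
have [u su eu] := alt_word_suffix s t mk.
have br : weyl_word D (alt_word s t m.+1) = weyl_word D (alt_word t s m.+1).
  by rewrite -em; apply: braid; rewrite ?opprK.
move: hs; rewrite leqNgt => /negP; apply.
have -> : (w * s_ s = v * (weyl_word D u * weyl_word D (alt_word s t m)))%g.
  rewrite ev eu weyl_word_cat br alt_word_rcons -cats1 weyl_word_cat weyl_word1 !mulgA.
  by rewrite simple_reflKr.
rewrite lv; apply: leq_ltn_trans (len_mul _ _) _; rewrite ltn_add2l -weyl_word_cat.
by apply: leq_ltn_trans (len_le _ _) _; rewrite size_cat su size_alt_word; lia.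
Qed.

Lemma act_simple_opp w i : act (w * s_ i)%g (al i) = - act w (al i).
Proof. by rewrite weyl_latM act_simple_root raddfN. Qed.

Lemma act_sign w i : nonneg (act w (al i)) \/ nonneg (- act w (al i)).
Proof.
have [h|h] := leqP (len w) (len (w * s_ i)%g); first by left; apply: act_pos.
right; rewrite -act_simple_opp; apply: act_pos.
by rewrite simple_reflKr ltnW.
Qed.

Definition root (l : Lam) := roots L l.

Lemma root_act w l : root l -> root (act w l).
Proof. by move=> [v [i ->]]; exists (w * v)%g, i; rewrite weyl_latM. Qed.

Lemma root_simple i : root (al i).
Proof. by exists 1%g, i; rewrite weyl_lat1. Qed.

Lemma rootN l : root l -> root (- l).
Proof.
move=> [v [i ->]]; exists (v * s_ i)%g, i.
by rewrite weyl_latM act_simple_root raddfN.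
Qed.

Lemma root_sign l : root l -> nonneg l \/ nonneg (- l).
Proof. by move=> [v [i ->]]; apply: act_sign. Qed.

Lemma root_neq0 l : root l -> l <> 0.
Proof. by move=> [v [i ->]] /act_eq0; apply: simple_neq0. Qed.

Lemma pos_rootsP l : pos_roots L l <-> root l /\ nonneg l.
Proof. by split=> -[h1 /nonnegP h2]. Qed.

Lemma root_pos l : root l -> pos_roots L l \/ pos_roots L (- l).
Proof.
move=> h; case: (root_sign h) => hs; [left|right]; apply/pos_rootsP; split=> //.
exact: rootN.
Qed.

Lemma root_dual l : root l -> exists co : {additive Lam -> int}, co l = 1.
Proof.
move=> [v [i ->]]; have [co h] := simple_root_dual L i.
by exists (co \o act v^-1%g); rewrite /= weyl_latK.
Qed.

(** A functional takes the value 1 on the root [l], which makes z a unit. *)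
Lemma root_colinear l m z : root l -> root m -> l = m *~ z -> l = m \/ l = - m.
Proof.
move=> /root_dual[co h] _ e; move: h; rewrite {1}e raddfMz mulrzz => h.
have /(congr1 absz)/eqP := h; rewrite abszM muln_eq1 => /andP[_ /eqP z1].
have [e1|e1] : z = 1 \/ z = -1 by lia.
  by left; rewrite e e1 mulr1z.
by right; rewrite e e1 mulrNz mulr1z.
Qed.

(** s_i changes only the coefficient of alpha_i; if the image were negative, [l] would be a multiple
    of alpha_i. *)
Lemma simple_refl_pos i l : root l -> nonneg l -> l <> al i -> nonneg (act (s_ i) l).
Proof.
move=> hl [c c0 ec] li.
have [//|[d d0 ed]] := root_sign (root_act (s_ i) hl).
have e : comb (fun j => c j + d j) = al i *~ pairing i l.
  by rewrite combD -ec -ed act_simple opprB addrC subrK.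
have cz j : j != i -> c j = 0.
  move=> /negPf ji; have := e; rewrite -comb_delta => /comb_inj/(_ j).
  by rewrite /delta ji; have := c0 j; have := d0 j; lia.
have el : l = al i *~ c i.
  rewrite ec -comb_delta; congr comb; apply/funext => j; rewrite /delta.
  by case: (eqVneq j i) => [->//|/cz].
case: (root_colinear hl (root_simple i) el) => // el'; exfalso.
have := nonneg_simple i; rewrite -[al i]opprK -el' => h.
by apply: (root_neq0 hl); apply: nonneg_anti => //; exists c.
Qed.

(** The letters are applied in turn; by [simple_refl_pos] a positive root turns negative only when
    it equals the simple root of the current letter. *)
Lemma neg_word s l : root l -> nonneg l -> nonneg (- act (weyl_word D s)^-1%g l) ->
  exists s1 i s2, s = s1 ++ i :: s2 /\ l = act (weyl_word D s1) (al i).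
Proof.
elim: s l => [|i s ih] l hl pl.
  rewrite weyl_word0 invg1 weyl_lat1 => nl.
  by case: (root_neq0 hl); apply: nonneg_anti.
rewrite weyl_word_cons invgM simple_reflV weyl_latM => nl.
have [->|li] := pselect (l = al i).
  by exists [::], i, s; rewrite weyl_word0 weyl_lat1.
have [s1 [j [s2 [-> e]]]] := ih _ (root_act (s_ i) hl) (simple_refl_pos hl pl li) nl.
exists (i :: s1), j, s2; split=> //.
by rewrite weyl_word_cons weyl_latM -e -weyl_latM simple_reflK weyl_lat1.
Qed.

(** The simple root of the last letter of a reduced word is sent to a negative root. *)
Lemma act_pos_len0 u : (forall i, nonneg (act u (al i))) -> u = 1%g.
Proof.
move=> h; have [/len_eq0 //|w0] := eqVneq (len u) 0%N; exfalso.
have [rw [t e]] : exists rw t, red_word u = rcons rw t.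
  by move: w0; rewrite /len; case: (lastP (red_word u)) => // rw t _; exists rw, t.
have eu : u = (weyl_word D rw * s_ t)%g.
  by rewrite -[LHS]red_wordK e -cats1 weyl_word_cat.
have hv : nonneg (act (weyl_word D rw) (al t)).
  apply: act_pos; rewrite -eu (leq_trans (len_le _ _)) //.
  by rewrite /len e size_rcons.
have := h t; rewrite eu weyl_latM act_simple_root raddfN => hn.
by apply: (simple_neq0 (i := t)); apply: (act_eq0 (w := weyl_word D rw)); apply: nonneg_anti.
Qed.

Definition refl_of (v : W) i : W := (v * s_ i * v^-1)%g.

Lemma refl_ofK v i : (refl_of v i * refl_of v i = 1)%g.
Proof.
rewrite /refl_of !mulgA mulgVK simple_reflKr mulgV.
by [].
Qed.

Lemma refl_ofV v i : (refl_of v i)^-1%g = refl_of v i.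
Proof. by apply: mulg1_eq; apply: refl_ofK. Qed.

Lemma act_refl_of v i : act (refl_of v i) (act v (al i)) = - act v (al i).
Proof. by rewrite /refl_of !weyl_latM weyl_latK act_simple_root raddfN. Qed.

Lemma refl_of_shift v i l : exists z, act (refl_of v i) l = l + act v (al i) *~ z.
Proof.
exists (- pairing i (act v^-1%g l)); rewrite /refl_of !weyl_latM act_simple raddfB.
by rewrite [X in X - _]weyl_latVK [X in _ - X]raddfMz mulrNz.
Qed.

Lemma refl_of_mul u v i : (u * refl_of v i = refl_of (u * v) i * u)%g.
Proof. by rewrite /refl_of invgM !mulgA mulgVK. Qed.

Lemma refl_of_opp v i : refl_of (v * s_ i)%g i = refl_of v i.
Proof. by rewrite /refl_of invgM simple_reflV !mulgA simple_reflKr. Qed.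

(* u = s_beta s_(alpha_j) with beta = alpha_j adds multiples of alpha_j and   *)
(* fixes alpha_j, hence preserves positivity, hence is trivial.               *)
Lemma refl_of_simple v i j : act v (al i) = al j -> refl_of v i = s_ j.
Proof.
move=> e; suff u1 : (refl_of v i * s_ j = 1)%g.
  by rewrite -[LHS](simple_reflKr _ j) u1 mul1g.
have uj : act (refl_of v i * s_ j)%g (al j) = al j.
  have r : act (refl_of v i) (al j) = - al j by rewrite -e act_refl_of.
  by rewrite act_simple_opp r opprK.
apply: act_pos_len0 => k; have [->|kj] := eqVneq k j; first by rewrite uj; apply: nonneg_simple.
have [z ez] : exists z, act (refl_of v i * s_ j)%g (al k) = al k + al j *~ z.
  have [z ez] := refl_of_shift v i (act (s_ j) (al k)).
  exists (z - pairing j (al k)); rewrite weyl_latM ez act_simple e mulrzBr.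
  by rewrite addrAC addrA.
case: (act_sign (refl_of v i * s_ j)%g k) => // -[c c0 ec]; exfalso.
have : comb (delta k 1) + comb (delta j z) = comb (fun m => - c m).
  by rewrite combN -ec opprK ez !comb_delta mulr1z.
rewrite -combD => /comb_inj/(_ k); rewrite /delta eqxx (negPf kj).
by have := c0 k; lia.
Qed.

(** The reflection s_alpha depends on the root alpha up to sign only, not on its presentation. *)
Lemma refl_of_uniq v i v' j : act v (al i) = act v' (al j) \/ act v (al i) = - act v' (al j) ->
  refl_of v i = refl_of v' j.
Proof.
have key u k : act u (al k) = act v' (al j) -> refl_of u k = refl_of v' j.
  move=> e; have := @refl_of_simple (v'^-1 * u)%g k j.
  rewrite weyl_latM e weyl_latK => /(_ erefl) h.
  rewrite [RHS]/refl_of -h /refl_of invgM invgK !mulgA mulgV mul1g.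
  by rewrite mulgK.
case=> [/key //|e]; rewrite -refl_of_opp; apply: key.
by rewrite act_simple_opp e opprK.
Qed.

(** Strong exchange: the reflection deletes from a reduced word the letter found by [neg_word]. *)
Lemma refl_len_lt w v i : nonneg (act v (al i)) -> nonneg (- act w^-1%g (act v (al i))) ->
  (len (refl_of v i * w)%g < len w)%N.
Proof.
move=> pl; rewrite -{1}[w]red_wordK => nl.
have rl : root (act v (al i)) by exists v, i.
have [s1 [j [s2 [ew e]]]] := neg_word rl pl nl.
rewrite (refl_of_uniq (or_introl e)).
have -> : (refl_of (weyl_word D s1) j * w = weyl_word D (s1 ++ s2))%g.
  rewrite -[w]red_wordK ew !weyl_word_cat weyl_word_cons /refl_of !mulgA mulgVK.
  by rewrite simple_reflKr.
apply: leq_ltn_trans (len_le _ _) _; rewrite /len ew !size_cat /=; lia.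
Qed.

Lemma refl_len_gt w v i : nonneg (act v (al i)) -> nonneg (act w^-1%g (act v (al i))) ->
  (len w < len (refl_of v i * w)%g)%N.
Proof.
move=> pl h; have := @refl_len_lt (refl_of v i * w)%g v i pl.
rewrite mulgA refl_ofK mul1g; apply.
by rewrite invgM refl_ofV weyl_latM act_refl_of raddfN opprK.
Qed.

End Roots.

(** * Localizations and twisted group algebras *)

Section LocalizationTheory.
Variables (S : comPzRingType) (G : set S).
Local Notation Q := (loc G).
Local Notation lin := (@loc_in S G).

Definition invertible (A : comPzRingType) (x : A) := exists y, x * y = 1.

Lemma cinvE (A : comPzRingType) (x y : A) : x * y = 1 -> cinv x = y.
Proof.
move=> xy; have : x * cinv x = 1 by apply: (xgetPex 0 (P := [set y | x * y = 1])); exists y.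
by move=> e; rewrite -[LHS]mul1r -xy mulrAC e mul1r.
Qed.

Lemma cinvP (A : comPzRingType) (x : A) : invertible x -> x * cinv x = 1.
Proof. by move=> [y h]; rewrite (cinvE h). Qed.

Lemma invertible_cancel (A : comPzRingType) (x y z : A) :
  invertible x -> x * y = x * z -> y = z.
Proof. by move=> [w h] e; rewrite -[y]mul1r -[z]mul1r -h mulrAC e mulrAC. Qed.

Lemma invertibleM (A : comPzRingType) (x y : A) :
  invertible x -> invertible y -> invertible (x * y).
Proof. by move=> [a ha] [b hb]; exists (a * b); rewrite mulrACA ha hb mulr1. Qed.

Lemma invertible_dvd (A : comPzRingType) (x y : A) : invertible (x * y) -> invertible x.
Proof. by move=> [a h]; exists (y * a); rewrite mulrA. Qed.

Lemma mulspan_gen g : G g -> g \in mulspan G.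
Proof.
move=> Gg; apply/mulspanP; exists [:: g]; last by rewrite big_seq1.
by move=> h; rewrite inE => /eqP ->.
Qed.

Lemma mulspan_inv u : u \in mulspan G -> invertible (lin u).
Proof.
move=> hu; exists (frac 1 (Den hu)); rewrite -[LHS]/(loc_mul _ _) /loc_in frac_mul.
by apply: frac_eq; rewrite /= !mul1r !mulr1.
Qed.

Lemma loc_elim (q : Q) : exists s u, u \in mulspan G /\ lin u * q = lin s.
Proof.
have [s [t ->]] := fracW q; exists s, (den_val t); split; first exact: valP.
rewrite -[LHS]/(loc_mul _ _) /loc_in frac_mul.
by apply: frac_eq; rewrite /= mul1r mulr1 mulrC.
Qed.

Lemma frac_lin s t : frac (G := G) s t * lin (den_val t) = lin s.
Proof.
rewrite -[LHS]/(loc_mul _ _) /loc_in frac_mul.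
by apply: frac_eq; rewrite /= !mulr1.
Qed.

Lemma lin_inj : (forall u s, u \in mulspan G -> u * s = 0 -> s = 0) -> injective lin.
Proof.
move=> nz s t /fracP[u hu] /=; rewrite !mulr1 => e.
by apply/eqP; rewrite -subr_eq0; apply/eqP/(nz u) => //; rewrite mulrBr e subrr.
Qed.

Lemma mulspan_nzd : (forall g s, G g -> g * s = 0 -> s = 0) ->
  forall u s, u \in mulspan G -> u * s = 0 -> s = 0.
Proof.
move=> nz u s /mulspanP[r rG ->]; elim: r rG => [|g r ih] rG.
  by rewrite big_nil mul1r.
rewrite big_cons -mulrA => /(nz _ _ (rG g (mem_head _ _))); apply: ih => h hr.
by apply: rG; rewrite in_cons hr orbT.
Qed.

Lemma loc_hom_ext (A : comPzRingType) (f g : {rmorphism Q -> A}) :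
  (forall s, f (lin s) = g (lin s)) -> f =1 g.
Proof.
move=> h q; have [s [u [hu e]]] := loc_elim q.
have [y hy] := mulspan_inv hu.
have iu : invertible (f (lin u)) by exists (f y); rewrite -rmorphM hy rmorph1.
by apply: (invertible_cancel iu); rewrite -rmorphM e h -e rmorphM h.
Qed.

Section Extension.
Variable f : {rmorphism S -> S}.
Hypothesis finv : forall g, G g -> invertible (lin (f g)).

Lemma mulspan_finv u : u \in mulspan G -> invertible (lin (f u)).
Proof.
move=> /mulspanP[r rG ->]; elim: r rG => [|g r ih] rG.
  by rewrite big_nil !rmorph1; exists 1; rewrite mulr1.
rewrite big_cons !rmorphM; apply: invertibleM; first by apply/finv/rG; rewrite mem_head.
by apply: ih => h hr; apply: rG; rewrite in_cons hr orbT.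
Qed.

(** [loc_ext] chooses a fraction for [q]; its value may be computed from any other one. *)
Lemma loc_ext_frac u s q : u \in mulspan G -> lin u * q = lin s ->
  lin (f u) * loc_ext f q = lin (f s).
Proof.
move=> hu e.
have [s' [t' [eq ->]]] : exists s t, q = frac s t /\
    loc_ext f q = lin (f s) * cinv (lin (f (den_val t))).
  apply: (xgetPex 0 (P :=
    [set q' | exists s t, q = frac s t /\ q' = lin (f s) * cinv (lin (f (den_val t)))])).
  by have [s' [t' e']] := fracW q; exists (lin (f s') * cinv (lin (f (den_val t')))), s', t'.
have it := mulspan_finv (valP t').
apply: (invertible_cancel it).
rewrite mulrCA [X in _ * X]mulrCA (cinvP it) mulr1 -!rmorphM.
have : lin (u * s') = lin (den_val t' * s).
  by rewrite !rmorphM /= -e -(frac_lin s' t') -eq [RHS]mulrCA; congr (_ * _); apply: mulrC.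
move=> /fracP[w hw] /=; rewrite !mulr1 => ew.
apply: (invertible_cancel (mulspan_finv hw)); rewrite -!rmorphM.
by rewrite ew.
Qed.

Lemma loc_ext_in s : loc_ext f (lin s) = lin (f s).
Proof. by have := loc_ext_frac (mulspan1 G) (mul1r (lin s)); rewrite !rmorph1 !mul1r; apply;
  rewrite rmorph1 mul1r. Qed.

Lemma loc_ext_zmod : zmod_morphism (loc_ext f : Q -> Q).
Proof.
move=> p q; have [s [u [hu e]]] := loc_elim p; have [t [v [hv e']]] := loc_elim q.
have huv := mulspanM hu hv; apply: (invertible_cancel (mulspan_finv huv)).
have -> := loc_ext_frac (s := s * v - t * u) huv; last by rewrite rmorphB !rmorphM /= -e -e'; ring.
rewrite mulrBr !rmorphB !rmorphM /= -(loc_ext_frac hu e) -(loc_ext_frac hv e'); ring.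
Qed.
HB.instance Definition _ := GRing.isZmodMorphism.Build Q Q (loc_ext f) loc_ext_zmod.

Lemma loc_ext_monoid : monoid_morphism (loc_ext f : Q -> Q).
Proof.
split=> [|p q]; first by rewrite -(rmorph1 lin) loc_ext_in !rmorph1.
have [s [u [hu e]]] := loc_elim p; have [t [v [hv e']]] := loc_elim q.
have huv := mulspanM hu hv; apply: (invertible_cancel (mulspan_finv huv)).
have -> := loc_ext_frac (s := s * t) huv; last by rewrite !rmorphM /= -e -e'; ring.
rewrite !rmorphM /= -(loc_ext_frac hu e) -(loc_ext_frac hv e'); ring.
Qed.
HB.instance Definition _ := GRing.isMonoidMorphism.Build Q Q (loc_ext f) loc_ext_monoid.

Definition loc_extr : {rmorphism Q -> Q} := loc_ext f.
End Extension.

End LocalizationTheory.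

Section TwistedTheory.
Variables (W : groupType) (Q : comPzRingType) (act : W -> {rmorphism Q -> Q}).
Hypothesis act1 : forall q, act 1%g q = q.
Hypothesis actM : forall v w q, act (v * w)%g q = act v (act w q).
Local Notation T := {malg Q[W]}.
Local Notation twm := (tw_mul (fun w => act w)).
Implicit Types (f : W -> Q) (z : T).

(* The right action of the twisted algebra on functions, dual to right        *)
(* multiplication: Rop z f (v) = f (delta_v z).                              *)
Definition Rop z f : W -> Q := fun v => \sum_(u <- msupp z) act v z@_u * f (v * u)%g.

Lemma RopEw (d : {fset W}) z f v : (msupp z `<=` d)%fset ->
  Rop z f v = \sum_(u <- d) act v z@_u * f (v * u)%g.
Proof.
move=> le; rewrite /Rop (big_fset_incl _ le) // => u _.
by rewrite -mcoeff_eq0 => /eqP ->; rewrite rmorph0 mul0r.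
Qed.

Lemma tw_evalE f z : tw_eval f z = Rop z f 1%g.
Proof. by apply: eq_bigr => u _; rewrite act1 mul1g. Qed.

Lemma RopB y z f v : Rop (y - z) f v = Rop y f v - Rop z f v.
Proof.
rewrite (RopEw _ _ (msuppB_le y z)).
rewrite (RopEw _ _ (fsubsetUl _ (msupp z))) (RopEw _ _ (fsubsetUr (msupp y) _)).
by rewrite -sumrB; apply: eq_bigr => u _; rewrite mcoeffB rmorphB mulrBl.
Qed.

Lemma Rop0 f v : Rop 0 f v = 0.
Proof. by rewrite /Rop msupp0 big_seq_fset0. Qed.

Lemma RopN z f v : Rop (- z) f v = - Rop z f v.
Proof. by rewrite -sub0r RopB Rop0 sub0r. Qed.

Lemma RopD y z f v : Rop (y + z) f v = Rop y f v + Rop z f v.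
Proof. by rewrite -[z in LHS]opprK RopB RopN opprK. Qed.

Lemma Rop_sum (J : Type) (r : seq J) (E : J -> T) f v :
  Rop (\sum_(j <- r) E j) f v = \sum_(j <- r) Rop (E j) f v.
Proof. by elim/big_rec2: _ => [|j a b _ <-]; rewrite ?Rop0 ?RopD. Qed.

Lemma RopU u q f v : Rop (mkmalgU u q) f v = act v q * f (v * u)%g.
Proof. by rewrite (RopEw _ _ msuppU_le) big_seq_fset1 mcoeffUU. Qed.

Lemma RopM y z f v : Rop (twm y z) f v = Rop y (Rop z f) v.
Proof.
rewrite /tw_mul Rop_sum; apply: eq_bigr => a _; rewrite Rop_sum mulr_sumr.
apply: eq_bigr => b _; rewrite RopU rmorphM -actM -mulrA; congr (_ * _).
by rewrite mulgA.
Qed.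

Lemma Rop_subf z f g v : Rop z (fun w => f w - g w) v = Rop z f v - Rop z g v.
Proof. by rewrite -sumrB; apply: eq_bigr => u _; rewrite mulrBr. Qed.

Lemma tw_evalM f y z : tw_eval f (twm y z) = tw_eval (Rop z f) y.
Proof. by rewrite !tw_evalE RopM. Qed.

Lemma tw_evalB f y z : tw_eval f (y - z) = tw_eval f y - tw_eval f z.
Proof. by rewrite !tw_evalE RopB. Qed.

Lemma Rop_scal q f v : Rop (tw_scal W q) f v = act v q * f v.
Proof. by rewrite RopU mulg1. Qed.

Lemma Rop_delta u f v : Rop (tw_delta Q u) f v = f (v * u)%g.
Proof. by rewrite RopU rmorph1 mul1r. Qed.

Definition divdiff q s : T := twm (tw_scal W q) (tw_delta Q 1%g - tw_delta Q s).

Lemma Rop_divdiff q s f v : Rop (divdiff q s) f v = act v q * (f v - f (v * s)%g).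
Proof. by rewrite RopM Rop_scal RopB !Rop_delta mulg1. Qed.

(** The method behind the integrality statements: to control the values of [f] on an algebra, find a
    class of functions containing [f] and stable under the generators. *)
Lemma tw_subalg_stable (G : set T) (Mo : set (W -> Q)) :
  (forall f g, Mo f -> Mo g -> Mo (fun w => f w - g w)) ->
  (forall z f, G z -> Mo f -> Mo (Rop z f)) ->
  forall z, tw_subalg (fun w => act w) G z -> forall f, Mo f -> Mo (Rop z f).
Proof.
move=> MB MG z; elim=> {z} [z Gz|||] => [f hf||y z _ hy _ hz f hf|y z _ hy _ hz f hf].
- exact: MG.
- move=> f; rewrite [Rop _ _](_ : _ = f) //; apply/funext => v.
  by rewrite Rop_scal rmorph1 mul1r.
- rewrite [Rop _ _](_ : _ = (fun w => Rop y f w - Rop z f w)); first by apply: MB; auto.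
  by apply/funext => v; rewrite RopB.
rewrite [Rop _ _](_ : _ = Rop y (Rop z f)); first by apply/hy/hz.
by apply/funext => v; rewrite RopM.
Qed.

Definition ind u : W -> Q := fun w => (w == u)%:R.

Lemma Rop_ind z u v : Rop z (ind u) v = act v z@_(v^-1 * u)%g.
Proof.
have le : (msupp z `<=` (v^-1 * u)%g |` msupp z)%fset by apply: fsubsetU1.
rewrite (RopEw _ _ le) (big_fsetD1 (v^-1 * u)%g) ?fset1U1 //=.
rewrite /ind mulVKg eqxx mulr1 big1_seq ?addr0 // => w /andP[_].
rewrite in_fsetD1 => /andP[wu _]; case: eqP => [e|]; last by rewrite mulr0.
by case/eqP: wu; rewrite -e mulKg.
Qed.

Lemma coef_divdiffM q s z u :
  (twm (divdiff q s) z)@_u = q * (z@_u - act s z@_(s^-1 * u)%g).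
Proof.
have := Rop_ind (twm (divdiff q s) z) u 1%g; rewrite invg1 mul1g act1 => <-.
by rewrite RopM Rop_divdiff act1 !Rop_ind act1 invg1 !mul1g.
Qed.

End TwistedTheory.

(** * Triangularity of the elements attached to reduced words *)

Section WordElements.
Variables (C : fieldType) (n : nat) (A : 'M[int]_n) (D : root_datum C A).
Local Notation W := (weyl D).
Local Notation s_ := (simple_refl D).
Local Notation word := (weyl_word D).
Variables (Q : comPzRingType) (act : W -> {rmorphism Q -> Q}).
Hypothesis act1 : forall q, act 1%g q = q.
Hypothesis actM : forall v w q, act (v * w)%g q = act v (act w q).
Variable y : 'I_n -> Q.
Local Notation T := {malg Q[W]}.
Local Notation twm := (tw_mul (fun w => act w)).

Definition word_elt (s : seq 'I_n) : T :=
  foldr (fun i z => twm (divdiff act (y i) (s_ i)) z) (tw_delta Q 1%g) s.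

Definition word_lead (s : seq 'I_n) : Q := foldr (fun i c => - y i * act (s_ i) c) 1 s.

(** A generator lengthens the elements of the support by at most one, and only through its own
    reflection. *)
Lemma word_elt_coef s u : (size s <= len u)%N -> u <> word s -> (word_elt s)@_u = 0.
Proof.
elim: s u => [|i s ih] u /= su us.
  by rewrite /tw_delta mcoeffU; case: eqP us => // <-.
have z1 : (word_elt s)@_u = 0.
  apply: ih; first exact: ltnW.
  by move=> e; have := len_le D s; rewrite -e; move: su; lia.
have z2 : (word_elt s)@_(s_ i * u)%g = 0.
  apply: ih; last by move=> e; apply: us; rewrite weyl_word_cons -e mulgA simple_reflK mul1g.
  have := len_mul (s_ i) (s_ i * u)%g; rewrite mulgA simple_reflK mul1g.
  by have := len_simple D i; lia.
by rewrite (coef_divdiffM act1 actM) simple_reflV z1 z2 rmorph0 subr0 mulr0.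
Qed.

Lemma word_elt_lead s : (size s <= len (word s))%N -> (word_elt s)@_(word s) = word_lead s.
Proof.
elim: s => [|i s ih] /= su; first by rewrite /tw_delta weyl_word0 mcoeffUU.
have su' : (size s <= len (word s))%N.
  have := len_mul (s_ i) (word s); rewrite -weyl_word_cons.
  by have := len_simple D i; lia.
rewrite (coef_divdiffM act1 actM) simple_reflV weyl_word_cons mulgA simple_reflK mul1g ih //.
rewrite -weyl_word_cons word_elt_coef ?sub0r ?mulNr ?mulrN //; first exact: ltnW.
by move=> e; have := len_le D s; rewrite -e; move: su => /=; lia.
Qed.

Lemma Rop_word_elt_cons f i s v : Rop act (word_elt (i :: s)) f v =
  act v (y i) * (Rop act (word_elt s) f v - Rop act (word_elt s) f (v * s_ i)%g).
Proof. by rewrite /= RopM // Rop_divdiff. Qed.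

Lemma Rop_word_elt_nil f v : Rop act (word_elt [::]) f v = f v.
Proof. by rewrite /= Rop_delta mulg1. Qed.

Hypothesis lead_inv : forall s, invertible (word_lead s).

Definition red_elt (w : W) := word_elt (red_word w).

(** Triangularity for the length, with invertible diagonal: values on the [red_elt] determine a
    function and can be prescribed. *)
Lemma red_elt_eval f w : tw_eval f (red_elt w) =
  word_lead (red_word w) * f w +
  \sum_(u <- msupp (red_elt w) | (len u < len w)%N) (red_elt w)@_u * f u.
Proof.
have le : (msupp (red_elt w) `<=` w |` msupp (red_elt w))%fset by apply: fsubsetU1.
have -> : tw_eval f (red_elt w) =
    \sum_(u <- (w |` msupp (red_elt w))%fset) (red_elt w)@_u * f u.
  by rewrite (tw_evalE act1) (RopEw _ _ _ le); apply: eq_bigr => u _; rewrite act1 mul1g.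
rewrite (big_fsetD1 w) ?fset1U1 //=; congr (_ + _).
  have := @word_elt_lead (red_word w); rewrite red_wordK => e.
  by rewrite /red_elt -e.
rewrite [RHS]big_mkcond /= [RHS](big_fset_incl _ (fsubsetU1 w _)); last first.
  by move=> u _; rewrite -mcoeff_eq0 => /eqP ->; rewrite mul0r; case: ifP.
rewrite [RHS](big_fsetD1 w) ?fset1U1 //= ltnn add0r; apply: eq_big_seq => u.
rewrite in_fsetD1 => /andP[uw _]; case: ltnP => // lwu.
rewrite /red_elt word_elt_coef ?mul0r // red_wordK => e.
by case/eqP: uw.
Qed.

Lemma red_elt_determined f : (forall w, tw_eval f (red_elt w) = 0) -> forall w, f w = 0.
Proof.
move=> h w; have [N] := ubnP (len w); elim: N w => // N ih w; rewrite ltnS => wN.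
apply: (invertible_cancel (lead_inv (red_word w))); rewrite mulr0 -[RHS](h w) red_elt_eval.
by rewrite big1 ?addr0 // => u uw; rewrite ih ?mulr0 // (leq_trans uw).
Qed.

Lemma red_elt_dual (a : W -> Q) : exists h, forall w, tw_eval h (red_elt w) = a w.
Proof.
pose st (h : W -> Q) (w : W) := cinv (word_lead (red_word w)) *
  (a w - \sum_(u <- msupp (red_elt w) | (len u < len w)%N) (red_elt w)@_u * h u).
(* After k rounds the values at elements of length below k are final ([stab]). *)
pose hk k := iter k st (fun=> 0).
have stab k m w : (len w < k)%N -> (len w < m)%N -> hk k w = hk m w.
  elim: k m w => // k ih [//|m] w; rewrite !ltnS => wk wm.
  rewrite /hk !iterS -!/(hk _) /st; congr (_ * (_ - _)); apply: eq_bigr => u uw.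
  by congr (_ * _); apply: ih; apply: leq_trans uw _.
exists (fun w => hk (len w).+1 w) => w; rewrite red_elt_eval {1}/hk iterS -/(hk _) {1}/st.
rewrite mulrA cinvP // mul1r.
rewrite [X in _ + X](eq_bigr (fun u => (red_elt w)@_u * hk (len w) u)) ?subrK // => u uw.
by congr (_ * _); apply: stab.
Qed.

End WordElements.

(** * The dual of the formal affine Demazure algebra *)

Section DemazureDual.
Variables (R : idomainType) (charR0 : [pchar R] =i pred0) (F : fgl R).
Variables (C : fieldType) (charC0 : [pchar C] =i pred0).
Variables (n : nat) (A : 'M[int]_n) (D : root_datum C A) (L : demazure_lattice D).
Local Notation Lam := (lat L).
Local Notation S := (fga F L).
Local Notation W := (weyl D).
Local Notation x := (@xS R F C n A D L).
Local Notation al := (simple_root L).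
Local Notation s_ := (simple_refl D).
Local Notation Gx := [set fga_x F a | a in pos_roots L].
Local Notation Q := (Qx F L).
Local Notation fw w := (@fga_map R F C n A D L (@weyl_lat C n A D L w)).

Definition Qin : {rmorphism S -> Q} := @loc_in S Gx.

Lemma fw_x w l : fw w (x l) = x (weyl_lat w l). Proof. exact: fga_map_x. Qed.

Lemma fw_xM w l s : fw w (x l * s) = x (weyl_lat w l) * fw w s.
Proof. by rewrite -fw_x; apply: rmorphM. Qed.

Lemma fw1 s : fw 1%g s = s.
Proof. rewrite -[RHS]fga_map_id; apply: fga_map_ext => l; exact: weyl_lat1. Qed.

Lemma fwM v w s : fw (v * w)%g s = fw v (fw w s).
Proof. rewrite fga_map_comp; apply: fga_map_ext => l; exact: weyl_latM. Qed.

Lemma xS_nzd (l : Lam) (s : S) : l <> 0 -> x l * s = 0 -> s = 0.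
Proof. by move=> l0 /(fga_mulf_eq0 charR0)[/(xS_eq0 charR0) /l0|]. Qed.

Lemma Gx_nzd g (s : S) : Gx g -> g * s = 0 -> s = 0.
Proof.
move=> [a /pos_rootsP[ra _] <-]; apply: xS_nzd; exact: root_neq0 ra.
Qed.

Lemma Qin_inj : injective Qin.
Proof. by apply: lin_inj; apply: mulspan_nzd; exact: Gx_nzd. Qed.

(** Only positive roots are inverted by definition; for negative [l], x_l divides the unit
    x_(-l). *)
Lemma Qin_x_inv (l : Lam) : root l -> invertible (Qin (x l)).
Proof.
move=> rl; have pos m : pos_roots L m -> invertible (Qin (x m)).
  by move=> hm; apply/mulspan_inv/mulspan_gen; exists m.
case: (root_pos charC0 rl) => [/pos //|/pos]; have [b ->] := xdvd_opp F l.
by rewrite rmorphM => /invertible_dvd.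
Qed.

Lemma fw_inv w g : Gx g -> invertible (Qin (fw w g)).
Proof.
move=> [a /pos_rootsP[ra _] <-].
rewrite -[fga_x F a]/(x a) fga_map_x; apply: Qin_x_inv; exact: root_act.
Qed.

Definition Qact (w : W) : {rmorphism Q -> Q} := loc_extr (@fw_inv w).

Lemma Qact_in w s : Qact w (Qin s) = Qin (fw w s).
Proof. exact: (loc_ext_in (@fw_inv w)). Qed.

Lemma Qact1 q : Qact 1%g q = q.
Proof.
apply: (loc_hom_ext (f := Qact 1%g) (g := idfun)) => s.
by rewrite [LHS]Qact_in fw1.
Qed.

Lemma QactM v w q : Qact (v * w)%g q = Qact v (Qact w q).
Proof.
apply: (loc_hom_ext (f := Qact (v * w)%g) (g := Qact v \o Qact w)) => s.
rewrite [LHS]Qact_in; apply/esym; apply: etrans (congr1 (Qact v) (Qact_in w s)) _.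
by rewrite Qact_in fwM.
Qed.

Definition xi (l : Lam) : Q := cinv (Qin (x l)).

Lemma xiP l : root l -> Qin (x l) * xi l = 1.
Proof. by move=> rl; apply/cinvP/Qin_x_inv. Qed.

Lemma Qact_xi w l : root l -> Qact w (xi l) = xi (weyl_lat w l).
Proof.
move=> rl; apply/esym/cinvE; rewrite -(fga_map_x _ (weyl_lat w)) -Qact_in -rmorphM xiP //.
exact: rmorph1.
Qed.

Lemma root_al v i : root (weyl_lat v (al i)). Proof. by exists v, i. Qed.

Definition dem v i := divdiff Qact (xi (weyl_lat v (al i))) (refl_of v i).

Lemma Rop_dem v i f w : Rop Qact (dem v i) f w =
  xi (weyl_lat (w * v)%g (al i)) * (f w - f (w * refl_of v i)%g).
Proof.
rewrite (Rop_divdiff QactM) Qact_xi; last exact: root_al.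
by rewrite weyl_latM.
Qed.

Lemma Rop_in s f w : Rop Qact (tw_scal W (Qin s)) f w = Qin (fw w s) * f w.
Proof. by rewrite Rop_scal Qact_in. Qed.

Definition dgen : set {malg Q[W]} :=
  [set tw_scal W (Qin s) | s in setT] `|` [set z | exists w i, z = dem w i].

Definition dalg := tw_subalg (fun w => Qact w) dgen.

Lemma dalg_in s : dalg (tw_scal W (Qin s)).
Proof. by apply: TwGen; left; exists s. Qed.

Lemma dalg_dem v i : dalg (dem v i).
Proof. by apply: TwGen; right; exists v, i. Qed.

Lemma dalg_stable (Mo : set (W -> Q)) :
  (forall f g, Mo f -> Mo g -> Mo (fun w => f w - g w)) ->
  (forall s f, Mo f -> Mo (fun w => Qin (fw w s) * f w)) ->
  (forall v i f, Mo f -> Mo (fun w => xi (weyl_lat (w * v)%g (al i)) * (f w - f (w * refl_of v i)%g))) ->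
  forall z, dalg z -> forall f, Mo f -> Mo (Rop Qact z f).
Proof.
move=> hB hS hX; apply: (tw_subalg_stable QactM hB) => z f [[s _ <-]|[v [i ->]]] hf.
  have -> : Rop Qact (tw_scal W (Qin s)) f = (fun w => Qin (fw w s) * f w).
    by apply/funext => w; apply: Rop_in.
  exact: hS.
have -> : Rop Qact (dem v i) f =
  (fun w => xi (weyl_lat (w * v)%g (al i)) * (f w - f (w * refl_of v i)%g)).
  by apply/funext => w; apply: Rop_dem.
exact: hX.
Qed.

Definition ddual : set (W -> Q) := [set f | forall z, dalg z -> range Qin (tw_eval f z)].

Lemma ddual_Rop z f : dalg z -> ddual f -> ddual (Rop Qact z f).
Proof.
move=> hz hf y hy; rewrite -(tw_evalM Qact1 QactM); apply: hf; exact: TwMul.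
Qed.

Lemma ddualB f g : ddual f -> ddual g -> ddual (fun w => f w - g w).
Proof.
move=> hf hg z hz; rewrite (tw_evalE Qact1) Rop_subf -!(tw_evalE Qact1).
by have [s _ <-] := hf z hz; have [t _ <-] := hg z hz; exists (s - t); rewrite ?rmorphB.
Qed.

Lemma ddual_in s f : ddual f -> ddual (fun w => Qin (fw w s) * f w).
Proof.
move=> /(ddual_Rop (dalg_in s)); congr ddual.
by apply/funext => w; apply: Rop_in.
Qed.

Lemma ddual_dem v i f : ddual f ->
  ddual (fun w => xi (weyl_lat (w * v)%g (al i)) * (f w - f (w * refl_of v i)%g)).
Proof.
move=> /(ddual_Rop (dalg_dem v i)); congr ddual.
by apply/funext => w; apply: Rop_dem.
Qed.

(** The translate is [f] minus w(x_alpha) times its divided difference, alpha = v(alpha_i), and both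
    lie in the dual. *)
Lemma ddual_trans v i f : ddual f -> ddual (fun w => f (w * refl_of v i)%g).
Proof.
move=> hf; have := ddualB hf (ddual_in (x (weyl_lat v (al i))) (ddual_dem v i hf)).
congr ddual; apply/funext => w; rewrite fw_x -weyl_latM mulrA xiP; last exact: root_al.
by rewrite mul1r opprB addrC subrK.
Qed.

Lemma refl_of1 i : refl_of 1%g i = s_ i.
Proof. by rewrite /refl_of mul1g invg1 mulg1. Qed.

Lemma ddual_val f w : ddual f -> range Qin (f w).
Proof.
move=> hf; have [s ->] := weyl_wordP w.
have h g : ddual g -> range Qin (g 1%g).
  move=> hg; have := hg _ (TwOne _ _).
  by rewrite (tw_evalE Qact1) Rop_scal rmorph1 mul1r.
elim/last_ind: s f hf => [|s i ih] f hf; first by rewrite weyl_word0; apply: h.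
rewrite -cats1 weyl_word_cat weyl_word1 -refl_of1.
exact: (ih (fun w => f (w * refl_of 1%g i)%g) (ddual_trans 1%g i hf)).
Qed.

Lemma xdvd_refl v i w s :
  xdvd (weyl_lat (w * v)%g (al i)) (fw w s - fw (w * refl_of v i)%g s).
Proof.
have := xdvd_map charR0 (l := weyl_lat (w * v)%g (al i))
  (rho := weyl_lat (refl_of (w * v)%g i)) (fw w s) (root_neq0 (root_al _ i)).
move=> /(_ (refl_of_shift (w * v)%g i)) /xdvdN; rewrite opprB; congr (xdvd _ (_ - _)).
rewrite fga_map_comp; apply: fga_map_ext => l.
by rewrite refl_of_mul; exact: esym (weyl_latM _ _ _).
Qed.

(** The functions w |-> w(s), s in S, include 1 and are stable under the generators, since s -
    s_alpha(s) is divisible by x_alpha. *)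
Lemma ddual1 : ddual (fun=> 1).
Proof.
pose Mo : set (W -> Q) := [set f | exists s, f = (fun w => Qin (fw w s))].
move=> z hz; rewrite (tw_evalE Qact1).
suff [s ->] : Mo (Rop Qact z (fun=> 1)) by exists (fw 1%g s).
apply: (dalg_stable _ _ _ hz) => [f g [s ->] [t ->]|s f [t ->]|v i f [t ->]|].
- by exists (s - t); apply/funext => w; rewrite !rmorphB.
- by exists (s * t); apply/funext => w; rewrite !rmorphM.
- have [b hb] : xdvd (weyl_lat v (al i)) (t - fw (refl_of v i) t).
    by have := xdvd_refl v i 1%g t; rewrite !mul1g fw1.
  have e w : fw w t - fw (w * refl_of v i)%g t = x (weyl_lat w (weyl_lat v (al i))) * fw w b.
    rewrite fwM -fw_xM -hb; exact: esym (rmorphB (fw w) t _).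
  exists b; apply/funext => w; rewrite -rmorphB e.
  rewrite -weyl_latM rmorphM mulrA [_ * Qin (x _)]mulrC xiP ?mul1r //; exact: root_al.
by exists 1; apply/funext => w; rewrite !rmorph1.
Qed.

(** Finite sums of products of two elements of the dual have values in S and are stable under the
    generators, by the Leibniz rule. *)
Lemma ddualM f g : ddual f -> ddual g -> ddual (fun w => f w * g w).
Proof.
pose Mo : set (W -> Q) := [set f | exists2 r : seq ((W -> Q) * (W -> Q)),
  (forall p, p \in r -> ddual p.1 /\ ddual p.2) & f = (fun w => \sum_(p <- r) p.1 w * p.2 w)].
have Mo2 f1 f2 : ddual f1 -> ddual f2 -> Mo (fun w => f1 w * f2 w).
  move=> h1 h2; exists [:: (f1, f2)]; first by move=> p; rewrite inE => /eqP ->.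
  by apply/funext => w; rewrite big_seq1.
have Mo0 : Mo (fun=> 0).
  by exists [::] => //; apply/funext => w; rewrite big_nil.
have MoD f1 f2 : Mo f1 -> Mo f2 -> Mo (fun w => f1 w + f2 w).
  move=> [r1 h1 ->] [r2 h2 ->]; exists (r1 ++ r2).
    by move=> p; rewrite mem_cat => /orP[/h1|/h2].
  by apply/funext => w; rewrite big_cat.
have Mosum (E : (W -> Q) * (W -> Q) -> W -> Q) (r : seq ((W -> Q) * (W -> Q))) :
   (forall p, p \in r -> Mo (E p)) -> Mo (fun w => \sum_(p <- r) E p w).
  elim: r => [|p r ih] h.
    by rewrite [X in Mo X](_ : _ = (fun=> 0)) //; apply/funext => w; rewrite big_nil.
  rewrite [X in Mo X](_ : _ = (fun w => E p w + \sum_(p <- r) E p w)).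
    by apply: MoD; [apply: h; rewrite mem_head|apply: ih => q qr; apply: h;
      rewrite in_cons qr orbT].
  by apply/funext => w; rewrite big_cons.
have MoS s f1 : Mo f1 -> Mo (fun w => Qin (fw w s) * f1 w).
  move=> [r h ->]; rewrite [X in Mo X](_ : _ =
    (fun w => \sum_(p <- r) (Qin (fw w s) * p.1 w) * p.2 w)).
    apply: (Mosum (fun p w => (Qin (fw w s) * p.1 w) * p.2 w)) => p /h[h1 h2].
    by apply: Mo2 => //; apply: ddual_in.
  by apply/funext => w; rewrite mulr_sumr; apply: eq_bigr => p _; rewrite mulrA.
move=> hf hg z hz; rewrite (tw_evalE Qact1).
suff [r hr ->] : Mo (Rop Qact z (fun w => f w * g w)).
  rewrite big_seq; elim/big_ind: _ => [|a b [s _ <-] [t _ <-]|p /hr[h1 h2]].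
  - by exists 0; rewrite ?rmorph0.
  - by exists (s + t); rewrite ?rmorphD.
  have [s _ <-] := ddual_val 1%g h1; have [t _ <-] := ddual_val 1%g h2.
  by exists (s * t); rewrite ?rmorphM.
apply: (dalg_stable _ _ _ hz) => [f1 f2 h1 h2|s f1|v i f1 [r h ->]|]; last exact: Mo2.
- rewrite [X in Mo X](_ : _ = (fun w => f1 w + Qin (fw w (-1)) * f2 w)).
    by apply: MoD => //; apply: MoS.
  by apply/funext => w; rewrite !rmorphN !rmorph1 mulN1r.
- exact: MoS.
(* twisted Leibniz rule for divided differences *)
pose X f1 w := xi (weyl_lat (w * v)%g (al i)) * (f1 w - f1 (w * refl_of v i)%g).
rewrite [X in Mo X](_ : _ = (fun w => \sum_(p <- r)
    (X p.1 w * p.2 w + p.1 (w * refl_of v i)%g * X p.2 w))).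
  apply: (Mosum (fun p w => X p.1 w * p.2 w + p.1 (w * refl_of v i)%g * X p.2 w)) => p /h[h1 h2].
  apply: MoD; apply: Mo2 => //; [exact: ddual_dem|exact: ddual_trans|exact: ddual_dem].
apply/funext => w; rewrite -sumrB mulr_sumr; apply: eq_bigr => p _; rewrite /X.
move: (xi _) (p.1 w) (p.2 w) (p.1 _) (p.2 _) => a b c d e; ring.
Qed.

Definition IQ k (q : Q) := exists2 s, Iord k s & q = Qin s.

Definition dfil k : set (W -> Q) := [set f | ddual f /\ forall w, IQ k (f w)].

Lemma dfilE k f : demazure_dual_fil F L k f <-> dfil k f.
Proof.
split=> -[h1 h2]; split=> // w.
  have [s /(ideal_pow_Iord charR0) hs e] := h2 w; exists s; first exact: hs.
  exact: (esym e).
have [s hs e] := h2 w; exists s; first exact/(ideal_pow_Iord charR0).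
exact: (esym e).
Qed.

Lemma dfil_filtration : ring_filtration (demazure_dual_fil F L).
Proof.
split=> [i|i a b /dfilE[ha1 ha2] /dfilE[hb1 hb2]|i a /dfilE[ha1 ha2]||
    i j a b /dfilE[ha1 ha2] /dfilE[hb1 hb2]]; apply/dfilE; split.
- have -> : (0 : W -> Q) = (fun w => (fun=> 1) w - (fun=> 1) w) by apply/funext => w; rewrite subrr.
  exact: ddualB ddual1 ddual1.
- by move=> w; exists 0; rewrite ?rmorph0 //; apply: Iord0.
- exact: ddualB.
- move=> w; have [s hs e] := ha2 w; have [t ht e'] := hb2 w.
  exists (s - t); first exact: IordB.
  by rewrite rmorphB -e -e'.
- by [].
- by move=> w; have [s hs e] := ha2 w; exists s => //; apply: Iord_le hs.
- exact: ddual1.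
- by move=> w; exists 1; rewrite ?rmorph1 //; apply: Iord_all.
- exact: ddualM.
move=> w; have [s hs e] := ha2 w; have [t ht e'] := hb2 w.
exists (s * t); first exact: IordM.
by rewrite rmorphM -e -e'.
Qed.

(** The value of the divided difference, multiplied by some x_l with l a root, has order k + 1;
    [Iord_div] applies. *)
Lemma dfil_dem k v i f : dfil k.+1 f ->
  dfil k (fun w => xi (weyl_lat (w * v)%g (al i)) * (f w - f (w * refl_of v i)%g)).
Proof.
move=> [h1 h2]; have h3 := ddual_dem v i h1; split=> // w.
have [t _ et] := ddual_val w h3; exists t; last exact: (esym et).
have rl := root_al (w * v)%g i; apply: (Iord_div charR0 (root_neq0 rl)).
have [s hs e] := h2 w; have [s' hs' e'] := h2 (w * refl_of v i)%g.
have -> : x (weyl_lat (w * v)%g (al i)) * t = s - s'; last exact: IordB.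
by apply: Qin_inj; rewrite rmorphM rmorphB et mulrA xiP // mul1r e e'.
Qed.

End DemazureDual.

(** * Reduced words span, and the graded dual *)

#[local] Opaque xi xS.

Lemma inv_sub (B : comPzRingType) (p q c d : B) : c * p = 1 -> d * q = 1 ->
  p - q = p * q * (d - c).
Proof.
move=> e e'; transitivity (p * (d * q) - q * (c * p)); last by ring.
by rewrite e e' !mulr1.
Qed.

Lemma inv_add (B : comPzRingType) (p q c d k : B) : c * p = 1 -> d * q = 1 ->
  c + d + c * d * k = 0 -> p + q = - k.
Proof.
move=> e e' h; transitivity (p * (d * q) + q * (c * p)); first by rewrite e e' !mulr1.
transitivity (p * q * (c + d + c * d * k) - (c * p) * (d * q) * k); first by ring.
by rewrite h e e' mulr0 !mul1r add0r.
Qed.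

Section MainTheorem.
Variables (R : idomainType) (charR0 : [pchar R] =i pred0) (F : fgl R).
Variables (C : fieldType) (charC0 : [pchar C] =i pred0).
Variables (n : nat) (A : 'M[int]_n) (D : root_datum C A) (L : demazure_lattice D).
Local Notation Lam := (lat L).
Local Notation S := (fga F L).
Local Notation W := (weyl D).
Local Notation x := (@xS R F C n A D L).
Local Notation al := (simple_root L).
Local Notation s_ := (simple_refl D).
Local Notation Q := (Qx F L).
Local Notation fw w := (@fga_map R F C n A D L (@weyl_lat C n A D L w)).
Local Notation Qin := (Qin F L).
Local Notation Qact := (@Qact R F C charC0 n A D L).
Local Notation Qact1 := (@Qact1 R F C charC0 n A D L).
Local Notation QactM := (@QactM R F C charC0 n A D L).
Local Notation xi := (@xi R F C n A D L).

(** The subring S[1/x_b] of Q, with b running over the positive roots other than [a]. *)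
Definition Reg (a : Lam) (q : Q) := exists u s,
  u \in mulspan [set x b | b in [set b | pos_roots L b /\ b <> a]] /\ Qin u * q = Qin s.

Lemma Reg_in a s : Reg a (Qin s).
Proof. by exists 1, s; split; [apply: mulspan1|rewrite rmorph1 mul1r]. Qed.

Lemma RegD a p q : Reg a p -> Reg a q -> Reg a (p + q).
Proof.
move=> [u [s [hu e]]] [v [t [hv e']]]; exists (u * v), (s * v + t * u).
split; first exact: mulspanM.
have E (a' b c d : Q) : a' * b * (c + d) = a' * c * b + b * d * a' by ring.
by rewrite rmorphD !rmorphM -e -e'; exact: E.
Qed.

Lemma RegM a p q : Reg a p -> Reg a q -> Reg a (p * q).
Proof.
move=> [u [s [hu e]]] [v [t [hv e']]]; exists (u * v), (s * t).
by split; [apply: mulspanM|rewrite !rmorphM -e -e' mulrACA].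
Qed.

Lemma RegB a p q : Reg a p -> Reg a q -> Reg a (p - q).
Proof.
move=> hp hq; apply: RegD => //; rewrite -mulN1r; apply: RegM => //.
by rewrite -(rmorph1 Qin) -rmorphN; apply: Reg_in.
Qed.

Lemma pos_root_opp (l : Lam) : pos_roots L l -> pos_roots L (- l) -> False.
Proof.
move=> /pos_rootsP[rl pl] /pos_rootsP[_ nl]; apply: (root_neq0 rl).
exact: (nonneg_anti charC0).
Qed.

Lemma Reg_xi a l : root l -> l <> a -> l <> - a -> Reg a (xi l).
Proof.
move=> rl la lna.
have pos m : root m -> pos_roots L m -> m <> a -> Reg a (xi m).
  move=> rm pm ma; exists (x m), 1; split; last by rewrite rmorph1 xiP.
  by apply: mulspan_gen; exists m.
case: (root_pos charC0 rl) => [pl|pl]; first exact: pos.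
have [b hb] := xdvd_opp F l; have rn := rootN charC0 rl.
suff -> : xi l = Qin b * xi (- l).
  apply: RegM; first exact: Reg_in.
  by apply: pos => // e; apply: lna; rewrite -e opprK.
apply: cinvE; rewrite mulrA -rmorphM -hb; exact: xiP.
Qed.

(* Fractions regular along every root lie in S: the denominators x_g of       *)
(* distinct positive roots form regular sequences.                            *)
Lemma Reg_cap q : (forall a, pos_roots L a -> Reg a q) -> exists s, q = Qin s.
Proof.
move=> hq; have [s [u [/mulspanP[r rG ->] e]]] := loc_elim q.
change (Qin (\prod_(g <- r) g) * q = Qin s) in e.
elim: r rG s e => [|g r ih] rG s; first by rewrite big_nil rmorph1 mul1r => ->; exists s.
rewrite big_cons rmorphM => e.
(* The denominators x_a are removed one by one: regularity along [a] makes x_a divide [s] times a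
   product of x_c with c <> a, and these x_c are regular modulo x_a. *)
have [a pa ga] := rG g (mem_head _ _); change (x a = g) in ga; subst g.
have [ra _] := (pos_rootsP a).1 pa.
have [w [s' [/mulspanP[v vG ->] e']]] := hq a pa.
have dvd : xdvd a (\prod_(g <- v) g * s).
  exists (\prod_(g <- r) g * s'); apply: (Qin_inj charR0); rewrite !rmorphM -e -e'.
  by have E (a' b c d : Q) : a' * (b * c * d) = b * (c * (a' * d)); [ring|apply: E].
have {dvd} [b eb] : xdvd a s.
  elim: v vG dvd {e'} => [|g v ihv] vG; first by rewrite big_nil mul1r.
  rewrite big_cons -mulrA; have [c [pc ca] gc] := vG g (mem_head _ _).
  change (x c = g) in gc; subst g => h; apply: ihv.
    by move=> g gv; apply: vG; rewrite in_cons gv orbT.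
  have [co co1] := root_dual ra; apply: (xdvd_regular charR0 co1 _ h) => ec.
  have [rc _] := (pos_rootsP c).1 pc.
  case: (root_colinear rc ra ec) => // e2; apply: (pos_root_opp pa).
  by rewrite -e2.
apply: (ih _ b) => [g gr|]; first by apply: rG; rewrite in_cons gr orbT.
apply: (invertible_cancel (Qin_x_inv F charC0 ra)).
by rewrite mulrA e eb rmorphM.
Qed.

(** * Congruences along one root *)

Section OneRoot.
Variables (v0 : W) (i0 : 'I_n).
Local Notation a := (weyl_lat v0 (al i0)).
Local Notation r := (refl_of v0 i0).

(** The congruence of a GKM description for the single root [a], over the ring in which the x_b of
    the other positive roots are inverted. *)
Definition local_gkm : set (W -> Q) := [set f | (forall w, Reg a (f w)) /\
  forall w, exists2 q, Reg a q & f w - f (r * w)%g = Qin (x a) * q].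

Let ra : root a. Proof. exact: root_al. Qed.

Lemma weyl_lat_opp w (l : Lam) : weyl_lat w (- l) = - weyl_lat w l.
Proof. exact: raddfN. Qed.

Lemma fw_refl_dvd w s : exists b, fw w s - fw (r * w)%g s = x a * b.
Proof.
have [b hb] := xdvdN (xdvd_map charR0 (fw w s) (root_neq0 ra) (refl_of_shift v0 i0)).
by exists b; rewrite -hb opprB fwM.
Qed.

Lemma xi_sub (l m : Lam) : root l -> root m ->
  xi l - xi m = xi l * xi m * (Qin (x m) - Qin (x l)).
Proof.
move=> rl rm; exact: (inv_sub (xiP F charC0 rl) (xiP F charC0 rm)).
Qed.

(** Divide x_l + x_(-l) + x_l x_(-l) h = 0 by x_l x_(-l). *)
Lemma xi_opp (l : Lam) : root l -> exists h, xi l + xi (- l) = Qin h.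
Proof.
move=> rl; have [h e] := xS_opp F l; exists (- h).
rewrite rmorphN; apply: (inv_add (xiP F charC0 rl) (xiP F charC0 (rootN charC0 rl))).
by have := congr1 Qin e; rewrite !rmorphD !rmorphM rmorph0.
Qed.

(** If the root g w = w v alpha_i is [a] or its opposite, then w t = r w: the congruence of [f]
    permits the division, and [xi_opp] gives the new congruence. Otherwise 1/x_(g w) is regular
    along [a] and congruent modulo x_a to 1/x_(g (r w)). *)
Lemma local_gkm_dem v i f : local_gkm f ->
  local_gkm (fun w => xi (weyl_lat (w * v)%g (al i)) * (f w - f (w * refl_of v i)%g)).
Proof.
move=> [f1 f2]; set t := refl_of v i.
pose g l := weyl_lat (l * v)%g (al i) : Lam.
have rg l : root (g l) by apply: root_al.
have gr w : g (r * w)%g = weyl_lat r (g w).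
  exact: etrans (congr1 (fun u => weyl_lat u (al i)) (esym (mulgA _ _ _))) (weyl_latM _ _ _).
have ar : weyl_lat r a = - a by apply: act_refl_of.
have rr (l : Lam) : weyl_lat r (weyl_lat r l) = l by rewrite -weyl_latM refl_ofK weyl_lat1.
have tE w : g w = a \/ g w = - a -> (w * t = r * w)%g.
  by move=> e; rewrite refl_of_mul; congr (_ * _)%g; apply: (refl_of_uniq charC0) e.
have opp w : g w = a \/ g w = - a -> g (r * w)%g = - g w.
  by rewrite gr => -[->|->]; rewrite ?weyl_lat_opp ar.
split=> w; have [h|h] := pselect (g w = a \/ g w = - a).
- rewrite -/(g w) tE //; have [q hq ->] := f2 w.
  have [b hb] : exists b, xi (g w) * Qin (x a) = Qin b.
    case: h => [->|e]; first by exists 1; rewrite mulrC xiP // rmorph1.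
    have [b hb] := xdvd_opp F (g w); rewrite -[a]opprK -e hb.
    by exists b; rewrite rmorphM mulrA [xi _ * _]mulrC xiP // mul1r.
  by rewrite mulrA hb; apply: RegM => //; apply: Reg_in.
- apply: RegM; last exact: RegB.
  by apply: Reg_xi; [apply: rg| |] => e; apply: h; [left|right].
- have rwt : (r * w * t)%g = w.
    by apply: etrans (esym (mulgA r w t)) _; rewrite (tE _ h) mulgA refl_ofK mul1g.
  rewrite -/(g w) -/(g (r * w)%g) (opp _ h) (tE _ h) rwt.
  have [q hq e] := f2 w; have [c hc] := xi_opp (rg w).
  exists (Qin c * q); first by apply: RegM => //; apply: Reg_in.
  have E (p p' y y' : Q) : p * (y - y') - p' * (y' - y) = (p + p') * (y - y') by ring.
  by rewrite [LHS]E hc e mulrCA.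
have h' : ~ (g (r * w)%g = a \/ g (r * w)%g = - a).
  rewrite gr => e; apply: h; rewrite -(rr (g w)).
  by case: e => ->; rewrite ?weyl_lat_opp ar ?opprK; [right|left].
rewrite -/(g w) -/(g (r * w)%g).
have [q1 hq1 e1] := f2 w; have [q2 hq2 e2] := f2 (w * t)%g.
have [b hb] : exists b, x (g (r * w)%g) - x (g w) = x a * b.
  have [b hb] := xdvd_map charR0 (x (g w)) (root_neq0 ra) (refl_of_shift v0 i0).
  by exists b; rewrite -hb fw_x gr.
have Rxi u : ~ (g u = a \/ g u = - a) -> Reg a (xi (g u)).
  by move=> hu; apply: Reg_xi; [apply: rg| |] => e; apply: hu; [left|right].
exists (xi (g w) * (q1 - q2)
  + xi (g w) * xi (g (r * w)%g) * Qin b * (f (r * w)%g - f (r * w * t)%g)).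
  apply: RegD; first by apply: RegM; [apply: Rxi|apply: RegB].
  apply: RegM; last exact: RegB.
  by apply: RegM; [apply: RegM; apply: Rxi|apply: Reg_in].
have -> : xi (g w) * (f w - f (w * t)%g) - xi (g (r * w)%g) * (f (r * w)%g - f (r * w * t)%g) =
  xi (g w) * ((f w - f (r * w)%g) - (f (w * t)%g - f (r * (w * t))%g)) +
  (xi (g w) - xi (g (r * w)%g)) * (f (r * w)%g - f (r * w * t)%g).
  rewrite [(r * (w * t))%g]mulgA mulrBl addrA -mulrDr; congr (xi _ * _ - _).
  by rewrite sub_sub_sub subrK.
rewrite e1 e2 xi_sub // -rmorphB hb rmorphM -mulrBr.
have E (p p' X d B y : Q) : p * (X * d) + p * p' * (X * B) * y =
  X * (p * d + p * p' * B * y) by ring.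
exact: E.
Qed.

Lemma local_gkmB f h : local_gkm f -> local_gkm h -> local_gkm (fun w => f w - h w).
Proof.
move=> [f1 f2] [h1 h2]; split=> w; first exact: (RegB (f1 w) (h1 w)).
have [q hq e] := f2 w; have [q' hq' e'] := h2 w.
by exists (q - q'); [apply: RegB|rewrite sub_sub_sub e e' mulrBr].
Qed.

Lemma local_gkm_in s f : local_gkm f -> local_gkm (fun w => Qin (fw w s) * f w).
Proof.
move=> [f1 f2]; split=> w; first by apply: RegM => //; apply: Reg_in.
have [q hq e] := f2 w; have [b hb] := fw_refl_dvd w s.
exists (Qin (fw w s) * q + f (r * w)%g * Qin b).
  by apply: RegD; apply: RegM => //; apply: Reg_in.
by rewrite mul_sub_mul e -rmorphB hb rmorphM mulrDr [X in X + _]mulrCA [X in _ + X]mulrCA.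
Qed.

Lemma local_gkm_eval f z : local_gkm f -> dalg charC0 z -> Reg a (tw_eval f z).
Proof.
move=> hf hz; rewrite (tw_evalE Qact1).
by have [h _] := dalg_stable local_gkmB local_gkm_in local_gkm_dem hz hf.
Qed.

End OneRoot.

(** Up to sign, the product of the x_b over the roots b at which the letters of the word turn (for a
    reduced word of w: b > 0 and w^-1 b < 0). It inverts the leading coefficient. *)
Definition bprod (s : seq 'I_n) : S := foldr (fun i c => - x (al i) * fw (s_ i) c) 1 s.

Local Notation wlead := (word_lead Qact (fun i => xi (al i))).

Lemma bprod_lead s : Qin (bprod s) * wlead s = 1.
Proof.
elim: s => [|i s ih] /=; first by rewrite rmorph1 mulr1.
have E (a b c d : Q) : - a * b * (- c * d) = a * c * (b * d) by ring.
rewrite rmorphM rmorphN [LHS]E (xiP F charC0); last exact: root_simple.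
by rewrite mul1r; have := congr1 (Qact (s_ i)) ih; rewrite rmorphM rmorph1 Qact_in.
Qed.

Lemma wlead_inv s : invertible (wlead s).
Proof. by exists (Qin (bprod s)); rewrite mulrC bprod_lead. Qed.

Lemma bprod_dvd s1 i s2 : xdvd (weyl_lat (weyl_word D s1) (al i)) (bprod (s1 ++ i :: s2)).
Proof.
elim: s1 => [|j s1 [b hb]] /=.
  by exists (- fw (s_ i) (bprod s2)); rewrite weyl_word0 weyl_lat1 mulrN mulNr.
rewrite hb fw_xM; apply: xdvdMl; rewrite weyl_word_cons weyl_latM.
by exists (fw (s_ j) b).
Qed.

Lemma tw_eval_ind w (z : {malg Q[W]}) : tw_eval (ind Q w) z = z@_w.
Proof. by rewrite (tw_evalE Qact1) Rop_ind Qact1 invg1 mul1g. Qed.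

Lemma tw_eval_scal q f (z : {malg Q[W]}) : tw_eval (fun w => q * f w) z = q * tw_eval f z.
Proof. by rewrite /tw_eval mulr_sumr; apply: eq_bigr => w _; rewrite mulrCA. Qed.

Lemma tw_eval_add f g (z : {malg Q[W]}) : tw_eval (fun w => f w + g w) z =
  tw_eval f z + tw_eval g z.
Proof. by rewrite /tw_eval -big_split; apply: eq_bigr => w _; rewrite mulrDr. Qed.

(** Tested along each positive root [a] by [Reg_cap]; the coefficient at [w] is the value of the
    indicator of [w] on [z]. If w^-1 a > 0, then s_a w is longer than [w], so the indicator of the
    pair w, s_a w gives the same value, and it satisfies the congruence along [a]. If w^-1 a < 0,
    then x_a divides [bprod], and x_a times the indicator of [w] satisfies it. *)
Lemma dalg_lead z w : dalg charC0 z -> (forall u, (len w < len u)%N -> z@_u = 0) ->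
  exists s, Qin (bprod (red_word w)) * z@_w = Qin s.
Proof.
move=> hz hw; suff [s e] : exists s, Qin (bprod (red_word w)) * z@_w = Qin s by exists s.
apply: Reg_cap => b pb; have [[v [i ea]] nb] := (pos_rootsP b).1 pb; subst b.
set a := weyl_lat v (al i) in nb *; set r := refl_of v i.
have ind_r u : ind Q w (r * u)%g = ind Q (r * w)%g u.
  rewrite /ind; congr (_%:R); congr nat_of_bool; apply/eqP/eqP => [<-|->].
    by rewrite mulgA refl_ofK mul1g.
  by rewrite mulgA refl_ofK mul1g.
have Reg_ind u u' : Reg a (ind Q u u').
  rewrite /ind; case: (u' == u).
    by have := Reg_in a 1; rewrite rmorph1.
  by have := Reg_in a 0; rewrite rmorph0.
case: (root_sign charC0 (root_act w^-1%g (root_al L v i))) => sg.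
  have lt := refl_len_gt charC0 nb sg.
  apply: RegM; first exact: Reg_in.
  have -> : z@_w = tw_eval (fun u => ind Q w u + ind Q (r * w)%g u) z.
    rewrite tw_eval_add tw_eval_ind [X in _ + X]tw_eval_ind (hw _ lt).
    by rewrite addr0.
  apply: local_gkm_eval hz; split=> u; first by apply: RegD; exact: Reg_ind.
  exists 0; first by have := Reg_in a 0; rewrite rmorph0.
  rewrite mulr0 -!ind_r mulgA refl_ofK mul1g [X in _ - X]addrC subrr //.
have nb' := sg; rewrite -{1}[w]red_wordK in nb'.
have [s1 [j [s2 [ew ea]]]] := neg_word charC0 (root_al L v i) nb nb'.
have [b hb] := bprod_dvd s1 j s2; rewrite -ew -ea in hb.
rewrite hb rmorphM mulrAC mulrC; apply: RegM; first exact: Reg_in.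
rewrite -tw_eval_ind -tw_eval_scal.
apply: local_gkm_eval => //; split=> u; first by apply: RegM => //; apply: Reg_in.
exists (ind Q w u - ind Q w (r * u)%g); first exact: RegB.
by rewrite mulrBr.
Qed.

Lemma coef_scalM q (z : {malg Q[W]}) u :
  (tw_mul (fun w => Qact w) (tw_scal W q) z)@_u = q * z@_u.
Proof. by rewrite -tw_eval_ind (tw_evalM Qact1 QactM)
  (tw_evalE Qact1) Rop_scal Qact1 -(tw_evalE Qact1) tw_eval_ind. Qed.

Lemma tw_eval_scalM q h (z : {malg Q[W]}) :
  tw_eval h (tw_mul (fun w => Qact w) (tw_scal W q) z) = q * tw_eval h z.
Proof. by rewrite (tw_evalM Qact1 QactM) (tw_evalE Qact1) Rop_scal Qact1 -(tw_evalE Qact1). Qed.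

Local Notation welt := (word_elt Qact (fun i => xi (al i))).
Local Notation relt := (red_elt Qact (fun i => xi (al i))).

Lemma dalg_word s : dalg charC0 (welt s).
Proof.
elim: s => [|i s ih] /=; first exact: TwOne.
apply: TwMul => //; have := dalg_dem F charC0 L 1%g i.
by rewrite /dem weyl_lat1 refl_of1.
Qed.

Lemma IQ0 k : IQ k (0 : Q).
Proof. by exists 0; rewrite ?rmorph0 //; apply: Iord0. Qed.
Lemma IQD k (p q : Q) : IQ k p -> IQ k q -> IQ k (p + q).
Proof. by move=> [s hs ->] [t ht ->]; exists (s + t); rewrite ?rmorphD //; apply: IordD. Qed.
Lemma IQB k (p q : Q) : IQ k p -> IQ k q -> IQ k (p - q).
Proof. by move=> [s hs ->] [t ht ->]; exists (s - t); rewrite ?rmorphB //; apply: IordB. Qed.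
Lemma IQM k l (p q : Q) : IQ k p -> IQ l q -> IQ (k + l) (p * q).
Proof. by move=> [s hs ->] [t ht ->]; exists (s * t); rewrite ?rmorphM //; apply: IordM. Qed.
Lemma IQ_in s : IQ 0 (Qin s : Q).
Proof. by exists s => //; apply: Iord_all. Qed.
Lemma IQ_le k l (p : Q) : (l <= k)%N -> IQ k p -> IQ l p.
Proof. by move=> lk [s hs ->]; exists s => //; apply: Iord_le hs. Qed.

(* The elements of reduced words span the Demazure algebra over S.            *)
Lemma dalg_eval k (h : W -> Q) : (forall v, IQ (k - len v) (tw_eval h (relt v))) ->
  forall m z, dalg charC0 z -> (forall u, (m <= len u)%N -> z@_u = 0) ->
  IQ (k - m.-1) (tw_eval h z).
Proof.
move=> hh; elim=> [|m ih] z hz z0.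
  rewrite /tw_eval big1 ?IQ0 //; first exact: IQ0.
  by move=> u _; rewrite z0 // mul0r.
have /choice[c hc] w : exists s, len w = m -> Qin s = Qin (bprod (red_word w)) * z@_w.
  have [lw|] := pselect (len w = m); last by exists 0.
  have [|s e] := dalg_lead (w := w) hz; last by exists s.
  by move=> u; rewrite lw; apply: z0.
(* [T] has the coefficients of [z] in the top length m; the induction applies to z - T. *)
pose T := \sum_(w <- msupp z | len w == m)
  tw_mul (fun w => Qact w) (tw_scal W (Qin (c w))) (relt w).
have dsum (I : eqType) (rr : seq I) (pp : pred I) (E : I -> {malg Q[W]}) :
  (forall j, dalg charC0 (E j)) -> dalg charC0 (\sum_(j <- rr | pp j) E j).
  move=> hE; have d0 : dalg charC0 (0 : {malg Q[W]}).
    by rewrite -(subrr (tw_scal W 1)); apply: TwSub; apply: TwOne.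
  apply: (big_ind (fun y => dalg charC0 y)) => // y y' hy hy'.
  by rewrite -[y']opprK; apply: TwSub => //; rewrite -[- y']sub0r; apply: TwSub.
have hT : dalg charC0 T.
  by apply: dsum => w; apply: TwMul; [apply: dalg_in|apply: dalg_word].
have zT u : (m <= len u)%N -> (z - T)@_u = 0.
  rewrite leq_eqVlt mcoeffB raddf_sum => /orP[/eqP mu|mu]; last first.
    rewrite z0 // sub0r big1 ?oppr0 // => w /eqP lw; rewrite [LHS]coef_scalM.
    rewrite /red_elt (word_elt_coef Qact1 QactM) ?mulr0 //; first by rewrite -/(len w) lw ltnW.
    by rewrite red_wordK => e; move: mu; rewrite e lw ltnn.
  have lead_u : Qin (c u) * (relt u)@_u = z@_u.
    have := word_elt_lead Qact1 QactM (fun i => xi (al i)) (s := red_word u).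
    rewrite red_wordK => /(_ (leqnn _)) E; rewrite /red_elt E hc //.
    by rewrite mulrAC bprod_lead mul1r.
  have off w : w != u -> len w == m -> (relt w)@_u = 0.
    move=> /eqP wu /eqP lw; rewrite /red_elt (word_elt_coef Qact1 QactM) //.
      by rewrite -/(len w) lw mu.
    by rewrite red_wordK => e; apply: wu.
  apply/eqP; rewrite subr_eq0; apply/eqP.
  have [us|us] := boolP (u \in msupp z).
    rewrite big_mkcond (big_fsetD1 u us) /= -mu eqxx [X in X + _]coef_scalM lead_u.
    rewrite big_seq big1 ?addr0 // => w.
    by rewrite in_fsetD1 => /andP[wu _]; case: ifP => // lw; rewrite [LHS]coef_scalM off ?mulr0.
  rewrite mcoeff_outdom // big_seq_cond big1 // => w /andP[ws lw]; rewrite [LHS]coef_scalM.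
  by rewrite off ?mulr0 //; apply/eqP => e; move: us; rewrite -e ws.
have -> : tw_eval h z = tw_eval h (z - T) + tw_eval h T.
  by rewrite (tw_evalB Qact1) subrK.
apply: IQD.
  by apply: IQ_le (ih _ _ zT); [case: (m) => //= m'; lia|apply: TwSub].
rewrite /T (tw_evalE Qact1).
have -> : Rop Qact T h 1%g = \sum_(w <- msupp z | len w == m) Qin (c w) * tw_eval h (relt w).
  rewrite /T -big_filter Rop_sum big_filter; apply: eq_bigr => w _.
  by rewrite -(tw_evalE Qact1) tw_eval_scalM.
apply: (big_ind (IQ (k - m))) => [|p q|w /eqP lw]; [exact: IQ0|exact: IQD|].
by rewrite -lw; exact: (IQM (IQ_in (c w)) (hh w)).
Qed.

(** Integrality on the Demazure algebra is [dalg_eval]; the order of the values at the delta_w is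
    obtained separately, by translation. *)
Lemma dual_lift k (h : W -> Q) : (forall v, IQ (k - len v) (tw_eval h (relt v))) ->
  dfil charC0 k h.
Proof.
move=> hh; split.
  move=> z hz; pose m := (\max_(u <- msupp z) (len u).+1)%N.
  have [|s hs ->] := dalg_eval hh (m := m) hz; last by exists s.
  move=> u mu; apply/eqP; rewrite mcoeff_eq0; apply/negP => us.
  have := mu; rewrite /m (big_fsetD1 u) //= geq_max ltnn //.
(* All words at once: translating by s_j brings in the word j :: s, which costs one order, and a
   factor x_l, which restores it. *)
have P s u : IQ (k - size s) (Rop Qact (welt s) h u).
  have [q ->] := weyl_wordP u; elim/last_ind: q s => [|q j ih] s.
    rewrite weyl_word0 -(tw_evalE Qact1).
    apply: (dalg_eval hh (m := (size s).+1)); first exact: dalg_word.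
    move=> w sw; apply: (word_elt_coef Qact1 QactM); first exact: ltnW.
    by move=> e; have := len_le D s; rewrite -e; lia.
  rewrite -cats1 weyl_word_cat weyl_word1.
  have rl := root_al L (weyl_word D q) j.
  have -> : Rop Qact (welt s) h (weyl_word D q * s_ j)%g =
    Rop Qact (welt s) h (weyl_word D q) -
    Qin (x (weyl_lat (weyl_word D q) (al j))) * Rop Qact (welt (j :: s)) h (weyl_word D q).
    rewrite (Rop_word_elt_cons QactM) Qact_xi; last exact: root_simple.
    by rewrite mulrA xiP // mul1r opprB addrC subrK.
  apply: IQB => //; have := ih (j :: s) => /= h1.
  apply: (@IQ_le (1 + (k - (size s).+1))); first lia.
  by apply: IQM h1; exists (x (weyl_lat (weyl_word D q) (al j))) => //; apply: Iord_x.
by move=> w; have := P [::] w; rewrite subn0 Rop_word_elt_nil.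
Qed.

(** * The nil affine Hecke side and symbols of divided differences *)

Local Notation Sym := (sym R L).
Local Notation Ga := [set sym_x R a | a in pos_roots L].
Local Notation smap w := (@sym_map R C n A D L (@weyl_lat C n A D L w)).

Definition Qain : {rmorphism Sym -> Qa R L} := @loc_in Sym Ga.

Lemma Qain_inj : injective Qain.
Proof.
apply: lin_inj; apply: mulspan_nzd => g p [a /pos_rootsP[ra _] <-].
by move=> /(sym_mulf_eq0 charR0 F)[/(xSym_eq0 charR0)/(root_neq0 ra)|].
Qed.

Lemma Qain_x_inv (l : Lam) : root l -> invertible (Qain (xSym R l)).
Proof.
move=> rl; have pos m : pos_roots L m -> invertible (Qain (xSym R m)).
  by move=> hm; apply/mulspan_inv/mulspan_gen; exists m.
case: (root_pos charC0 rl) => [/pos //|/pos [y hy]].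
exists (- y); rewrite mulrN -mulNr -rmorphN -raddfN; exact: hy.
Qed.

Lemma smap1 p : smap 1%g p = p.
Proof. rewrite -[RHS]sym_map_id; apply: sym_map_ext => l; exact: weyl_lat1. Qed.

Lemma smapM v w p : smap (v * w)%g p = smap v (smap w p).
Proof. rewrite sym_map_comp; apply: sym_map_ext => l; exact: weyl_latM. Qed.

Lemma smap_inv w g : Ga g -> invertible (Qain (smap w g)).
Proof.
move=> [a /pos_rootsP[ra _] <-].
rewrite -[sym_x R a]/(xSym R a) sym_map_x; apply: Qain_x_inv; exact: root_act.
Qed.

Definition Qaact (w : W) : {rmorphism Qa R L -> Qa R L} := loc_extr (@smap_inv w).

Lemma Qa_actE : @Qa_act R C n A D L = (fun w => Qaact w).
Proof.
apply/funext => w; congr (loc_ext _).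
Qed.

Lemma Qaact_in w p : Qaact w (Qain p) = Qain (smap w p).
Proof. exact: (loc_ext_in (@smap_inv w)). Qed.

Lemma Qaact1 q : Qaact 1%g q = q.
Proof.
apply: (loc_hom_ext (f := Qaact 1%g) (g := idfun)) => p.
by rewrite [LHS]Qaact_in smap1.
Qed.

Lemma QaactM v w q : Qaact (v * w)%g q = Qaact v (Qaact w q).
Proof.
apply: (loc_hom_ext (f := Qaact (v * w)%g) (g := Qaact v \o Qaact w)) => p.
rewrite [LHS]Qaact_in; apply/esym; apply: etrans (congr1 (Qaact v) (Qaact_in w p)) _.
by rewrite Qaact_in smapM.
Qed.

Definition eta (l : Lam) : Qa R L := cinv (Qain (xSym R l)).

Lemma etaP l : root l -> Qain (xSym R l) * eta l = 1.
Proof. by move=> rl; apply/cinvP/Qain_x_inv. Qed.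

Lemma Qaact_eta w l : root l -> Qaact w (eta l) = eta (weyl_lat w l).
Proof.
move=> rl; apply/esym/cinvE; rewrite -(sym_map_x _ (weyl_lat w)) -Qaact_in -rmorphM etaP //.
exact: rmorph1.
Qed.

Local Notation nwelt := (word_elt Qaact (fun i => - eta (al i))).
Local Notation nlead := (word_lead Qaact (fun i => - eta (al i))).

Lemma nil_eltE w : nil_elt R L w = red_elt Qaact (fun i => - eta (al i)) w.
Proof.
rewrite /nil_elt /red_elt /word_elt Qa_actE; congr (foldr _ _ _).
Qed.

Definition nalg := tw_subalg (fun w => Qaact w)
  ([set tw_scal W (Qain p) | p in setT] `|`
   [set divdiff Qaact (- eta (al i)) (s_ i) | i in setT]).

Lemma nalgE : nil_hecke R L = nalg.
Proof.
rewrite /nil_hecke /nalg Qa_actE; congr (tw_subalg _ (_ `|` _)).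
Qed.

Lemma nalg_elt w : nalg (nil_elt R L w).
Proof.
rewrite nil_eltE /red_elt; elim: (red_word w) => [|i s ih] /=; first exact: TwOne.
by apply: TwMul => //; apply: TwGen; right; exists i.
Qed.

Lemma nlead_inv s : invertible (nlead s).
Proof.
elim: s => [|i s [b hb]] /=; first by exists 1; rewrite mulr1.
exists (Qain (xSym R (al i)) * Qaact (s_ i) b).
rewrite opprK mulrACA [eta _ * _]mulrC etaP; last exact: root_simple.
by rewrite mul1r -rmorphM hb rmorph1.
Qed.

Lemma Rop_nil_scal p f w : Rop Qaact (tw_scal W (Qain p)) f w = Qain (smap w p) * f w.
Proof. by rewrite Rop_scal Qaact_in. Qed.

(** S embeds in Q, so that the choice made in [phi_deg] is forced. *)
Lemma phi_degE k (f : W -> Q) w s : f w = Qin s -> phi_deg F L k f w = Qain (symbol k s).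
Proof.
move=> e; have : exists2 s', f w = Qin s' & phi_deg F L k f w = Qain (symbol k s').
  apply: (xgetPex 0 (P := [set q | exists2 s, f w = Qx_in s & q = Qa_in (symbol k s)])).
  by exists (Qain (symbol k s)), s.
by move=> [s' e' ->]; rewrite (Qin_inj charR0 (etrans (esym e) e')).
Qed.

Lemma phi_degB k (f g : W -> Q) w : dfil charC0 k f -> dfil charC0 k g ->
  phi_deg F L k (f - g) w = phi_deg F L k f w - phi_deg F L k g w.
Proof.
move=> [_ hf] [_ hg]; have [s hs e] := hf w; have [t ht e'] := hg w.
rewrite (phi_degE k e) (phi_degE k e') -rmorphB -(symbolB charR0 hs ht).
by apply: phi_degE; rewrite rmorphB -e -e'.
Qed.

Lemma phi_degM i j (f g : W -> Q) w : dfil charC0 i f -> dfil charC0 j g ->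
  phi_deg F L (i + j) (f * g) w = phi_deg F L i f w * phi_deg F L j g w.
Proof.
move=> [_ hf] [_ hg]; have [s hs e] := hf w; have [t ht e'] := hg w.
rewrite (phi_degE i e) (phi_degE j e') -rmorphM -(symbolM charR0 hs ht).
by apply: phi_degE; rewrite rmorphM -e -e'.
Qed.

Lemma phi_deg1 w : phi_deg F L 0 1 w = 1.
Proof.
by rewrite (@phi_degE 0 1 w 1) ?rmorph1 // (symbol1 charR0) rmorph1.
Qed.

Lemma phi_deg_eq0 k (f : W -> Q) w : dfil charC0 k.+1 f -> phi_deg F L k f w = 0.
Proof.
move=> [_ hf]; have [s hs e] := hf w; rewrite (phi_degE k e).
have hk : Iord k s by apply: Iord_le hs.
by rewrite ((symbol_eq0 charR0 hk).2 hs) rmorph0.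
Qed.

Lemma symbolN k (s : S) : Iord k s -> symbol k (- s) = - symbol k s.
Proof.
move=> hs; rewrite -[- s]sub0r (symbolB charR0 _ hs); last exact: Iord0.
by rewrite ((symbol_eq0 charR0 (Iord0 F L k)).2 (Iord0 F L k.+1)) sub0r.
Qed.

(** Demazure elements and nil Hecke generators have opposite signs, hence one sign for each
    letter. *)
Definition sdem s (f : W -> Q) : W -> Q := fun w => (-1) ^+ size s * Rop Qact (welt s) f w.

Lemma sdem_cons i s f w : sdem (i :: s) f w =
  - (xi (weyl_lat w (al i)) * (sdem s f w - sdem s f (w * s_ i)%g)).
Proof.
rewrite /sdem (Rop_word_elt_cons QactM) Qact_xi; last exact: root_simple.
by rewrite exprS -mulrA mulN1r -mulrBr; congr (- _); exact: mulrCA.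
Qed.

Lemma dfil_opp k (f : W -> Q) : dfil charC0 k f -> dfil charC0 k (fun w => - f w).
Proof.
move=> [h1 h2]; split.
  have -> : (fun w => - f w) = (fun w => (f w - f w) - f w).
    by apply/funext => w; rewrite subrr sub0r.
  exact: ddualB (ddualB h1 h1) h1.
by move=> w; have [s hs ->] := h2 w; exists (- s); rewrite ?rmorphN //; apply: IordN.
Qed.

Lemma dfil_ext k (f g : W -> Q) : f =1 g -> dfil charC0 k f -> dfil charC0 k g.
Proof. by move=> /funext ->. Qed.

Lemma dfil_simple k i (f : W -> Q) : dfil charC0 k.+1 f ->
  dfil charC0 k (fun w => xi (weyl_lat w (al i)) * (f w - f (w * s_ i)%g)).
Proof.
move=> hf; apply: (dfil_ext _ (dfil_dem charR0 1%g i hf)) => w.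
by rewrite mulg1 refl_of1.
Qed.

Lemma dfil_sdem s f k : dfil charC0 (size s + k) f -> dfil charC0 k (sdem s f).
Proof.
elim: s k => [|i s ih] k h.
  by congr (dfil charC0 k): h; apply/funext => w; rewrite /sdem mul1r Rop_word_elt_nil.
have h1 : dfil charC0 k.+1 (sdem s f) by apply: ih; rewrite addnS.
by apply: (dfil_ext _ (dfil_opp (dfil_simple i h1))) => w; rewrite sdem_cons.
Qed.

(** Write f(w) - f(w s_i) = x_(w alpha_i) t. Its symbol is w(alpha_i) times the symbol of t, and the
    nil Hecke generator divides by -w(alpha_i). *)
Lemma phi_dem k i f w : dfil charC0 k.+1 f ->
  Rop Qaact (divdiff Qaact (- eta (al i)) (s_ i)) (phi_deg F L k.+1 f) w =
  phi_deg F L k (fun w => - (xi (weyl_lat w (al i)) * (f w - f (w * s_ i)%g))) w.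
Proof.
move=> hf; have := dfil_simple i hf => -[_ /(_ w)[t ht et]].
have [s hs e] := hf.2 w; have [s' hs' e'] := hf.2 (w * s_ i)%g.
have rl := root_al L w i.
have es : s - s' = x (weyl_lat w (al i)) * t.
  by apply: (Qin_inj charR0); rewrite rmorphM rmorphB -et mulrA xiP // mul1r e e'.
rewrite (Rop_divdiff QaactM) rmorphN Qaact_eta; last exact: root_simple.
rewrite (phi_degE _ e) (phi_degE _ e') -rmorphB -(symbolB charR0 hs hs') es.
rewrite -add1n (symbolM charR0 (Iord_x F _) ht) (symbol_x charR0) rmorphM mulNr mulrA.
rewrite [eta _ * _]mulrC etaP // mul1r -rmorphN -(symbolN ht).
by apply/esym/phi_degE; rewrite rmorphN -et.
Qed.

(** f(w) - f(w s_i) is a multiple of x_(w alpha_i), hence has symbol 0 in degree 0. *)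
Lemma phi_dem0 i f w : dfil charC0 0 f ->
  Rop Qaact (divdiff Qaact (- eta (al i)) (s_ i)) (phi_deg F L 0 f) w = 0.
Proof.
move=> hf; have := ddual_dem 1%g i hf.1; rewrite refl_of1 => h; have := ddual_val w h.
rewrite mulg1 => -[t _ et].
have [s hs e] := hf.2 w; have [s' hs' e'] := hf.2 (w * s_ i)%g.
have rl := root_al L w i.
have es : s - s' = x (weyl_lat w (al i)) * t.
  by apply: (Qin_inj charR0); rewrite rmorphM rmorphB et mulrA xiP // mul1r e e'.
rewrite (Rop_divdiff QaactM) (phi_degE _ e) (phi_degE _ e') -rmorphB -(symbolB charR0 hs hs') es.
have h1 : Iord 1 (x (weyl_lat w (al i)) * t).
  by rewrite -[1%N]addn0; apply: IordM; [apply: Iord_x|apply: Iord_all].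
by rewrite ((symbol_eq0 charR0 (Iord_all _)).2 h1) rmorph0 mulr0.
Qed.

Lemma phi_word s k f : dfil charC0 (size s + k) f ->
  Rop Qaact (nwelt s) (phi_deg F L (size s + k) f) = phi_deg F L k (sdem s f).
Proof.
elim: s k => [|i s ih] k h; apply/funext => w.
  rewrite Rop_word_elt_nil; congr phi_deg.
  by apply/funext => v; rewrite /sdem mul1r Rop_word_elt_nil.
rewrite (RopM QaactM) /= addSn -addnS ih; last by rewrite addnS.
rewrite phi_dem; last by apply: dfil_sdem; rewrite addnS.
by congr phi_deg; apply/funext => v; rewrite sdem_cons.
Qed.

Lemma phi_word0 s k f w : dfil charC0 k f -> (k < size s)%N ->
  Rop Qaact (nwelt s) (phi_deg F L k f) w = 0.
Proof.
move=> h; elim: s w => //= i s ih w; rewrite ltnS leq_eqVlt (RopM QaactM) => /orP[/eqP e|/ih h0].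
  have := @phi_word s 0 f; rewrite addn0 -e => -> //; apply: phi_dem0.
  by apply: dfil_sdem; rewrite addn0 -e.
by rewrite (Rop_divdiff QaactM) !h0 subrr mulr0.
Qed.

(** * The graded map: multiplicativity, injectivity and image *)

Local Notation phd := (phi_deg F L).
Local Notation dfil := (@dfil R F C charC0 n A D L).
Local Notation dfilE := (@dfilE R charR0 F C charC0 n A D L).

Definition hfil : ring_filtration (demazure_dual_fil F L) := dfil_filtration charR0 F charC0 L.
Implicit Type a b : rees hfil.
Local Notation grI := (@gr_ideal _ _ hfil).

Lemma rees_dfil a i : dfil i (coefs a i).
Proof. by have /asboolP[h _] := valP a; apply/dfilE. Qed.

Lemma rees_bound a : exists N, forall i, (N <= i)%N -> coefs a i = 0.
Proof. by have /asboolP[_ h] := valP a. Qed.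

Lemma phi_deg0 k w : phd k 0 w = 0.
Proof. by rewrite (@phi_degE k 0 w 0) ?rmorph0 // (symbol0 charR0) rmorph0. Qed.

(** On the Rees ring the components are actual functions; the chosen bound on their number does not
    matter ([rees_phiE]). *)
Definition rees_phi a : W -> Qa R L :=
  fun w => \sum_(i < sval (cid (rees_bound a))) phd i (coefs a i) w.

Lemma rees_phiE a N w : (forall i, (N <= i)%N -> coefs a i = 0) ->
  rees_phi a w = \sum_(i < N) phd i (coefs a i) w.
Proof.
rewrite /rees_phi; case: cid => M /= hM hN.
have E m m' : (forall i, (m <= i)%N -> coefs a i = 0) -> (m <= m')%N ->
    \sum_(i < m') phd i (coefs a i) w = \sum_(i < m) phd i (coefs a i) w.
  move=> hm mm; rewrite (big_ord_widen m' (fun i => phd i (coefs a i) w) mm) [RHS]big_mkcond.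
  by apply: eq_bigr => i _; case: ltnP => // mi; rewrite hm // phi_deg0.
by rewrite -(E _ (maxn M N) hM (leq_maxl _ _)) (E _ (maxn M N) hN (leq_maxr _ _)).
Qed.

Lemma rees_phiB a b : rees_phi (a - b) = rees_phi a - rees_phi b.
Proof.
apply/funext => w; have [M hM] := rees_bound a; have [N hN] := rees_bound b.
have hM' i : (maxn M N <= i)%N -> coefs a i = 0.
  by rewrite geq_max => /andP[/hM].
have hN' i : (maxn M N <= i)%N -> coefs b i = 0.
  by rewrite geq_max => /andP[_ /hN].
transitivity (rees_phi a w - rees_phi b w); last by [].
rewrite (rees_phiE w hM') (rees_phiE w hN').
rewrite (@rees_phiE _ (maxn M N)); last first.
  move=> i h; have -> : coefs (a - b) i = coefs a i - coefs b i by [].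
  by rewrite (hM' _ h) (hN' _ h) subr0.
by rewrite -sumrB; apply: eq_bigr => i _; apply: (phi_degB _ (rees_dfil _ _) (rees_dfil _ _)).
Qed.

Lemma phi_deg_sum k (I : Type) (r : seq I) (E : I -> W -> Q) w :
  (forall j, dfil k (E j)) -> phd k (\sum_(j <- r) E j) w = \sum_(j <- r) phd k (E j) w.
Proof.
move=> hE; have h0 : dfil k 0 by apply/dfilE; apply: (fil0 hfil).
have hD f g : dfil k f -> dfil k g -> phd k (f + g) w = phd k f w + phd k g w.
  move=> hf hg; have hN : dfil k (0 - g).
    by apply/dfilE; apply: (filB hfil); apply/dfilE.
  have -> : f + g = f - (0 - g) by rewrite sub0r opprK.
  by rewrite (phi_degB w hf hN) (phi_degB w h0 hg) phi_deg0 sub0r opprK.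
suff [] : dfil k (\sum_(j <- r) E j) /\ phd k (\sum_(j <- r) E j) w =
  \sum_(j <- r) phd k (E j) w by [].
elim: r => [|j r [ih1 ih2]]; first by rewrite !big_nil phi_deg0.
rewrite !big_cons hD // ih2; split=> //.
have -> : E j + \sum_(j <- r) E j = E j - (0 - \sum_(j <- r) E j) by rewrite sub0r opprK.
by apply/dfilE; apply: (filB hfil); [|apply: (filB hfil)]; apply/dfilE.
Qed.

Lemma rees_phiM a b : rees_phi (a * b) = rees_phi a * rees_phi b.
Proof.
apply/funext => w; have [M hM] := rees_bound a; have [N hN] := rees_bound b.
have hM' i : (M + N <= i)%N -> coefs a i = 0.
  by move=> h; apply: hM; apply: leq_trans (leq_addr _ _) h.
have hN' i : (M + N <= i)%N -> coefs b i = 0.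
  by move=> h; apply: hN; apply: leq_trans (leq_addl _ _) h.
have abE d : coefs (a * b) d = \sum_(i < d.+1) coefs a i * coefs b (d - i)%N by [].
have z i j : (M + N <= i + j)%N -> phd i (coefs a i) w * phd j (coefs b j) w = 0.
  move=> h; have [Mi|iM] := leqP M i; first by rewrite hM // phi_deg0 mul0r.
  by rewrite [X in _ * X](_ : _ = 0) ?mulr0 // hN ?phi_deg0 //; move: h iM; lia.
transitivity (rees_phi a w * rees_phi b w); last by [].
rewrite (rees_phiE w hM') (rees_phiE w hN').
rewrite (@rees_phiE _ (M + N)); last first.
  move=> d h; rewrite abE big1 // => i _.
  have [Mi|iM] := leqP M i; first by rewrite hM // mul0r.
  by rewrite [X in _ * X]hN ?mulr0 //; move: h iM; lia.
transitivity (\sum_(d < M + N) \sum_(i < d.+1) phd i (coefs a i) w * phd (d - i)%N (coefs b (d - i)%N) w).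
  apply: eq_bigr => d _; rewrite abE phi_deg_sum.
    apply: eq_bigr => i _; rewrite -(phi_degM w (rees_dfil a i) (rees_dfil b (d - i))).
    by rewrite subnKC // -ltnS.
  move=> i; apply/dfilE.
  have e : (i + (d - i))%N = d by rewrite subnKC // -ltnS.
  rewrite -[X in demazure_dual_fil F L X]e; apply: (filM hfil); apply/dfilE; exact: rees_dfil.
rewrite (sum_triangle _ (fun i j => phd i (coefs a i) w * phd j (coefs b j) w)) mulr_suml.
apply: eq_bigr => i _; rewrite mulr_sumr.
rewrite (big_ord_widen (M + N) (fun j => phd i (coefs a i) w * phd j (coefs b j) w)
  (leq_subr _ _)) big_mkcond.
by apply: eq_bigr => j _; case: ltnP => // h; rewrite z //; move: h; lia.
Qed.

Lemma rees_phi1 : rees_phi 1 = 1.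
Proof.
apply/funext => w; rewrite (@rees_phiE _ 1) => [|i i1].
  by rewrite big_ord1 [coefs _ _](_ : _ = 1) // phi_deg1.
by rewrite [LHS](_ : _ = (i == 0%N)%:R) //; case: i i1.
Qed.

Lemma rees_phi_ideal a : a \in grI -> rees_phi a = 0.
Proof.
move=> /asboolP h; apply/funext => w; have [N hN] := rees_bound a.
rewrite (rees_phiE w hN) big1 // => i _; apply: phi_deg_eq0.
by apply/dfilE; apply: h.
Qed.

(** At each w the symbols of the components add up to 0; [sym_grade] isolates the one of degree k,
    and a vanishing symbol raises the order. *)
Lemma rees_phi_inj a : rees_phi a = 0 -> a \in grI.
Proof.
move=> h0; apply/asboolP => k; apply/dfilE; split; first by have [] := rees_dfil a k.
move=> w; have [N hN] := rees_bound a.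
have /choice[s hs] i : exists s, Iord i s /\ coefs a i w = Qin s.
  by have [_ /(_ w)[s h e]] := rees_dfil a i; exists s.
exists (s k); last by have [] := hs k.
have [/hN e|kN] := leqP N k.
  have [_] := hs k; rewrite e => e0; have -> : s k = 0.
    by apply: (Qin_inj charR0); rewrite rmorph0 -e0.
  exact: Iord0.
apply/(symbol_eq0 charR0 (hs k).1).
have : \sum_(i < N) symbol i (s i) = 0.
  apply: (Qain_inj); rewrite rmorph0 rmorph_sum.
  have := congr1 (fun f => f w) h0; rewrite (rees_phiE w hN) => e; apply: etrans e.
  by apply: eq_bigr => i _; rewrite (phi_degE _ (hs i).2).
move=> /(congr1 (sym_grade (L := L))); rewrite raddf_sum raddf0.
move=> /(congr1 (fun g => coefs g k)); rewrite coefs0 coefs_sum => e.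
rewrite -[RHS]e (bigD1 (Ordinal kN)) //= (sym_grade_symbol charR0 (hs k).1) /= eqxx big1 ?addr0 //.
move=> i ik; rewrite (sym_grade_symbol charR0 (hs i).1) /=.
by case: eqP => // e'; case/eqP: ik; apply: val_inj.
Qed.

Definition gr_phi (q : gr hfil) : W -> Qa R L := rees_phi (quo_repr q).

Lemma gr_phi_pi a : gr_phi (quo_pi grI a) = rees_phi a.
Proof. by apply/subr0_eq; rewrite -rees_phiB; apply/rees_phi_ideal/quo_repr_pi. Qed.

Lemma gr_phi_zmod : zmod_morphism gr_phi.
Proof. by move=> p q; rewrite -[p]quo_reprK -[q]quo_reprK -rmorphB !gr_phi_pi rees_phiB. Qed.
HB.instance Definition _ := GRing.isZmodMorphism.Build (gr hfil) (W -> Qa R L) gr_phi gr_phi_zmod.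

Lemma gr_phi_monoid : monoid_morphism gr_phi.
Proof.
split=> [|p q]; first by rewrite -(rmorph1 (quo_pi grI)) gr_phi_pi rees_phi1.
by rewrite -[p]quo_reprK -[q]quo_reprK -rmorphM !gr_phi_pi rees_phiM.
Qed.
HB.instance Definition _ :=
  GRing.isMonoidMorphism.Build (gr hfil) (W -> Qa R L) gr_phi gr_phi_monoid.

Lemma gr_phi_inj : injective gr_phi.
Proof.
move=> p q e; apply/subr0_eq; have : gr_phi (p - q) = 0 by rewrite gr_phi_zmod e subrr.
rewrite -[X in gr_phi X]quo_reprK gr_phi_pi => /rees_phi_inj h.
rewrite -[LHS]quo_reprK -(rmorph0 (quo_pi grI)); apply/quo_piP.
by rewrite subr0.
Qed.

Lemma gr_phi_class i f (fi : demazure_dual_fil F L i f) : gr_phi (gr_class hfil fi) = phd i f.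
Proof.
rewrite gr_phi_pi; apply/funext => w; rewrite (@rees_phiE _ i.+1); last first.
  by move=> j ij /=; rewrite gtn_eqF.
rewrite (bigD1 ord_max) //= eqxx big1 ?addr0 // => j ji.
by case: eqP => [e|_]; [case/eqP: ji; apply: val_inj|rewrite phi_deg0].
Qed.

Lemma gr_phi_ind (P : set (W -> Qa R L)) : P 0 -> (forall f g, P f -> P g -> P (f + g)) ->
  (forall i f, dfil i f -> P (phd i f)) -> forall q, P (gr_phi q).
Proof.
move=> P0 PD Pi q; have [N hN] := rees_bound (quo_repr q).
have -> : gr_phi q = \sum_(i < N) phd i (coefs (quo_repr q) i).
  by apply/funext => w; rewrite /gr_phi (rees_phiE w hN) fct_sumE.
by apply: (big_ind P) => // i _; apply/Pi/rees_dfil.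
Qed.

Lemma range_phi0 : range gr_phi 0.
Proof. by exists 0; rewrite ?raddf0. Qed.
Lemma range_phiD f g : range gr_phi f -> range gr_phi g -> range gr_phi (f + g).
Proof. by move=> [p _ <-] [q _ <-]; exists (p + q); rewrite ?raddfD. Qed.
Lemma range_phiB f g : range gr_phi f -> range gr_phi g -> range gr_phi (f - g).
Proof. by move=> [p _ <-] [q _ <-]; exists (p - q); rewrite ?raddfB. Qed.
Lemma range_phi_deg i f : dfil i f -> range gr_phi (phd i f).
Proof. by move=> /dfilE h; exists (gr_class hfil h); rewrite ?gr_phi_class. Qed.

Lemma Rop_addf z (f g : W -> Qa R L) v : Rop Qaact z (f + g) v = Rop Qaact z f v + Rop Qaact z g v.
Proof. by rewrite -big_split; apply: eq_bigr => u _; exact: mulrDr. Qed.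

(** The generators act through divided differences; a scalar acts through lifts to S of its
    homogeneous components, which raise the degree accordingly. *)
Lemma range_phi_gen z : ([set tw_scal W (Qain p) | p in setT] `|`
   [set divdiff Qaact (- eta (al i)) (s_ i) | i in setT]) z ->
  forall f, range gr_phi f -> range gr_phi (Rop Qaact z f).
Proof.
move=> hz _ [q _ <-]; move: q; apply: (@gr_phi_ind (fun g => range gr_phi (Rop Qaact z g))).
- have -> : Rop Qaact z 0 = 0; last exact: range_phi0.
  by apply/funext => v; rewrite /Rop big1 // => u _; rewrite mulr0.
- move=> f g hf hg; have -> : Rop Qaact z (f + g) = Rop Qaact z f + Rop Qaact z g.
    by apply/funext => v; exact: Rop_addf.
  exact: range_phiD.
move=> k f hf; case: hz => [[p _ <-]|[i _ <-]]; last first.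
  case: k hf => [|k] hf.
    have -> : Rop Qaact (divdiff Qaact (- eta (al i)) (s_ i)) (phd 0 f) = 0; last exact: range_phi0.
    by apply/funext => w; apply: phi_dem0.
  have -> : Rop Qaact (divdiff Qaact (- eta (al i)) (s_ i)) (phd k.+1 f) =
    phd k (fun w => - (xi (weyl_lat w (al i)) * (f w - f (w * s_ i)%g))).
    by apply/funext => w; apply: phi_dem.
  exact: (range_phi_deg (dfil_opp (dfil_simple i hf))).
have [s [N [hs es _ ep]]] := sym_decomp charR0 F p.
have hg j : dfil (j + k) (fun w => Qin (fw w (s j)) * f w).
  split; first by apply: ddual_in; have [] := hf.
  move=> w; have [_ /(_ w)[t ht ->]] := hf; exists (fw w (s j) * t); last by rewrite rmorphM.
  by apply: IordM => //; apply: fga_map_Iord.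
have -> : Rop Qaact (tw_scal W (Qain p)) (phd k f) =
    \sum_(j < N) phd (j + k) (fun w => Qin (fw w (s j)) * f w).
  apply/funext => w; rewrite Rop_nil_scal fct_sumE {1}ep !rmorph_sum mulr_suml.
  apply: eq_bigr => j _; have [_ /(_ w)[t ht e]] := hf.
  rewrite (phi_degE _ e) (@phi_degE _ _ _ (fw w (s j) * t)); last by rewrite rmorphM -e.
  rewrite (symbolM charR0 _ ht); last exact: fga_map_Iord.
  by rewrite (symbol_map charR0) // es rmorphM.
by apply: (big_ind (range gr_phi)) => [||j _];
  [exact: range_phi0|exact: range_phiD|exact: range_phi_deg].
Qed.

Lemma phi_deg_val k f w : dfil k f -> range Qain (phd k f w).
Proof. by move=> [_ /(_ w)[s _ e]]; rewrite (phi_degE _ e); exists (symbol k s). Qed.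

Lemma range_phi_val f w : range gr_phi f -> range Qain (f w).
Proof.
move=> [q _ <-]; move: q; apply: (@gr_phi_ind (fun g => range Qain (g w))).
- by exists 0; rewrite ?rmorph0.
- by move=> f1 f2 [p _ e] [q _ e']; exists (p + q); rewrite // rmorphD e e'.
by move=> k g hg; apply: phi_deg_val.
Qed.

Lemma range_phi_bound f : range gr_phi f ->
  exists N, forall w, (N <= len w)%N -> tw_eval f (nil_elt R L w) = 0.
Proof.
move=> [q _ <-]; move: q;
  apply: (@gr_phi_ind (fun g => exists N, forall w : W, (N <= len w)%N ->
    tw_eval g (nil_elt R L w) = 0)).
- by exists 0%N => w _; rewrite /tw_eval big1 // => u _; rewrite mulr0.
- move=> f1 f2 [N1 h1] [N2 h2]; exists (maxn N1 N2) => w; rewrite geq_max => /andP[/h1 e1 /h2 e2].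
  by move: e1 e2; rewrite !(tw_evalE Qaact1) Rop_addf => -> ->; rewrite addr0.
move=> k g hg; exists k.+1 => w kw; rewrite (nil_eltE) (tw_evalE Qaact1).
exact: phi_word0.
Qed.

Lemma finite_len N : finite_set [set w : W | (len w < N)%N].
Proof.
apply: (@sub_finite_set _ _ [set weyl_word D (val t) | t in @setT {bseq N of 'I_n}]).
  move=> w /= wN; have h : (size (red_word w) <= N)%N by apply: ltnW.
  by exists (Bseq h) => //=; rewrite red_wordK.
exact/finite_image/finite_finset.
Qed.

Lemma range_phi_sub f : range gr_phi f -> nil_hecke_dual R L f.
Proof.
move=> hf; split=> [z|].
  rewrite (nalgE) (tw_evalE Qaact1) => hz; apply: range_phi_val.
  apply: (tw_subalg_stable QaactM _ _ hz hf); first exact: range_phiB.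
  by move=> y g hy hg; apply: range_phi_gen.
have [N hN] := range_phi_bound hf; apply: sub_finite_set (finite_len N) => w /= h.
by rewrite ltnNge; apply/negP => /hN.
Qed.

(** The component of degree d of f(x_v) is to come from a function of degree d + len v, because x_v
    lowers degrees by len v. *)
Lemma range_phi_sup f : nil_hecke_dual R L f -> range gr_phi f.
Proof.
move=> [hf ffin]; have /choice[p hp] v : exists p, tw_eval f (nil_elt R L v) = Qain p.
  have [|p _ <-] := hf (nil_elt R L v); last by exists p.
  by rewrite (nalgE); apply: nalg_elt.
have /choice[s /choice[B hs]] v : exists s N, [/\ forall k, Iord k (s k),
      forall k, symbol k (s k) = coefs (sym_grade (p v)) k,
      forall k, (N <= k)%N -> coefs (sym_grade (p v)) k = 0 &
      p v = \sum_(k < N) coefs (sym_grade (p v)) k] := sym_decomp charR0 F (p v).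
(* The sign cancels the one in [sdem]. The value at [v] has order at least i - len v, as [dual_lift]
   requires. *)
have /choice[h hh] i : exists h : W -> Q, forall v, tw_eval h (relt v) =
    if (len v <= i)%N then (-1) ^+ len v * Qin (s v (i - len v)%N) else 0.
  exact: (red_elt_dual Qact1 QactM wlead_inv).
have dh i : dfil i (h i).
  apply: dual_lift => v; rewrite hh; case: leqP => _; last exact: IQ0.
  have [h1 _ _ _] := hs v; exists ((-1) ^+ len v * s v (i - len v)%N); first exact: IordMl.
  by rewrite rmorphM rmorphXn rmorphN rmorph1.
have ev i v : tw_eval (phd i (h i)) (nil_elt R L v) =
    if (len v <= i)%N then Qain (coefs (sym_grade (p v)) (i - len v)%N) else 0.
  rewrite (nil_eltE) (tw_evalE Qaact1); case: leqP => lv; last exact: phi_word0.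
  have [_ <- _ _] := hs v;
    have e : (size (red_word v) + (i - len v))%N = i by rewrite -/(len v) subnKC.
  have d' := dh i; rewrite -{1}e in d'; have := phi_word d';
    rewrite e => /(congr1 (fun g => g 1%g)) ->.
  apply: phi_degE; rewrite /sdem -(tw_evalE Qact1) -/(relt v) hh lv mulrA -exprD addnn.
  by rewrite -mul2n exprM sqrrN !expr1n mul1r.
(* Finite support of [f] on the x_v bounds the degrees that occur. *)
have [N hN] : exists N, forall v, p v <> 0 -> (len v + B v <= N)%N.
  have /finite_seqP[r er] := ffin; exists (\max_(v <- r) (len v + B v))%N => v pv.
  have vr : v \in r.
    have : [set w | tw_eval f (nil_elt R L w) <> 0] v.
      by rewrite /= hp => e; apply: pv; apply: (Qain_inj); rewrite e rmorph0.
    by rewrite er.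
  exact: (@leq_bigmax_seq _ r xpredT (fun v => (len v + B v)%N) v vr isT).
have -> : f = \sum_(i < N) phd i (h i).
  apply/subr0_eq; apply/funext => w; move: w; apply: (red_elt_determined Qaact1 QaactM nlead_inv).
  move=> v; rewrite -(nil_eltE) (tw_evalE Qaact1).
  have -> : Rop Qaact (nil_elt R L v) (f - \sum_(i < N) phd i (h i)) 1%g =
     tw_eval f (nil_elt R L v) - \sum_(i < N) tw_eval (phd i (h i)) (nil_elt R L v).
    rewrite [LHS]Rop_subf -(tw_evalE Qaact1); congr (_ - _).
    rewrite -(tw_evalE Qaact1) /tw_eval exchange_big; apply: eq_bigr => u _.
    by rewrite fct_sumE mulr_sumr.
  rewrite hp; apply/eqP; rewrite subr_eq0; apply/eqP.
  have [h1 h2 h3 h4] := hs v.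
  have [p0|pv] := pselect (p v = 0).
    rewrite p0 rmorph0 big1 // => i _; rewrite ev p0 raddf0 coefs0 rmorph0; by case: ifP.
  have lN := hN v pv.
  have NE : N = (len v + (N - len v))%N by lia.
  rewrite [in RHS]NE big_split_ord /= big1 ?add0r; last first.
    by move=> i _; rewrite ev leqNgt ltn_ord.
  rewrite {1}h4 rmorph_sum.
  have BN : (B v <= N - len v)%N by lia.
  rewrite (big_ord_widen (N - len v) (fun k => Qain (coefs (sym_grade (p v)) k)) BN) big_mkcond.
  apply: eq_bigr => i _; rewrite ev leq_addr addKn; case: ltnP => // /h3 ->.
  by rewrite rmorph0.
by apply: (big_ind (range gr_phi)) => [||j _];
  [exact: range_phi0|exact: range_phiD|exact: range_phi_deg].
Qed.

End MainTheorem.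

Theorem theorem5p6 (RR : realType) (R : idomainType) (charR0 : [pchar R] =i pred0)
    (F : fgl R) (n : nat) (A : 'M[int]_n) (D : root_datum RR[i] A)
    (L : demazure_lattice D) :
  exists (hfil : ring_filtration (demazure_dual_fil F L))
         (phi : {rmorphism gr hfil -> (weyl D -> Qa R L)}),
    [/\ forall i f (fi : demazure_dual_fil F L i f),
          phi (gr_class hfil fi) = phi_deg F L i f,
        injective phi
      & range phi = nil_hecke_dual R L].
Proof.
have charC0 : [pchar RR[i]] =i pred0 by exact: Num.Theory.pchar_num.
exists (hfil charR0 F charC0 L), (@gr_phi R charR0 F _ charC0 n A D L); split.
- exact: gr_phi_class.
- exact: gr_phi_inj.
by apply/seteqP; split=> f; [apply: range_phi_sub|apply: range_phi_sup].
Qed.
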